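(* Let $d\ge 1$ and let $k\ge 2$ be a fixed integer. Let $p$ and $q$ be probability densities on $\mathbb{R}^d$, let $\mathcal{M}$ denote the support of $p$, and assume that almost all points of $\mathcal{M}$ lie in its interior and that $$r_{\mathcal{M}} := \inf_{0<\delta<1}\inf_{x\in\mathcal{M}} \frac{\mathrm{Vol}\big(B(x,\delta)\cap \mathcal{M}\big)}{\mathrm{Vol}\big(B(x,\delta)\big)}>0,$$ where $B(x,R)$ is the closed Euclidean ball of radius $R$ around $x$. For each $n,m$ let $X_{1:n}=(X_1,\dots,X_n)$ be an i.i.d. sample from $p$ and $Y_{1:m}=(Y_1,\dots,Y_m)$ an i.i.d. sample from $q$. Let $\alpha,\beta\in\mathbb{R}$ with $-(k-1)/2<\alpha,\beta<(k-1)/2$. Assume: if $0<\alpha<(k-1)/2$, then $p$ is bounded away from zero and uniformly continuous; if $-(k-1)/2<\alpha<0$, then $p$ is bounded; if $0<\beta<(k-1)/2$, then $q$ is bounded away from zero and uniformly continuous; if $-(k-1)/2<\beta<0$, then $q$ is bounded. Assume moreover that $D_{\alpha,\beta}(p\|q)<\infty$ and $D_{2\alpha,2\beta}(p\|q)<\infty$, and that the estimator is asymptotically unbiased for both $(\alpha,\beta)$ and $(2\alpha,2\beta)$, i.e. $\lim_{n,m\to\infty}\mathbb{E}[\widehat D_{a,b}(X_{1:n}\|Y_{1:m})]=D_{a,b}(p\|q)$ for $(a,b)\in\{(\alpha,\beta),(2\alpha,2\beta)\}$. Then $$\lim_{n,m\to\infty}\mathbb{E}\left[\left(\widehat D_{\alpha,\beta}(X_{1:n}\|Y_{1:m})-D_{\alpha,\beta}(p\|q)\right)^2\right]=0,$$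 i.e. the estimator is $L_2$ consistent.
   Context: For real $a,b$: $D_{a,b}(p\|q)=\int_{\mathcal{M}} p^{a}(x)\,q^{b}(x)\,p(x)\,dx$. For $i=1,\dots,n$, $\rho_k(i)$ is the Euclidean distance from $X_i$ to its $k$th nearest neighbor in $X_{1:n}\setminus\{X_i\}$, and $\nu_k(i)$ is the Euclidean distance from $X_i$ to its $k$th nearest neighbor in $Y_{1:m}$. The estimator is $$\widehat D_{a,b}(X_{1:n}\|Y_{1:m})=\frac{B_{k,d,a,b}}{n(n-1)^{a}m^{b}}\sum_{i=1}^n \rho_k^{-da}(i)\,\nu_k^{-db}(i),\qquad B_{k,d,a,b}=\bar c_d^{-a-b}\frac{\Gamma(k)^2}{\Gamma(k-a)\Gamma(k-b)},$$ where $\bar c_d$ is the volume of the $d$-dimensional unit ball. *)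

(* Defs.v *)
From HB Require Import structures.
From mathcomp Require Import all_boot all_order all_algebra.
From mathcomp Require Import all_classical all_reals all_analysis.
Set Implicit Arguments.
Unset Strict Implicit.
Unset Printing Implicit Defensive.
Import Order.TTheory GRing.Theory Num.Theory.
Import numFieldNormedType.Exports.
Local Open Scope classical_set_scope.
Local Open Scope ring_scope.

(* Points of R^d are d-tuples of reals; the measurable structure on
   [d.-tuple R] is the library's product (coordinatewise) Borel sigma-algebra. *)

Section Defs.
Variable R : realType.

Definition euclid_dist (d : nat) (x y : d.-tuple R) : R :=
  Num.sqrt (\sum_(i < d) (tnth x i - tnth y i) ^+ 2).

Definition eball (d : nat) (x : d.-tuple R) (r : R) : set (d.-tuple R) :=
  [set y | euclid_dist x y <= r].

Definition box (d : nat) (a b : d.-tuple R) : set (d.-tuple R) :=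
  [set x | forall i : 'I_d, tnth a i <= tnth x i <= tnth b i].

(* [lam] is Lebesgue(-Borel) measure on R^d: the measure on the Borel sets
   giving every closed box its volume (this determines it uniquely). *)
Definition is_lebesgue (d : nat)
    (lam : {measure set (d.-tuple R) -> \bar R}) : Prop :=
  forall a b : d.-tuple R, (forall i : 'I_d, tnth a i <= tnth b i) ->
    lam (box a b) = (\prod_(i < d) (tnth b i - tnth a i))%:E.

Definition is_density (d : nat) (lam : {measure set (d.-tuple R) -> \bar R})
    (p : d.-tuple R -> R) : Prop :=
  measurable_fun setT p /\ (forall x, 0 <= p x) /\
  (\int[lam]_x (p x)%:E = 1)%E.

Definition eclosure (d : nat) (A : set (d.-tuple R)) : set (d.-tuple R) :=
  [set x | forall e : R, 0 < e -> exists y, A y /\ euclid_dist x y < e].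
Definition einterior (d : nat) (A : set (d.-tuple R)) : set (d.-tuple R) :=
  [set x | exists e : R, 0 < e /\ forall y, euclid_dist x y < e -> A y].

Definition supp (d : nat) (p : d.-tuple R -> R) : set (d.-tuple R) :=
  eclosure [set x | 0 < p x].

Definition epow (x a : R) : \bar R :=
  if (x == 0) && (a < 0) then +oo%E else (x `^ a)%:E.

Definition Dab (d : nat) (lam : {measure set (d.-tuple R) -> \bar R})
    (a b : R) (p q : d.-tuple R -> R) : \bar R :=
  (\int[lam]_(x in supp p) (epow (p x) a * epow (q x) b * (p x)%:E))%E.

Definition Gamma (s : R) : R :=
  fine (\int[lebesgue_measure]_(t in [set t : R | (0 < t)%R])
          ((t `^ (s - 1)) * expR (- t))%R%:E)%E.

Definition cbar (d : nat) (lam : {measure set (d.-tuple R) -> \bar R}) : R :=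
  fine (lam (eball [tuple of nseq d 0] 1)).

Definition knn_dist (d k : nat) (x : d.-tuple R) (s : seq (d.-tuple R)) : R :=
  nth 0 (sort <=%R [seq euclid_dist x y | y <- s]) k.-1.

Definition Bconst (d k : nat) (lam : {measure set (d.-tuple R) -> \bar R})
    (a b : R) : R :=
  cbar lam `^ (- a - b) * (Gamma k%:R ^+ 2 / (Gamma (k%:R - a) * Gamma (k%:R - b))).

(* rho_k(i) and nu_k(i) for the samples X_{1:n} = (x 0, ..., x (n-1)),
   Y_{1:m} = (y 0, ..., y (m-1)) *)
Definition rho (d k n : nat) (x : nat -> d.-tuple R) (i : nat) : R :=
  knn_dist k (x i) [seq x j | j <- iota 0 n & j != i].
Definition nu (d k m : nat) (x y : nat -> d.-tuple R) (i : nat) : R :=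
  knn_dist k (x i) [seq y j | j <- iota 0 m].

Definition Dhat (d k : nat) (lam : {measure set (d.-tuple R) -> \bar R})
    (a b : R) (n m : nat) (x y : nat -> d.-tuple R) : R :=
  Bconst k lam a b / (n%:R * ((n - 1)%:R `^ a) * (m%:R `^ b)) *
  \sum_(i < n) (rho k n x i `^ (- d%:R * a) * nu k m x y i `^ (- d%:R * b)).

Definition lim2E (u : nat -> nat -> \bar R) (l : R) : Prop :=
  forall e : R, 0 < e -> exists N : nat, forall n m : nat,
    (N <= n)%N -> (N <= m)%N -> ((l - e)%:E < u n m < (l + e)%:E)%E.

Definition mutually_independent {dT} {T : measurableType dT} (I : eqType)
    (P : probability T R) (d : nat) (Z : I -> T -> d.-tuple R) : Prop :=
  forall (s : seq I) (A : I -> set (d.-tuple R)), uniq s ->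
    (forall i, measurable (A i)) ->
    P (\bigcap_(i in [set` s]) (Z i @^-1` A i)) =
    (\prod_(i <- s) P (Z i @^-1` A i))%E.

Definition has_density {dT} {T : measurableType dT} (P : probability T R)
    (d : nat) (lam : {measure set (d.-tuple R) -> \bar R})
    (Z : T -> d.-tuple R) (p : d.-tuple R -> R) : Prop :=
  measurable_fun setT Z /\
  forall A, measurable A -> P (Z @^-1` A) = (\int[lam]_(x in A) (p x)%:E)%E.

End Defs.

(* Main.v *)
(* Since E[(Dhat - D)^2] = E[Dhat^2] - 2 D E[Dhat] + D^2 and E[Dhat] -> D, it is
   enough to show limsup E[Dhat^2] <= D^2.  Let z_i be the i-th normalized summand
   of Dhat, so that Dhat = (B/n) sum z_i.  The squares z_i^2 are the summands for
   (2 alpha, 2 beta): by hypothesis their mean is bounded, so the diagonal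
   contributes O(1/n), and it remains to prove limsup E[z_0 z_1] <= (D/B)^2.

   Fix t > 0 and call X_i far when one of its k-NN distances with nonzero exponent
   exceeds t.  Three parts are estimated separately.
   - |X_0 - X_1| <= 2 d t: z_0 z_1 <= (z_0^2 + z_1^2)/2; up to a term of order k/n,
     z_0^2 is independent of X_1, and balls of radius 2 d t have small mass.
   - X_0 or X_1 far: a weighted AM-GM inequality, whose weight at X_i is
     comparable to E[z_i^2; X_i far | X_i] / E[z_i^2 | X_i], which tends to 0
     almost surely.
   - otherwise the two summands depend on the sample through its points in the
     disjoint balls B(X_0, t) and B(X_1, t), and both are monotone in the same sense
     under insertion of points.  Hence they are negatively associated given X_0, X_1,
     so that E[z_0 z_1] is at most (1 + o(1)) (E z_0)^2, which tends to (D/B)^2. *)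
Require Import Defs.
From HB Require Import structures.
From mathcomp Require Import all_boot all_order all_algebra.
From mathcomp Require Import all_classical all_reals all_analysis.
From mathcomp Require Import measurable_realfun ring lra.
Import Order.TTheory GRing.Theory Num.Theory.
Import numFieldNormedType.Exports.
Set Implicit Arguments.
Unset Strict Implicit.
Unset Printing Implicit Defensive.
Local Open Scope classical_set_scope.
Local Open Scope ring_scope.

(** Asymptotic unbiasedness is the only limit information, and it concerns single summands, so pairs
    must be reduced to one-point means. The obstacle is the far points. The mean of z_i^2 on the far
    event tends to 0 given almost every X_i, but no uniform integrability of E[z_i^2 | X_i] is at
    hand, so plain Cauchy-Schwarz leaves a term that need not vanish. The weighted AM-GM inequality
    puts 1/th(X_0) on z_0^2, which only brings the far part up to the size of E[z_0^2], and th(X_0)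
    on z_1^2. Since z_1^2 is nearly independent of X_0, only the mean of th has to vanish, and th is
    bounded, so dominated convergence gives this. Two facts on k-NN distances do the rest. One given
    point changes such a distance only on a share k/N of the sample space, which gives near
    independence. A distance truncated at t depends on one ball only and stays monotone under
    insertion. The truncation is harmless: for a negative exponent alpha or beta it lowers the
    summand, and for a positive one its excess tends to 0 while the mean stays bounded below. *)

Section OrderStatistics.
Context {R : realType}.
Implicit Types (s : seq R) (r : R).

Lemma sorted_nth_le x0 s i r : sorted <=%R s -> (i < size s)%N ->
  (nth x0 s i <= r) = (i < count (fun z => z <= r)%R s)%N.
Proof.
elim: s i => [//|a s IH] i /= ps.
have [ar|ra] := leP a r.
  by case: i => [|i]; rewrite add1n//= !ltnS => si; rewrite IH// (path_sorted ps).
have gt z : z \in s -> r < z.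
  by move=> zs; apply: (lt_le_trans ra); move/(order_path_min le_trans)/allP: ps; apply.
rewrite add0n => si; have -> : count (fun z => z <= r)%R s = 0%N.
  by apply/eqP; rewrite -leqn0 leqNgt -has_count; apply/hasPn => z /gt; rewrite ltNge.
rewrite ltn0; apply/negbTE; rewrite -ltNge.
by case: i si => [//|i] /= si; apply: gt; exact: mem_nth.
Qed.

Lemma nth_sort_le x0 s k r : (0 < k <= size s)%N ->
  (nth x0 (sort <=%R s) k.-1 <= r) = (k <= count (fun z => z <= r)%R s)%N.
Proof.
case: k => // k /= ks; rewrite sorted_nth_le ?size_sort//; last exact: sort_le_sorted.
by have /permP -> : perm_eq (sort <=%R s) s by rewrite perm_sort.
Qed.

(** Order statistics are accessible only through their lower level sets, so equalities between them
    are proved by comparing these. *)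
Lemma le_eq_of_lower (a b : R) : (forall r, (a <= r) = (b <= r)) -> a = b.
Proof. by move=> h; apply/eqP; rewrite eq_le h lexx -h lexx. Qed.

End OrderStatistics.

(** * k-NN distances and their truncation *)

Section Knn.
Context {R : realType} {d : nat}.
Implicit Types (x y z : d.-tuple R) (s : seq (d.-tuple R)) (r t : R) (k : nat).

Lemma euclid_dist_ge0 x y : 0 <= euclid_dist x y.
Proof. exact: sqrtr_ge0. Qed.

Lemma euclid_distC x y : euclid_dist x y = euclid_dist y x.
Proof.
by rewrite /euclid_dist; congr Num.sqrt; apply: eq_bigr => i _; rewrite -sqrrN opprB.
Qed.

(** Later facts on [knn_dist] are read off from this count. The side condition excludes the default
    value 0 that [nth] returns on lists with fewer than [k] points. *)
Lemma knn_leE k x s r : (0 < k <= size s)%N ->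
  (knn_dist k x s <= r) = (k <= count (fun y => euclid_dist x y <= r)%R s)%N.
Proof. by move=> ks; rewrite /knn_dist nth_sort_le ?size_map// count_map. Qed.

Lemma knn_perm k x s s' : perm_eq s s' -> knn_dist k x s = knn_dist k x s'.
Proof.
move=> ss'; rewrite /knn_dist; congr (nth _ _ _).
by apply/perm_sort_leP; exact: perm_map.
Qed.

Lemma knn_ge0 k x s : 0 <= knn_dist k x s.
Proof.
rewrite /knn_dist.
have [ks|ks] := ltnP k.-1 (size (sort <=%R [seq euclid_dist x y | y <- s])).
  have := mem_nth 0 ks; rewrite mem_sort => /mapP[y _ ->].
  exact: euclid_dist_ge0.
by rewrite nth_default.
Qed.

Lemma knn_cat_lel k x s1 s2 : (0 < k <= size s1)%N ->
  knn_dist k x (s1 ++ s2) <= knn_dist k x s1.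
Proof.
move=> /andP[k0 ks]; rewrite knn_leE; last by rewrite k0 size_cat (leq_trans ks)// leq_addr.
rewrite count_cat (@leq_trans (count (fun y => euclid_dist x y <= knn_dist k x s1)%R s1))//.
  by rewrite -knn_leE// k0.
exact: leq_addr.
Qed.

Lemma knn_cat_ler k x s1 s2 : (0 < k <= size s2)%N ->
  knn_dist k x (s1 ++ s2) <= knn_dist k x s2.
Proof.
have /(@knn_perm k x _ _) -> : perm_eq (s1 ++ s2) (s2 ++ s1) by rewrite perm_catC.
exact: knn_cat_lel.
Qed.

Lemma knn_cons_le k x y s : (0 < k <= size s)%N ->
  knn_dist k x (y :: s) <= knn_dist k x s.
Proof. by rewrite -cat1s; exact: knn_cat_ler. Qed.

(** At a level [r <= t] the point [y] is not counted, so the count that determines the distance is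
    the same with and without it. *)
Lemma knn_cons_far k x y s t : (0 < k <= size s)%N ->
  t < euclid_dist x y -> knn_dist k x (y :: s) <= t ->
  knn_dist k x (y :: s) = knn_dist k x s.
Proof.
move=> ks ty yt; apply/eqP; rewrite eq_le knn_cons_le//=.
have ks' : (0 < k <= size (y :: s))%N by case/andP: ks => -> /leqW.
rewrite knn_leE//; move: (lexx (knn_dist k x (y :: s))).
by rewrite {1}knn_leE// [X in X -> _]/= leNgt (le_lt_trans yt ty)/= add0n.
Qed.

(* Removing a point changes the k-th order statistic only if exactly k points
   lie within it, one of which is removed. *)
Lemma count_knn_rem_neq (J : eqType) (v : J -> d.-tuple R) k x (l : seq J) :
  (0 < k < size l)%N ->
  (count (fun i => knn_dist k x [seq v j | j <- rem i l]
                   != knn_dist k x [seq v j | j <- l]) l <= k)%N.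
Proof.
move=> /andP[k0 kl].
set rho := knn_dist k x [seq v j | j <- l].
set c := count (fun j => euclid_dist x (v j) <= rho)%R l.
have kc : (k <= c)%N.
  by have := lexx rho; rewrite {1}/rho knn_leE ?size_map ?k0 ?(ltnW kl)// count_map.
have remE i : i \in l -> knn_dist k x [seq v j | j <- rem i l] <= rho ->
    knn_dist k x [seq v j | j <- rem i l] = rho.
  move=> il le; apply/eqP; rewrite eq_le le/=.
  have /(@knn_perm k x _ _) rhoE : perm_eq [seq v j | j <- l] (v i :: [seq v j | j <- rem i l]).
    by rewrite -map_cons; apply: perm_map; exact: perm_to_rem.
  rewrite /rho rhoE.
  by apply: knn_cons_le; rewrite k0 size_map size_rem// -ltnS prednK// (leq_ltn_trans _ kl).
have remle i : i \in l -> (k <= c - (euclid_dist x (v i) <= rho)%R)%N ->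
    knn_dist k x [seq v j | j <- rem i l] <= rho.
  move=> il kci; rewrite knn_leE; last first.
    by rewrite k0 size_map size_rem// -ltnS prednK// (leq_ltn_trans _ kl).
  rewrite count_map; apply: (leq_trans kci).
  by rewrite leq_subLR /c; have /permP -> := perm_to_rem il; rewrite /= addnC.
have [ck|ck] := leqP c k.
  apply: leq_trans ck; pose Q i := (i \in l) && (knn_dist k x [seq v j | j <- rem i l] != rho).
  rewrite (@eq_in_count _ _ Q) => [|i il]; last by rewrite /Q il.
  apply: sub_count => i /andP[il]; apply: contraNT => di.
  by apply/eqP/remE => //; apply: remle => //; rewrite (negbTE di) subn0.
rewrite (@leq_trans 0)// leqn0 -leqn0 leqNgt -has_count; apply/hasPn => i il.
rewrite negbK; apply/eqP/remE => //; apply: remle => //.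
by rewrite leq_subRL ?(leq_trans _ ck)//; case: (_ <= _); rewrite ?add0n ?(ltnW ck)// add1n.
Qed.

(** The default of [nth] is [t] here, not 0: with fewer than [k] points the [k]-th neighbour counts
    as lying beyond [t]. This keeps the truncated distance monotone under insertion for every list,
    however short. *)
Definition tknn k t x s : R :=
  Num.min t (nth t (sort <=%R [seq euclid_dist x y | y <- s]) k.-1).

Lemma tknn_leE k t x s r : (0 < k)%N ->
  (tknn k t x s <= r) =
  (t <= r) || (k <= count (fun y => euclid_dist x y <= r)%R s)%N.
Proof.
move=> k0; rewrite /tknn ge_min.
have [tr|tr] //= := leP t r.
have [ks|ks] := leqP k (size s).
  by rewrite nth_sort_le ?size_map ?k0// count_map.
rewrite nth_default; last by rewrite size_sort size_map -ltnS prednK.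
rewrite leNgt tr/=; apply/esym/negbTE; rewrite -ltnNge.
by rewrite (leq_ltn_trans (count_size _ _)).
Qed.

Lemma tknnE k t x s : (0 < k <= size s)%N ->
  tknn k t x s = Num.min t (knn_dist k x s).
Proof.
move=> /andP[k0 ks]; apply: le_eq_of_lower => r.
by rewrite tknn_leE// ge_min knn_leE// k0.
Qed.

Lemma tknn_le k t x s : tknn k t x s <= t.
Proof. by rewrite /tknn ge_min lexx. Qed.

Lemma tknn_ge0 k t x s : 0 <= t -> 0 <= tknn k t x s.
Proof.
move=> t0; rewrite /tknn le_min t0/=.
have [ks|ks] := ltnP k.-1 (size (sort <=%R [seq euclid_dist x y | y <- s])).
  have := mem_nth t ks; rewrite mem_sort => /mapP[y _ ->].
  exact: euclid_dist_ge0.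
by rewrite nth_default.
Qed.

Lemma tknn_insert_le k t x s1 z s2 : (0 < k)%N ->
  tknn k t x (s1 ++ z :: s2) <= tknn k t x (s1 ++ s2).
Proof.
move=> k0; rewrite tknn_leE//; move: (lexx (tknn k t x (s1 ++ s2))).
rewrite {1}tknn_leE// => /orP[->//|kc]; apply/orP; right.
by apply: (leq_trans kc); rewrite !count_cat /= leq_add2l leq_addl.
Qed.

(** Levels [r >= t] hold trivially for a truncated distance, and at levels [r < t] the point [z] is
    not counted. *)
Lemma tknn_insert_far k t x s1 z s2 : (0 < k)%N -> t <= euclid_dist x z ->
  tknn k t x (s1 ++ z :: s2) = tknn k t x (s1 ++ s2).
Proof.
move=> k0 tz; apply: le_eq_of_lower => r; rewrite !tknn_leE//.
have [//|rt] := leP t r.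
by rewrite !count_cat /= [euclid_dist x z <= r]leNgt (lt_le_trans rt tz)/= add0n.
Qed.

End Knn.

(** * Measurability for random lists of points *)

Section MeasurableKnn.
Context {R : realType} {d : nat}.
Local Notation S := (d.-tuple R).

(* Lists of points carry no measurable structure: a random list is a list of
   measurable points of fixed length, and a function of a list is called
   measurable when its composites with such random lists are. *)
Inductive mseq {dU} {U : measurableType dU} : (U -> seq S) -> Prop :=
| mseq_nil : mseq (fun=> [::])
| mseq_cons x s : measurable_fun setT x -> mseq s -> mseq (fun u => x u :: s u).

Definition mfunS (F : seq S -> R) : Prop :=
  forall dU (U : measurableType dU) (s : U -> seq S), mseq s ->
  measurable_fun setT (fun u => F (s u)).

Definition mfunXS (F : S -> seq S -> R) : Prop :=
  forall dU (U : measurableType dU) (x : U -> S) (s : U -> seq S),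
  measurable_fun setT x -> mseq s -> measurable_fun setT (fun u => F (x u) (s u)).

Definition mfunXXS (F : S -> S -> seq S -> R) : Prop :=
  forall dU (U : measurableType dU) (x y : U -> S) (s : U -> seq S),
  measurable_fun setT x -> measurable_fun setT y -> mseq s ->
  measurable_fun setT (fun u => F (x u) (y u) (s u)).

Section MseqClosure.
Context {dU} {U : measurableType dU}.
Implicit Types (x y : U -> S) (s : U -> seq S).

Lemma mseq_map (J : eqType) (v : J -> U -> S) (l : seq J) :
  (forall j, j \in l -> measurable_fun setT (v j)) ->
  mseq (fun u => [seq v j u | j <- l]).
Proof.
elim: l => [|j l IH] h /=; first exact: mseq_nil.
apply: mseq_cons; first by apply: h; rewrite mem_head.
by apply: IH => i il; apply: h; rewrite in_cons il orbT.
Qed.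

Lemma mseq_size s : mseq s -> exists n, forall u, size (s u) = n.
Proof.
elim=> [|x s' _ _ [n hn]]; first by exists 0%N.
by exists n.+1 => u /=; rewrite hn.
Qed.

Lemma measurable_euclid_dist x y : measurable_fun setT x -> measurable_fun setT y ->
  measurable_fun setT (fun u => euclid_dist (x u) (y u)).
Proof.
move=> mx my.
have -> : (fun u => euclid_dist (x u) (y u)) =
  (fun u => (\sum_(i < d) (tnth (x u) i - tnth (y u) i) ^+ 2) `^ 2^-1).
  apply/funext => u; rewrite powR12_sqrt//.
  by apply: sumr_ge0 => i _; exact: sqr_ge0.
apply: (@measurableT_comp _ _ _ _ _ _ (@powR R ^~ 2^-1)); first exact: measurable_powR.
apply: measurable_sum => i; apply: measurable_funX; apply: measurable_funB.
  exact: (@measurableT_comp _ _ _ _ _ _ (@tnth _ _ ^~ i) _ x (measurable_tnth i)).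
exact: (@measurableT_comp _ _ _ _ _ _ (@tnth _ _ ^~ i) _ y (measurable_tnth i)).
Qed.

Lemma measurable_count x s (r : R) : measurable_fun setT x -> mseq s ->
  measurable_fun setT (fun u =>
    count (fun z : S => euclid_dist (x u) z <= r)%R (s u)).
Proof.
move=> mx; elim=> [|y s' my ms IH] /=; first exact: measurable_cst.
apply: measurable_fun_addn => //.
have -> : (fun u => nat_of_bool (euclid_dist (x u) (y u) <= r)) =
   (fun u => if euclid_dist (x u) (y u) <= r then 1%N else 0%N).
  by apply/funext => u; case: ifP.
apply: measurable_fun_ifT => //; apply: measurable_fun_ler => //.
exact: measurable_euclid_dist.
Qed.

Lemma measurable_lower_level (f : U -> R) :
  (forall r, measurable_fun setT (fun u => f u <= r)) -> measurable_fun setT f.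
Proof.
move=> h mD; apply: (measurability _ (RGenOInfty.measurableE R)) => //.
move=> _ [_ [r ->] <-]; rewrite setTI.
have := h r mD [set false] I; rewrite setTI; congr measurable.
by apply/funext => u /=; rewrite in_itv/= andbT ltNge propeqE; split=> [->//|/negbTE].
Qed.

Lemma measurable_knn k x s : (0 < k)%N -> measurable_fun setT x -> mseq s ->
  measurable_fun setT (fun u => knn_dist k (x u) (s u)).
Proof.
move=> k0 mx ms; have [n sn] := mseq_size ms.
have [kn|nk] := leqP k n.
  apply: measurable_lower_level => r.
  under eq_fun do rewrite knn_leE ?sn ?k0//.
  by apply: measurable_fun_leq => //; exact: measurable_count.
have -> : (fun u => knn_dist k (x u) (s u)) = cst 0; last exact: measurable_cst.
apply/funext => u; rewrite /knn_dist nth_default//.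
by rewrite size_sort size_map sn -ltnS prednK.
Qed.

Lemma measurable_tknn k t x s : (0 < k)%N -> measurable_fun setT x -> mseq s ->
  measurable_fun setT (fun u => tknn k t (x u) (s u)).
Proof.
move=> k0 mx ms; apply: measurable_lower_level => r.
under eq_fun do rewrite tknn_leE//.
apply: measurable_or => //; apply: measurable_fun_leq => //; exact: measurable_count.
Qed.

End MseqClosure.
End MeasurableKnn.

(** * Independence of disjoint groups of sample points *)

Section Decoupling.
Context {R : realType} {dT} {T : measurableType dT} (P : probability T R).
Context {d : nat} {I : eqType}.
Local Notation S := (d.-tuple R).
Variable Z : I -> T -> S.
Hypothesis mZ : forall i, measurable_fun setT (Z i).
Hypothesis hind : mutually_independent P Z.
Implicit Types L : pred I.

Definition cylinders L : set (set T) :=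
  [set E | exists (s : seq I) (A : I -> set S), [/\ forall i, i \in s -> L i,
     forall i, measurable (A i) & E = \bigcap_(i in [set` s]) (Z i @^-1` A i)]].

(** The carrier is [T] itself, with the coarser sigma-algebra generated by the coordinates in [L]. A
    function of two outcomes can thus be measurable for different groups of coordinates in its two
    arguments. *)
Definition sigma_of L := g_sigma_algebraType (cylinders L).

Lemma cylinders_measurable L : cylinders L `<=` measurable.
Proof.
move=> _ [s [A [_ mA ->]]].
apply: fin_bigcap_measurable => [|i _]; first exact: finite_seq.
by rewrite -[X in measurable X]setTI; exact: mZ.
Qed.

Lemma sigma_of_sub L (E : set T) : measurable (E : set (sigma_of L)) -> measurable E.
Proof.
apply: smallest_sub; [exact: sigma_algebra_measurable | exact: cylinders_measurable].
Qed.

Lemma cylinders_setI L : setI_closed (cylinders L).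
Proof.
move=> _ _ [s [A [sL mA ->]]] [s' [A' [sL' mA' ->]]].
exists (s ++ s'), (fun i => (if i \in s then A i else setT) `&`
                            (if i \in s' then A' i else setT)); split.
- by move=> i; rewrite mem_cat => /orP[/sL|/sL'].
- by move=> i; apply: measurableI; case: ifP.
- apply/seteqP; split=> w.
    move=> [h1 h2] i _ /=.
    by split; case: ifP => // ii; [exact: h1 | exact: h2].
  move=> h; split=> i /= ii; have := h i; rewrite /= mem_cat ii ?orbT => /(_ isT).
    by move=> [].
  by move=> [].
Qed.

Lemma cylindersT L : cylinders L setT.
Proof.
exists [::], (fun=> setT); split => //.
by apply/seteqP; split.
Qed.

Lemma measurable_coord L i : L i -> measurable_fun [set: sigma_of L] (Z i : sigma_of L -> S).
Proof.
move=> Li _ A mA; rewrite setTI; apply: sub_sigma_algebra.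
exists [:: i], (fun j => if j == i then A else setT); split.
- by move=> j; rewrite inE => /eqP ->.
- by move=> j; case: ifP.
- apply/seteqP; split=> w.
    by move=> h j /=; rewrite inE => ji; rewrite ji; move/eqP : ji => ->.
  by move=> /(_ i); rewrite /= inE eqxx; exact.
Qed.

Lemma cylinders_indep L1 L2 E1 E2 : (forall i, L1 i -> ~~ L2 i) ->
  cylinders L1 E1 -> cylinders L2 E2 -> P (E1 `&` E2) = (P E1 * P E2)%E.
Proof.
move=> L12 [s [A [sL mA ->]]] [s' [A' [sL' mA' ->]]].
pose B i := if i \in s then A i else A' i.
have mB i : measurable (B i) by rewrite /B; case: ifP.
have dis i : i \in s' -> (i \in s) = false.
  move=> ii; apply/negbTE/negP => ii'.
  by have := L12 _ (sL _ ii'); rewrite sL'.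
(* [mutually_independent] speaks of lists without repetition, so repeated indices are dropped
   first. *)
have und (t : seq I) (C : I -> set S) : \bigcap_(i in [set` t]) (Z i @^-1` C i) =
    \bigcap_(i in [set` undup t]) (Z i @^-1` C i).
  by apply/seteqP; split=> w h i /= ii; apply: h; move: ii; rewrite /= mem_undup.
transitivity (P (\bigcap_(i in [set` undup s ++ undup s']) (Z i @^-1` B i))).
  congr (P _); apply/seteqP; split=> w.
    move=> [h1 h2] i /=; rewrite mem_cat !mem_undup /B => /orP[ii|ii].
      by rewrite ii; exact: h1.
    by rewrite dis//; exact: h2.
  move=> h; split=> i /= ii; have := h i; rewrite /= mem_cat !mem_undup /B ii ?orbT => /(_ isT) //.
  by rewrite dis.
rewrite hind//; last first.
  rewrite cat_uniq !undup_uniq andbT/=; apply/hasPn => i; rewrite !mem_undup => ii.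
  by rewrite dis.
rewrite big_cat/= (und s) (und s') !hind ?undup_uniq//; congr (_ * _)%E;
  apply: eq_big_seq => i; rewrite mem_undup /B => ii; first by rewrite ii.
by rewrite dis.
Qed.

(** Uniqueness of finite measures on a pi-system, applied to each side in turn: for fixed [E] the
    measures [P (C & E)] and [P E * P C] of [C] agree on cylinders. *)
Lemma sigma_of_indep L1 L2 (E1 : set (sigma_of L1)) (E2 : set (sigma_of L2)) :
  (forall i, L1 i -> ~~ L2 i) -> measurable E1 -> measurable E2 ->
  P ((E1 : set T) `&` (E2 : set T)) = (P E1 * P E2)%E.
Proof.
move=> L12 mE1 mE2.
have fP (E : set T) : measurable E -> P E \is a fin_num by exact: fin_num_measure.
have step L (E : set T) (mE : measurable E) :
    (forall C, cylinders L C -> P (C `&` E) = P C * P E)%E ->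
    forall C, <<s cylinders L >> C -> (P (C `&` E) = P C * P E)%E.
  move=> h C sC.
  have PE0 : 0 <= fine (P E) by rewrite fine_ge0.
  pose m2 := mscale (NngNum PE0) P.
  have : mrestr P mE C = m2 C.
    apply: (g_sigma_algebra_measure_unique (cylinders L) _ (fun=> setT)) => //.
    - exact: cylinders_measurable.
    - by move=> _; exact: cylindersT.
    - by apply/seteqP; split => // w _; exists 0%N.
    - exact: cylinders_setI.
    - move=> B cB; change (P (B `&` E) = (fine (P E))%:E * P B)%E.
      by rewrite fineK ?fP// h// muleC.
    - move=> _; change (P (setT `&` E) < +oo)%E; by rewrite setTI (le_lt_trans (probability_le1 _ _))// ltry.
  change (P (C `&` E) = (fine (P E))%:E * P C -> P (C `&` E) = P C * P E)%E.
  by rewrite fineK ?fP// muleC.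
apply: (step L1) => //; first exact: (@sigma_of_sub L2).
move=> C cC; rewrite setIC muleC.
apply: (step L2) => //; first exact: cylinders_measurable cC.
by move=> B cB; rewrite setIC muleC (@cylinders_indep L1 L2).
Qed.

Lemma measurable_id_sigma L : measurable_fun [set: T] (id : T -> sigma_of L).
Proof. by move=> _ A mA; rewrite setTI; exact: (@sigma_of_sub L). Qed.

(** By independence the diagonal map [w -> (w, w)] pushes [P] forward to the product of its two
    marginals; Tonelli's theorem then integrates the two occurrences of [w] separately. *)
Lemma decouple L1 L2 (F : T -> T -> \bar R) : (forall i, L1 i -> ~~ L2 i) ->
  (forall w1 w2, (0 <= F w1 w2)%E) ->
  measurable_fun [set: sigma_of L1 * sigma_of L2] (fun u => F u.1 u.2) ->
  (\int[P]_w F w w = \int[P]_w1 \int[P]_w2 F w1 w2)%E.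
Proof.
move=> L12 F0 mF.
pose i1 : T -> sigma_of L1 := id; pose i2 : T -> sigma_of L2 := id.
have mi1 : measurable_fun setT i1 by exact: measurable_id_sigma.
have mi2 : measurable_fun setT i2 by exact: measurable_id_sigma.
pose D : T -> (sigma_of L1 * sigma_of L2)%type := fun w => (i1 w, i2 w).
have mD : measurable_fun setT D by exact: measurable_fun_pair.
pose f1 : {mfun T >-> sigma_of L1} := HB.pack i1 (isMeasurableFun.Build _ _ _ _ _ mi1).
pose f2 : {mfun T >-> sigma_of L2} := HB.pack i2 (isMeasurableFun.Build _ _ _ _ _ mi2).
pose f12 : {mfun T >-> (sigma_of L1 * sigma_of L2)%type} :=
  HB.pack D (isMeasurableFun.Build _ _ _ _ _ mD).
pose m1 := distribution P f1; pose m2 := distribution P f2.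
pose m12 := distribution P f12.
have uni : forall X : set (sigma_of L1 * sigma_of L2), measurable X ->
    (m1 \x m2)%E X = m12 X.
  apply: product_measure_unique => A B mA mB.
  change (P ((A : set T) `&` (B : set T)) = P A * P B)%E; exact: sigma_of_indep.
transitivity (\int[m12]_u F u.1 u.2)%E.
  by rewrite /m12 /distribution (ge0_integral_pushforward mD)// => u _; exact: F0.
transitivity (\int[(m1 \x m2)%E]_u F u.1 u.2)%E.
  apply: eq_measure_integral => A mA _; exact/esym/uni.
pose G : sigma_of L1 * sigma_of L2 -> \bar R := fun u => F u.1 u.2.
have G0 u : (0 <= G u)%E by exact: F0.
rewrite (fubini_tonelli1 (m1 := m1) (m2 := m2) G mF G0).
rewrite /fubini_F /m1 /distribution (ge0_integral_pushforward mi1)//=; first last.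
- by move=> w _; apply: integral_ge0 => *; exact: F0.
- exact: (measurable_fun_fubini_tonelli_F (m2 := m2) G).
rewrite preimage_setT; apply: eq_integral => w1 _ /=.
rewrite /m2 /distribution (ge0_integral_pushforward mi2)//=.
exact: (measurable_fun_pair2 (f := fun u : sigma_of L1 * sigma_of L2 => F u.1 u.2)).
Qed.

End Decoupling.

(** * Expectations of functions of a sample *)

Section RealIntegrands.
Context {R : realType} {dT} {T : measurableType dT} (P : probability T R).
Implicit Types f g : T -> R.

Lemma integral_addr f g : measurable_fun setT f -> measurable_fun setT g ->
  (forall w, 0 <= f w) -> (forall w, 0 <= g w) ->
  (\int[P]_w (f w + g w)%:E = \int[P]_w (f w)%:E + \int[P]_w (g w)%:E)%E.
Proof.
move=> mf mg f0 g0; rewrite -ge0_integralD//.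
- by move=> w _; rewrite lee_fin.
- exact/measurable_EFinP.
- by move=> w _; rewrite lee_fin.
- exact/measurable_EFinP.
Qed.

Lemma integral_mulr (c : R) f : measurable_fun setT f -> (forall w, 0 <= f w) -> 0 <= c ->
  (\int[P]_w (c * f w)%:E = c%:E * \int[P]_w (f w)%:E)%E.
Proof.
move=> mf f0 c0; rewrite -ge0_integralZl//.
- exact/measurable_EFinP.
- by move=> w _; rewrite lee_fin.
Qed.

Lemma integral_ler f g : measurable_fun setT f -> measurable_fun setT g ->
  (forall w, 0 <= f w) -> (forall w, f w <= g w) ->
  (\int[P]_w (f w)%:E <= \int[P]_w (g w)%:E)%E.
Proof.
move=> mf mg f0 fg; apply: ge0_le_integral => //.
- by move=> w _; rewrite lee_fin.
- exact/measurable_EFinP.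
- exact/measurable_EFinP.
- by move=> w _; rewrite lee_fin.
Qed.

Lemma integral_cstr (c : R) : (\int[P]_w c%:E = c%:E)%E.
Proof. by rewrite -[RHS]mule1 -(probability_setT P) -integral_cst. Qed.

Lemma integral_ge0r f : (forall w, 0 <= f w) -> (0 <= \int[P]_w (f w)%:E)%E.
Proof. by move=> f0; apply: integral_ge0 => w _; rewrite lee_fin. Qed.

End RealIntegrands.

Section SampleExpectation.
Context {R : realType} {dT} {T : measurableType dT} (P : probability T R) {d : nat}.
Local Notation S := (d.-tuple R).

Lemma ge0_integral_same_law (U W : T -> S) (f : S -> \bar R) :
  measurable_fun setT U -> measurable_fun setT W ->
  (forall A, measurable A -> P (U @^-1` A) = P (W @^-1` A)) ->
  measurable_fun setT f -> (forall x, (0 <= f x)%E) ->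
  (\int[P]_w f (U w) = \int[P]_w f (W w))%E.
Proof.
move=> mU mW UW mf f0.
pose fU : {mfun T >-> S} := HB.pack U (isMeasurableFun.Build _ _ _ _ _ mU).
pose fW : {mfun T >-> S} := HB.pack W (isMeasurableFun.Build _ _ _ _ _ mW).
transitivity (\int[distribution P fU]_x f x)%E.
  by rewrite /distribution ge0_integral_pushforward.
transitivity (\int[distribution P fW]_x f x)%E.
  by apply: eq_measure_integral => A mA _; exact: UW.
by rewrite /distribution ge0_integral_pushforward.
Qed.

Section Family.
Variable V : nat -> T -> S.
Hypothesis mV : forall i, measurable_fun setT (V i).

Definition sample (l : seq nat) (w : T) : seq S := [seq V i w | i <- l].

Definition Ev (l : seq nat) (F : seq S -> R) : \bar R :=
  (\int[P]_w (F (sample l w))%:E)%E.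

Lemma mseq_sample l : mseq (sample l).
Proof. exact: mseq_map. Qed.

Lemma measurable_sample (F : seq S -> R) l : mfunS F ->
  measurable_fun setT (fun w => F (sample l w)).
Proof. by move=> mF; apply: mF; exact: mseq_sample. Qed.

Lemma mfunXS_fix (F : S -> seq S -> R) x : mfunXS F -> mfunS (F x).
Proof. by move=> mF dU U s ms; apply: mF. Qed.

Lemma mfunXXS_fix (F : S -> S -> seq S -> R) x : mfunXXS F -> mfunXS (F x).
Proof. by move=> mF dU U y s my ms; apply: mF. Qed.

Lemma measurable_Ev (F : S -> seq S -> R) l : mfunXS F -> (forall x s, 0 <= F x s) ->
  measurable_fun setT (fun x => Ev l (F x)).
Proof.
move=> mF F0.
pose f : S * T -> \bar R := fun u => (F u.1 (sample l u.2))%:E.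
apply: (measurable_fun_fubini_tonelli_F (m2 := P) f) => [|u]; last by rewrite lee_fin.
apply/measurable_EFinP; apply: mF => //.
by apply: mseq_map => i _; exact: (measurableT_comp (mV i)).
Qed.

Lemma Ev_ge0 l F : (forall s, 0 <= F s) -> (0 <= Ev l F)%E.
Proof. by move=> F0; exact: integral_ge0r. Qed.

Lemma le_Ev l F G : mfunS F -> mfunS G -> (forall s, 0 <= F s) ->
  (forall s, size s = size l -> F s <= G s) -> (Ev l F <= Ev l G)%E.
Proof.
move=> mF mG F0 FG; apply: ge0_le_integral => //.
- by move=> w _; rewrite lee_fin.
- by apply/measurable_EFinP; exact: measurable_sample.
- by apply/measurable_EFinP; exact: measurable_sample.
- by move=> w _; rewrite lee_fin FG// size_map.
Qed.

Lemma Ev_addr l F G : mfunS F -> mfunS G -> (forall s, 0 <= F s) ->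
  (forall s, 0 <= G s) -> (Ev l (fun s => F s + G s)%R = Ev l F + Ev l G)%E.
Proof. by move=> mF mG F0 G0; apply: integral_addr => //; exact: measurable_sample. Qed.

Lemma Ev_mulr l (c : R) F : mfunS F -> (forall s, 0 <= F s) -> 0 <= c ->
  (Ev l (fun s => c * F s)%R = c%:E * Ev l F)%E.
Proof. by move=> mF F0 c0; apply: integral_mulr => //; exact: measurable_sample. Qed.

Lemma Ev_cst l (c : R) : Ev l (fun=> c) = c%:E.
Proof. exact: integral_cstr. Qed.

Hypothesis hV : mutually_independent P V.

Lemma measurable_coord_fst (L1 L2 : pred nat) i : L1 i ->
  measurable_fun setT (fun u : sigma_of V L1 * sigma_of V L2 => V i u.1).
Proof.
move=> Li; apply: (@measurableT_comp _ _ _ _ _ _ (V i : sigma_of V L1 -> S) _ fst) => //.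
exact: measurable_coord.
Qed.

Lemma measurable_coord_snd (L1 L2 : pred nat) i : L2 i ->
  measurable_fun setT (fun u : sigma_of V L1 * sigma_of V L2 => V i u.2).
Proof.
move=> Li; apply: (@measurableT_comp _ _ _ _ _ _ (V i : sigma_of V L2 -> S) _ snd) => //.
exact: measurable_coord.
Qed.

Lemma Ev_point i l (F : S -> seq S -> R) : i \notin l -> mfunXS F -> (forall x s, 0 <= F x s) ->
  (\int[P]_w (F (V i w) (sample l w))%:E = \int[P]_w Ev l (F (V i w)))%E.
Proof.
move=> il mF F0.
rewrite (decouple (L1 := pred1 i) (L2 := mem l) mV hV
  (F := fun w1 w2 => (F (V i w1) (sample l w2))%:E))//.
- by move=> j /= /eqP ->.
- by move=> w1 w2; rewrite lee_fin.
apply/measurable_EFinP; apply: mF; first by apply: measurable_coord_fst => /=.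
by apply: mseq_map => j jl; exact: measurable_coord_snd.
Qed.

Lemma Ev_prod l1 l2 F G : ~~ has (mem l1) l2 -> mfunS F -> mfunS G ->
  (forall s, 0 <= F s) -> (forall s, 0 <= G s) ->
  (\int[P]_w (F (sample l1 w) * G (sample l2 w))%:E = Ev l1 F * Ev l2 G)%E.
Proof.
move=> l12 mF mG F0 G0.
rewrite (decouple (L1 := mem l1) (L2 := mem l2) mV hV
  (F := fun w1 w2 => (F (sample l1 w1) * G (sample l2 w2))%:E))//.
- under eq_integral => w1 _.
    under eq_integral => w2 _ do rewrite EFinM.
    rewrite ge0_integralZl//; last 3 first.
    + by apply/measurable_EFinP; exact: measurable_sample.
    + by move=> w2 _; rewrite lee_fin.
    + by rewrite lee_fin.
    over.
  rewrite ge0_integralZr//.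
  + by apply/measurable_EFinP; exact: measurable_sample.
  + by move=> w2 _; rewrite lee_fin.
  + exact: Ev_ge0.
- by move=> j /= jl1; apply: contra l12 => jl2; apply/hasP; exists j.
- by move=> w1 w2; rewrite lee_fin mulr_ge0.
apply/measurable_EFinP; apply: measurable_funM.
  by apply: mF; apply: mseq_map => j jl; exact: measurable_coord_fst.
by apply: mG; apply: mseq_map => j jl; exact: measurable_coord_snd.
Qed.

Hypothesis lV : forall i A, measurable A -> P (V i @^-1` A) = P (V 0%N @^-1` A).

Lemma int_same_law i j (f : S -> \bar R) : measurable_fun setT f ->
  (forall x, (0 <= f x)%E) -> (\int[P]_w f (V i w) = \int[P]_w f (V j w))%E.
Proof. by move=> mf f0; apply: ge0_integral_same_law => // A mA; rewrite (lV i)// (lV j). Qed.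

Lemma mfunS_cons (F : seq S -> R) : mfunS F -> mfunXS (fun x s => F (x :: s)).
Proof. by move=> mF dU U x s mx ms; apply: mF; exact: mseq_cons. Qed.

(** Independence lets the first point be frozen, and the common law lets it be called [V 0], so its
    index disappears. *)
Lemma Ev_cons i l F : i \notin l -> mfunS F -> (forall s, 0 <= F s) ->
  (Ev (i :: l) F = \int[P]_w Ev l (fun s => F (V 0%N w :: s)))%E.
Proof.
move=> il mF F0; rewrite {1}/Ev.
rewrite -[LHS]/(\int[P]_w (F (V i w :: sample l w))%:E)%E.
have F0' x t : 0 <= F (x :: t) by exact: F0.
rewrite (Ev_point il (mfunS_cons mF) F0').
apply: (int_same_law i 0%N (f := fun x => Ev l (fun s => F (x :: s)))).
  by apply: (@measurable_Ev (fun x s => F (x :: s))) => //; exact: mfunS_cons.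
by move=> x; exact: Ev_ge0.
Qed.

(** Peeling off the points with [Ev_cons] turns both sides into one iterated integral, which depends
    on the length of the list only. *)
Lemma Ev_exch l l' F : uniq l -> uniq l' -> size l = size l' -> mfunS F ->
  (forall s, 0 <= F s) -> Ev l F = Ev l' F.
Proof.
elim: l l' F => [|i l IH] [|j l'] F //= /andP[il ul] /andP[jl' ul'] [sl] mF F0.
rewrite !Ev_cons//; apply: eq_integral => w _; apply: IH => //.
by move=> dU U s ms; apply: mF; exact: mseq_cons.
Qed.

End Family.
End SampleExpectation.

(** * Negative association of statistics with disjoint supports *)

Section NegativeAssociation.
Context {R : realType} {dT} {T : measurableType dT} (P : probability T R) {d : nat}.
Local Notation S := (d.-tuple R).
Variable V : nat -> T -> S.
Hypothesis mV : forall i, measurable_fun setT (V i).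
Hypothesis hV : mutually_independent P V.
Hypothesis lV : forall i A, measurable A -> P (V i @^-1` A) = P (V 0%N @^-1` A).
Local Notation Ev := (Ev P V).

Lemma Ev_fin l (F : seq S -> R) (C : R) : mfunS F -> (forall s, 0 <= F s <= C) ->
  exists2 a, Ev l F = a%:E & 0 <= a.
Proof.
move=> mF FC.
have F0 s : 0 <= F s by case/andP: (FC s).
have : (Ev l F <= C%:E)%E.
  rewrite -(Ev_cst P V l C); apply: le_Ev => //.
  by move=> s _; case/andP: (FC s).
have := Ev_ge0 P V l F0.
by case: (Ev l F) => // a; rewrite !lee_fin => a0 _; exists a.
Qed.

Lemma mfunSM (F G : seq S -> R) : mfunS F -> mfunS G -> mfunS (fun s => F s * G s).
Proof. by move=> mF mG dU U s ms; apply: measurable_funM; [exact: mF | exact: mG]. Qed.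

Definition insert_indep (S1 : set S) (F : seq S -> R) :=
  forall s1 z s2, ~ S1 z -> F (s1 ++ z :: s2) = F (s1 ++ s2).

Definition insert_le (F : seq S -> R) :=
  forall s1 z s2, F (s1 ++ z :: s2) <= F (s1 ++ s2).

Definition insert_ge (F : seq S -> R) :=
  forall s1 z s2, F (s1 ++ s2) <= F (s1 ++ z :: s2).

(* Since S1 and S2 are disjoint, one new point z changes at most one of F and
   G, so (F_z - F)(G_z - G) = 0; integrating over z leaves
   E FG = E F E G - (E F_z - F)(E G_z - G), and the last product is >= 0. *)
Lemma negative_association (S1 S2 : set S) (F G : seq S -> R) (C : R) l :
  uniq l -> (forall z, ~ (S1 z /\ S2 z)) ->
  mfunS F -> mfunS G -> (forall s, 0 <= F s <= C) -> (forall s, 0 <= G s <= C) ->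
  insert_indep S1 F -> insert_indep S2 G ->
  (insert_le F /\ insert_le G) \/ (insert_ge F /\ insert_ge G) ->
  (Ev l (fun s => F s * G s)%R <= Ev l F * Ev l G)%E.
Proof.
move=> + S12; elim: l F G => [|i l IH] F G /=.
  move=> _ _ _ FC GC _ _ _; rewrite /Ev /sample/=.
  rewrite -![(\int[P]_w (_ [::] )%:E)%E]/(Ev [::] (fun=> _)).
  by rewrite -/(Ev [::] (fun=> F [::] * G [::])) !Ev_cst EFinM.
move=> /andP[il ul] mF mG FC GC iF iG mono.
have F0 s : 0 <= F s by case/andP: (FC s).
have G0 s : 0 <= G s by case/andP: (GC s).
have FG0 s : 0 <= F s * G s by exact: mulr_ge0.
have mFc z : mfunS (fun s => F (z :: s)) by exact: mfunXS_fix (mfunS_cons mF).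
have mGc z : mfunS (fun s => G (z :: s)) by exact: mfunXS_fix (mfunS_cons mG).
have [u0 Eu0 u0_ge0] := Ev_fin l mF FC; have [v0 Ev0 v0_ge0] := Ev_fin l mG GC.
have /choice[u hu] : forall z, exists a : R, Ev l (fun s => F (z :: s)) = a%:E /\ 0 <= a.
  by move=> z; have [|a ? ?] := Ev_fin (C := C) l (mFc z) => //; exists a.
have /choice[v hv] : forall z, exists a : R, Ev l (fun s => G (z :: s)) = a%:E /\ 0 <= a.
  by move=> z; have [|a ? ?] := Ev_fin (C := C) l (mGc z) => //; exists a.
have mu : measurable_fun setT u.
  apply/measurable_EFinP; rewrite (_ : _ \o _ = fun z => Ev l (fun s => F (z :: s))).
    by apply: (@measurable_Ev _ _ _ _ _ _ mV (fun x s => F (x :: s))) => //; exact: mfunS_cons.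
  by apply/funext => z /=; rewrite (hu z).1.
have mv : measurable_fun setT v.
  apply/measurable_EFinP; rewrite (_ : _ \o _ = fun z => Ev l (fun s => G (z :: s))).
    by apply: (@measurable_Ev _ _ _ _ _ _ mV (fun x s => G (x :: s))) => //; exact: mfunS_cons.
  by apply/funext => z /=; rewrite (hv z).1.
have muV : measurable_fun setT (fun w => u (V 0%N w)) by exact: (measurableT_comp mu).
have mvV : measurable_fun setT (fun w => v (V 0%N w)) by exact: (measurableT_comp mv).
have [A EA A0] := Ev_fin (i :: l) mF FC; have [B EB B0] := Ev_fin (i :: l) mG GC.
have IA : (\int[P]_w (u (V 0%N w))%:E = A%:E)%E.
  by rewrite -EA (Ev_cons mV hV lV)//; apply: eq_integral => w _; rewrite (hu _).1.
have IB : (\int[P]_w (v (V 0%N w))%:E = B%:E)%E.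
  by rewrite -EB (Ev_cons mV hV lV)//; apply: eq_integral => w _; rewrite (hv _).1.
(* This is [(u z - u0) * (v z - v0) = 0], arranged without subtraction so that all integrands below
   are nonnegative. *)
have uv z : u z * v z + u0 * v0 = u0 * v z + v0 * u z.
  have [S1z|S1z] := pselect (S1 z).
    have S2z : ~ S2 z by move=> ?; exact: (S12 z).
    suff -> : v z = v0 by ring.
    apply/EFin_inj; rewrite -(hv z).1 -Ev0; congr (Ev l _).
    by apply/funext => s; exact: (iG [::]).
  suff -> : u z = u0 by ring.
  apply/EFin_inj; rewrite -(hu z).1 -Eu0; congr (Ev l _).
  by apply/funext => s; exact: (iF [::]).
have IUV : (\int[P]_w (u (V 0%N w) * v (V 0%N w))%:E + (u0 * v0)%:E
            = (u0 * B + v0 * A)%:E)%E.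
  have u_ge0 w : 0 <= u (V 0%N w) by rewrite (hu _).2.
  have v_ge0 w : 0 <= v (V 0%N w) by rewrite (hv _).2.
  have uv0 : 0 <= u0 * v0 by exact: mulr_ge0.
  have uvV0 w : 0 <= u (V 0%N w) * v (V 0%N w) by exact: mulr_ge0.
  have muvV : measurable_fun setT (fun w => u (V 0%N w) * v (V 0%N w)).
    exact: measurable_funM.
  rewrite -{1}(integral_cstr P (u0 * v0)) -integral_addr//.
  under eq_integral do rewrite uv.
  have mZ (c : R) (f : T -> R) : measurable_fun setT f -> measurable_fun setT (fun w => c * f w).
    by move=> mf; exact: measurable_funM.
  rewrite integral_addr ?integral_mulr//; try by [exact: mZ | move=> w; exact: mulr_ge0].
  by rewrite IA IB.
(* Each factor is the mean effect of inserting one more point, and [mono] gives both the same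
   sign. *)
have AB : 0 <= (A - u0) * (B - v0).
  have Eu0' : (\int[P]_w (Ev l F) = u0%:E)%E by rewrite Eu0 -[LHS]/(Ev [::] (fun=> u0)) Ev_cst.
  have Ev0' : (\int[P]_w (Ev l G) = v0%:E)%E by rewrite Ev0 -[LHS]/(Ev [::] (fun=> v0)) Ev_cst.
  case: mono => -[mnF mnG].
    rewrite mulr_le0//; rewrite subr_le0 -lee_fin.
    - rewrite -EA -Eu0' (Ev_cons mV hV lV)//; apply: ge0_le_integral => //.
      + by move=> w _; exact: Ev_ge0.
      + rewrite (_ : (fun _ => _) = EFin \o (fun w => u (V 0%N w))); first exact/measurable_EFinP.
        by apply/funext => w /=; rewrite (hu _).1.
      + by move=> w _; apply: le_Ev => // s _; exact: (mnF [::]).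
    - rewrite -EB -Ev0' (Ev_cons mV hV lV)//; apply: ge0_le_integral => //.
      + by move=> w _; exact: Ev_ge0.
      + rewrite (_ : (fun _ => _) = EFin \o (fun w => v (V 0%N w))); first exact/measurable_EFinP.
        by apply/funext => w /=; rewrite (hv _).1.
      + by move=> w _; apply: le_Ev => // s _; exact: (mnG [::]).
  rewrite mulr_ge0//; rewrite subr_ge0 -lee_fin.
  - rewrite -EA -Eu0' (Ev_cons mV hV lV)//; apply: ge0_le_integral => //.
    + by move=> w _; exact: Ev_ge0.
    + rewrite (_ : (fun _ => _) = EFin \o (fun w => u (V 0%N w))); first exact/measurable_EFinP.
      by apply/funext => w /=; rewrite (hu _).1.
    + by move=> w _; apply: le_Ev => // s _; exact: (mnF [::]).
  - rewrite -EB -Ev0' (Ev_cons mV hV lV)//; apply: ge0_le_integral => //.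
    + by move=> w _; exact: Ev_ge0.
    + rewrite (_ : (fun _ => _) = EFin \o (fun w => v (V 0%N w))); first exact/measurable_EFinP.
      by apply/funext => w /=; rewrite (hv _).1.
    + by move=> w _; apply: le_Ev => // s _; exact: (mnG [::]).
rewrite EA EB (Ev_cons mV hV lV)//; last exact: mfunSM.
apply: (@le_trans _ _ (\int[P]_w (u (V 0%N w) * v (V 0%N w))%:E)%E).
  apply: ge0_le_integral => //.
  - by move=> w _; exact: Ev_ge0.
  - apply: (measurableT_comp (f := fun z => Ev l (fun s => F (z :: s) * G (z :: s)))) => //.
    apply: (@measurable_Ev _ _ _ _ _ _ mV (fun x s => F (x :: s) * G (x :: s))) => //.
    by apply: (mfunS_cons (F := fun s => F s * G s)); exact: mfunSM.
  - by apply/measurable_EFinP; exact: measurable_funM.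
  - move=> w _; rewrite EFinM -(hu _).1 -(hv _).1; apply: IH => //.
    + by move=> s1 z s2; exact: (iF (_ :: s1)).
    + by move=> s1 z s2; exact: (iG (_ :: s1)).
    + by case: mono => -[mnF mnG]; [left|right]; split => s1 z s2;
        [exact: (mnF (_ :: s1)) | exact: (mnG (_ :: s1)) |
         exact: (mnF (_ :: s1)) | exact: (mnG (_ :: s1))].
have : (\int[P]_w (u (V 0%N w) * v (V 0%N w))%:E = (u0 * B + v0 * A - u0 * v0)%:E)%E.
  by rewrite EFinB -IUV EFinM addeK.
by move=> ->; rewrite lee_fin; nra.
Qed.

End NegativeAssociation.

(** * Counts in a ball and the influence of one sample point *)

Section SampleGeometry.
Context {R : realType} {dT} {T : measurableType dT} (P : probability T R) {d : nat}.
Local Notation S := (d.-tuple R).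
Variable V : nat -> T -> S.
Hypothesis mV : forall i, measurable_fun setT (V i).
Hypothesis hV : mutually_independent P V.
Hypothesis lV : forall i A, measurable A -> P (V i @^-1` A) = P (V 0%N @^-1` A).
Local Notation Ev := (Ev P V).

Lemma measurable_indicr dU (U : measurableType dU) (b : U -> bool) :
  measurable_fun setT b -> measurable_fun setT (fun u => (b u)%:R : R).
Proof.
move=> mb; rewrite (_ : (fun _ => _) = fun u => if b u then 1 else 0 : R).
  exact: measurable_fun_ifT.
by apply/funext => u; case: (b u).
Qed.

Lemma mfunS_prod (h : S -> R) : measurable_fun setT h ->
  mfunS (fun s => \prod_(z <- s) h z).
Proof.
move=> mh dU U s; elim=> [|x s' mx _ IH].
  by under eq_fun do rewrite big_nil; exact: measurable_cst.
under eq_fun do rewrite big_cons.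
by apply: measurable_funM => //; exact: (measurableT_comp mh).
Qed.

Lemma Ev_prodh l (h : S -> R) (a : R) : uniq l -> measurable_fun setT h ->
  (forall z, 0 <= h z) -> (\int[P]_w (h (V 0%N w))%:E = a%:E)%E ->
  Ev l (fun s => \prod_(z <- s) h z) = (a ^+ size l)%:E.
Proof.
move=> + mh h0 Ha.
have p0 s : 0 <= \prod_(z <- s) h z by apply: prodr_ge0.
have a0 : 0 <= a by rewrite -lee_fin -Ha; exact: integral_ge0r.
elim: l => [_|i l IH /= /andP[il ul]].
  rewrite /Ev /sample /=; under eq_integral do rewrite big_nil.
  by rewrite integral_cstr expr0.
rewrite (Ev_cons mV hV lV)//; last exact: mfunS_prod.
under eq_integral => w _.
  rewrite (_ : (fun s => _) = (fun s => h (V 0%N w) * \prod_(z <- s) h z)); last first.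
    by apply/funext => s; rewrite big_cons.
  rewrite Ev_mulr//; last exact: mfunS_prod.
  rewrite IH// muleC -EFinM.
  over.
rewrite integral_mulr//; first by rewrite Ha exprSr EFinM.
- exact: (measurableT_comp mh).
- exact: exprn_ge0.
Qed.

Section FixedBall.
Variables (x : S) (r : R).
Let B z := (euclid_dist x z <= r)%R.

Lemma measurable_ball_pred : measurable_fun setT B.
Proof. by apply: measurable_fun_ler => //; exact: measurable_euclid_dist. Qed.

Lemma mfunS_count : mfunS (fun s => (count B s)%:R).
Proof.
move=> dU U s; elim=> [|z s' mz _ IH] /=; first exact: measurable_cst.
under eq_fun do rewrite natrD.
apply: measurable_funD => //; apply: measurable_indicr.
exact: (measurableT_comp measurable_ball_pred).
Qed.

Lemma mfunS_count_lt k : mfunS (fun s => (count B s < k)%N%:R).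
Proof.
move=> dU U s ms; apply: measurable_indicr; apply: measurable_fun_ltn => //.
exact: (measurable_count r (measurable_cst x) ms).
Qed.

Lemma mfunS_lt_count k : mfunS (fun s => (k < count B s)%N%:R).
Proof.
move=> dU U s ms; apply: measurable_indicr; apply: measurable_fun_ltn => //.
exact: (measurable_count r (measurable_cst x) ms).
Qed.

Lemma measurable_eball : measurable (eball x r).
Proof.
have := @measurable_ball_pred measurableT [set true] I; rewrite setTI.
by congr measurable; apply/seteqP; split=> z /=.
Qed.

Lemma integral_ball i : (\int[P]_w ((B (V i w))%:R)%:E = P (V 0%N @^-1` eball x r))%E.
Proof.
rewrite -(lV i measurable_eball) -[X in P X]setIT -integral_indic//; last first.
  by rewrite -[X in measurable X]setTI; apply: mV => //; exact: measurable_eball.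
apply: eq_integral => w _; rewrite indicE; congr ((nat_of_bool _)%:R%:E).
by apply/idP/idP => [?|]; [exact/mem_set | move/set_mem].
Qed.

Lemma prob_ball_fin : exists2 th, P (V 0%N @^-1` eball x r) = th%:E & 0 <= th <= 1.
Proof.
have m : measurable (V 0%N @^-1` eball x r).
  by rewrite -[X in measurable X]setTI; apply: mV => //; exact: measurable_eball.
have P0 : (0 <= P (V 0%N @^-1` eball x r))%E by exact: measure_ge0.
have P1 := probability_le1 P m.
have Pf : P (V 0%N @^-1` eball x r) \is a fin_num by exact: fin_num_measure.
by exists (fine (P (V 0%N @^-1` eball x r))); rewrite ?fineK// -!lee_fin fineK// P0.
Qed.

(** Markov's inequality in the crude form [1{k < count} <= count]. *)
Lemma Ev_lt_count k th l : uniq l -> P (V 0%N @^-1` eball x r) = th%:E ->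
  (Ev l (fun s => (k < count B s)%N%:R) <= ((size l)%:R * th)%:E)%E.
Proof.
move=> ul Eth.
have mB i : measurable_fun setT (fun w => (B (V i w))%:R : R).
  by apply: measurable_indicr; exact: (measurableT_comp measurable_ball_pred).
apply: (@le_trans _ _ (Ev l (fun s => (count B s)%:R))).
  apply: le_Ev => //; [exact: mfunS_lt_count | exact: mfunS_count |] => s _.
  by case: ltnP => // kc; rewrite ler_nat (leq_trans _ kc).
have -> : Ev l (fun s => (count B s)%:R) = (\int[P]_w \sum_(i <- l) ((B (V i w))%:R)%:E)%E.
  apply: eq_integral => w _; rewrite sumEFin; congr EFin.
  by elim: (l) => [|i l' IH] /=; rewrite ?big_nil// big_cons natrD IH.
rewrite ge0_integral_sum//; first last.
  by move=> i; exact/measurable_EFinP.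
under eq_bigr do rewrite integral_ball Eth.
by rewrite sumEFin big_const_seq iter_addr_0 count_predT mulr_natl.
Qed.

(* 1{count < k} <= 2^k 2^(-count), and 2^(-count) is a product over the points. *)
Lemma Ev_count_lt k th l : uniq l -> P (V 0%N @^-1` eball x r) = th%:E ->
  (Ev l (fun s => (count B s < k)%N%:R) <= (2 ^+ k * (1 - th / 2) ^+ size l)%:E)%E.
Proof.
move=> ul Eth.
pose h z : R := 1 - (B z)%:R / 2.
have mB : measurable_fun setT (fun z => (B z)%:R : R).
  exact: (measurable_indicr measurable_ball_pred).
have mh : measurable_fun setT h.
  by apply: measurable_funB => //; exact: measurable_funM.
have h0 z : 0 <= h z by rewrite /h; case: (B z) => /=; lra.
have Ih : (\int[P]_w (h (V 0%N w))%:E = (1 - th / 2)%:E)%E.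
  have : (\int[P]_w (h (V 0%N w))%:E + \int[P]_w (2^-1 * (B (V 0%N w))%:R)%:E = 1%:E)%E.
    rewrite -integral_addr//.
    - rewrite -[RHS](integral_cstr P); apply: eq_integral => w _; congr EFin.
      by rewrite /h mulrC subrK.
    - exact: (measurableT_comp mh).
    - by apply: measurable_funM => //; exact: (measurableT_comp mB).
  rewrite integral_mulr//; last exact: (measurableT_comp mB).
  rewrite integral_ball Eth => E1.
  by rewrite EFinB -E1 mulrC EFinM addeK.
rewrite EFinM -(Ev_prodh ul mh h0 Ih) -Ev_mulr//; first last.
- by move=> s; exact: prodr_ge0.
- exact: mfunS_prod.
apply: le_Ev => //; [exact: mfunS_count_lt | |].
  by move=> dU U s ms; apply: measurable_funM => //; exact: mfunS_prod.
move=> s _.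
have -> : \prod_(z <- s) h z = (2^-1) ^+ count B s.
  elim: s => [|z s IH]; first by rewrite big_nil.
  rewrite big_cons IH /= exprD; congr (_ * _); rewrite /h.
  by case: (B z) => /=; rewrite ?expr1 ?expr0; lra.
case: ltnP => ck; last by rewrite mulr_ge0// exprn_ge0.
rewrite exprVn ler_pdivlMr ?exprn_gt0// mul1r.
by rewrite ler_weXn2l ?ler1n// ltnW.
Qed.

End FixedBall.

Lemma mfunS_head (x : S) (h : S -> R) :
  measurable_fun setT h -> mfunS (fun s => h (head x s)).
Proof.
move=> mh dU U s [|y s' my _] /=; first exact: measurable_cst.
exact: (measurableT_comp mh).
Qed.

Lemma mfunS_behead (F : seq S -> R) : mfunS F -> mfunS (fun s => F (behead s)).
Proof. by move=> mF dU U s [|y s' my ms] /=; apply: mF => //; exact: mseq_nil. Qed.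

Lemma mfunS_knn (F : R -> R) k (x : S) : (0 < k)%N -> measurable_fun setT F ->
  mfunS (fun s => F (knn_dist k x s)).
Proof.
move=> k0 mF dU U s ms; apply: (measurableT_comp mF).
exact: (measurable_knn k0 (measurable_cst x) ms).
Qed.

(* A sample point that does not change the k-nearest-neighbour distance is
   independent of it; by exchangeability a given point changes it on a share
   k / N of the sample space. *)
Lemma Ev_knn_first_point k (x : S) i l (F : R -> R) (h : S -> R) (M a : R) :
  (0 < k <= size l)%N -> uniq (i :: l) -> measurable_fun setT F -> (forall r, 0 <= F r) ->
  measurable_fun setT h -> (forall z, 0 <= h z <= M) ->
  (\int[P]_w (h (V 0%N w))%:E <= a%:E)%E ->
  (Ev (i :: l) (fun s => F (knn_dist k x s) * h (head x s))%R <=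
   a%:E * Ev l (fun s => F (knn_dist k x s))
   + (M * k%:R / (size l).+1%:R)%:E * Ev (i :: l) (fun s => F (knn_dist k x s)))%E.
Proof.
move=> /andP[k0 kl] uil mF F0 mh hM Ha.
have h0 z : 0 <= h z by case/andP: (hM z).
have M0 : 0 <= M by case/andP: (hM x) => /le_trans; apply.
have mFk : mfunS (fun s => F (knn_dist k x s)) by exact: mfunS_knn.
pose phi s : R := F (knn_dist k x s) * (knn_dist k x (behead s) != knn_dist k x s)%:R.
have phi0 s : 0 <= phi s by rewrite mulr_ge0.
have mknn : mfunS (knn_dist k x).
  by move=> dU U s ms; exact: (measurable_knn k0 (measurable_cst x) ms).
have mphi : mfunS phi.
  move=> dU U s ms; apply: measurable_funM; first exact: mFk.
  apply: measurable_indicr.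
  apply: (@measurableT_comp _ _ _ _ _ _ negb _ (fun u => knn_dist k x (behead (s u)) == knn_dist k x (s u))) => //.
  by apply: measurable_fun_eqr; [exact: (mfunS_behead mknn) | exact: mknn].
have mhh : mfunS (fun s => h (head x s)) by exact: mfunS_head.
have mb : mfunS (fun s => F (knn_dist k x (behead s)) * h (head x s)).
  move=> dU U s ms; apply: measurable_funM; [exact: (mfunS_behead mFk) | exact: mhh].
(* If the first point does not matter, the distance is that of the remaining points; if it does,
   which is what [phi] records, [h] is bounded by [M]. *)
apply: (@le_trans _ _ (Ev (i :: l) (fun s => F (knn_dist k x (behead s)) * h (head x s) + M * phi s))).
  apply: le_Ev => //.
  - by move=> dU U s ms; apply: measurable_funM; [exact: mFk | exact: mhh].
  - move=> dU U s ms; apply: measurable_funD; first exact: mb.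
    by apply: measurable_funM => //; exact: mphi.
  - by move=> s; exact: mulr_ge0.
  - move=> s _; rewrite /phi; have [->|ne] := eqVneq (knn_dist k x (behead s)) (knn_dist k x s).
      by rewrite mulr0 mulr0 addr0.
    rewrite mulr1 addrC mulrC -subr_ge0 addrAC -mulrBl addr_ge0 ?mulr_ge0//.
    by rewrite subr_ge0; case/andP: (hM (head x s)).
rewrite Ev_addr//; first last.
- by move=> s; rewrite mulr_ge0.
- by move=> s; rewrite mulr_ge0.
- by move=> dU U s ms; apply: measurable_funM => //; exact: mphi.
apply: leeD.
  rewrite (Ev_cons mV hV lV)//; first last.
  - by move=> s; rewrite mulr_ge0.
  - by case/andP: uil.
  rewrite /=; under eq_integral => w _.
    rewrite (_ : (fun s => _) = (fun s => h (V 0%N w) * F (knn_dist k x s))); last first.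
      by apply/funext => s; rewrite mulrC.
    rewrite Ev_mulr//; over.
  rewrite ge0_integralZr//; last 3 first.
  - by apply/measurable_EFinP; exact: (measurableT_comp mh).
  - by move=> w _; rewrite lee_fin.
  - exact: Ev_ge0.
  by apply: lee_wpmul2r => //; exact: Ev_ge0.
rewrite Ev_mulr// -mulrA EFinM -muleA; apply: lee_wpmul2l; first by rewrite lee_fin.
set L := i :: l.
have -> : ((k%:R / (size l).+1%:R)%:E = ((size l).+1%:R^-1)%:E * (k%:R)%:E :> \bar R)%E.
  by rewrite -EFinM mulrC.
rewrite -muleA.
have <- : (((size l).+1%:R^-1)%:E * ((size l).+1%:R%:E * Ev L phi) = Ev L phi)%E.
  by rewrite muleA -EFinM mulVf ?mul1e ?pnatr_eq0.
apply: lee_wpmul2l; first by rewrite lee_fin.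
(* Every point of [L] may play the first one. In the sum over all of them the indicators are counted
   by [count_knn_rem_neq], at most [k] at each outcome. *)
have -> : ((size l).+1%:R%:E * Ev L phi = \sum_(j <- L) Ev (j :: rem j L) phi)%E.
  transitivity (\sum_(j <- L) Ev L phi)%E.
    rewrite big_const_seq count_predT /=.
    have := Ev_ge0 P V L phi0; move: (Ev L phi) => e e0.
    elim: (size l) => [|n IH]; first by rewrite /= mul1e adde0.
    by rewrite iterS -IH -[n.+2%:R]natr1 addrC EFinD ge0_muleDl ?lee_fin// mul1e.
  apply: eq_big_seq => j jL; apply: (Ev_exch mV hV lV) => //.
  - by rewrite cons_uniq rem_uniq// andbT mem_rem_uniq// inE eqxx.
  - by have /= -> := perm_size (perm_to_rem jL).
pose G w := F (knn_dist k x (sample V L w)).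
have mG : measurable_fun setT G by exact: (measurable_sample mV L mFk).
pose b j w := knn_dist k x (sample V (rem j L) w) != knn_dist k x (sample V L w).
have Gb j w : j \in L -> phi (sample V (j :: rem j L) w) = G w * (b j w)%:R.
  move=> jL; rewrite /phi /G /b /= -map_cons.
  have /(@knn_perm _ _ k x) <- // : perm_eq (sample V L w) [seq V i0 w | i0 <- j :: rem j L].
  by apply: perm_map; exact: perm_to_rem.
have -> : (\sum_(j <- L) Ev (j :: rem j L) phi = \sum_(j <- L) \int[P]_w (G w * (b j w)%:R)%:E)%E.
  by apply: eq_big_seq => j jL; apply: eq_integral => w _; rewrite Gb.
have mGb j : measurable_fun setT (fun w => G w * (b j w)%:R).
  apply: measurable_funM => //; apply: measurable_indicr.
  apply: (@measurableT_comp _ _ _ _ _ _ negb _ (fun w => knn_dist k x (sample V (rem j L) w) == knn_dist k x (sample V L w))) => //.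
  by apply: measurable_fun_eqr; exact: (measurable_sample mV _ mknn).
rewrite -ge0_integral_sum//; last first.
- by move=> j w _; rewrite lee_fin mulr_ge0// F0.
- by move=> j; exact/measurable_EFinP.
under eq_integral do rewrite sumEFin -mulr_sumr -natr_sum.
rewrite -Ev_mulr//; apply: integral_ler.
- under eq_fun do rewrite natr_sum mulr_sumr.
  by apply: measurable_sum => j.
- by apply: measurable_funM.
- by move=> w; rewrite mulr_ge0// F0.
- move=> w; rewrite mulrC ler_wpM2r ?F0// ler_nat.
  rewrite (eq_bigr (fun j => if b j w then 1%N else 0%N)); last by move=> j _; case: (b j w).
  by rewrite -big_mkcond/= sum1_count; apply: count_knn_rem_neq; rewrite k0.
Qed.

End SampleGeometry.

(** * Balls, boxes and their volumes *)

Section Balls.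
Context {R : realType} {d : nat}.
Local Notation S := (d.-tuple R).
Implicit Types x y z : S.

Lemma abs_coord_le_dist x y i : `|tnth x i - tnth y i| <= euclid_dist x y.
Proof.
rewrite -sqrtr_sqr /euclid_dist; apply: ler_wsqrtr.
rewrite (bigD1 i)//= lerDl; apply: sumr_ge0 => j _; exact: sqr_ge0.
Qed.

(** A cube of half-side [r / d] fits into the ball since [d * (r / d)^2 <= r^2]; the loss against
    [r / sqrt d] affects constants only. *)
Lemma dist_le_sum x y (r : R) : 0 <= r ->
  (forall i, `|tnth x i - tnth y i| <= r / d%:R) -> euclid_dist x y <= r.
Proof.
move=> r0 h.
have [d0|d0] := posnP d.
  rewrite /euclid_dist (_ : \sum_(_ < _) _ = 0) ?sqrtr0//.
  by apply: big1 => i; exfalso; have := leq_ltn_trans (leq0n i) (ltn_ord i); rewrite d0.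
rewrite -(ger0_norm r0) -sqrtr_sqr; apply: ler_wsqrtr.
apply: (@le_trans _ _ (\sum_(i < d) (r / d%:R) ^+ 2)).
  apply: ler_sum => i _; rewrite -real_normK ?num_real// ler_pXn2r// ?nnegrE//.
  by rewrite divr_ge0.
have dd : 0 < d%:R :> R by rewrite ltr0n.
rewrite sumr_const card_ord -[_ *+ d]mulr_natr.
have -> : (r / d%:R) ^+ 2 * d%:R = r ^+ 2 / d%:R by field; rewrite gt_eqF.
by rewrite ler_piMr ?sqr_ge0// invf_le1// ler1n.
Qed.

Lemma eball_sub_box x r :
  eball x r `<=` box [tuple tnth x i - r | i < d] [tuple tnth x i + r | i < d].
Proof.
move=> y xy i; rewrite !tnth_mktuple.
have := le_trans (abs_coord_le_dist x y i) xy.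
by rewrite ler_norml; lra.
Qed.

Lemma box_sub_eball x r : 0 <= r ->
  box [tuple tnth x i - r / d%:R | i < d] [tuple tnth x i + r / d%:R | i < d] `<=` eball x r.
Proof.
move=> r0 y xy; apply: dist_le_sum => // i.
have := xy i; rewrite !tnth_mktuple ler_norml; lra.
Qed.

Lemma measurable_box (a b : S) : measurable (box a b).
Proof.
rewrite (_ : box a b = \bigcap_(i in [set: 'I_d]) ((@tnth _ R ^~ i) @^-1` `[tnth a i, tnth b i])).
  apply: fin_bigcap_measurable => [|i _]; first exact: finite_finset.
  by rewrite -[X in measurable X]setTI; apply: measurable_tnth => //; exact: measurable_itv.
apply/seteqP; split=> z h i /=; first by move=> _; rewrite in_itv/=; exact: h.
by have := h i I; rewrite /= in_itv.
Qed.

Definition obox (a b : S) : set S := [set x | forall i : 'I_d, tnth a i < tnth x i < tnth b i].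

Lemma measurable_obox a b : measurable (obox a b).
Proof.
rewrite (_ : obox a b = \bigcap_(i in [set: 'I_d]) ((@tnth _ R ^~ i) @^-1` `]tnth a i, tnth b i[)).
  apply: fin_bigcap_measurable => [|i _]; first exact: finite_finset.
  by rewrite -[X in measurable X]setTI; apply: measurable_tnth => //; exact: measurable_itv.
apply/seteqP; split=> z h i /=; first by move=> _; rewrite in_itv/=; exact: h.
by have := h i I; rewrite /= in_itv.
Qed.

(** Open boxes with rational corners, numbered by [unpickle]. They replace uncountable unions by
    countable ones: in the measurability of closures, and when all balls without mass are discarded
    at once. *)
Lemma countable_base : exists F : nat -> set S, [/\ forall n, measurable (F n),
  forall x (t : R), 0 < t -> exists n, F n x /\ F n `<=` eball x t &
  forall n x, F n x -> exists2 t : R, 0 < t & eball x t `<=` F n].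
Proof.
pose toR (a : d.-tuple rat) : S := [tuple ratr (tnth a i) | i < d].
exists (fun n => if @unpickle (d.-tuple rat * d.-tuple rat)%type n is Some c
                 then obox (toR c.1) (toR c.2) else set0); split.
- by move=> n; case: unpickle => [c|]; [exact: measurable_obox | exact: measurable0].
- move=> x t t0.
  have d0 (i : 'I_d) : 0 < d%:R :> R by rewrite ltr0n; case: d i => // -[].
  have /choice[a ha] : forall i : 'I_d, exists a : rat, tnth x i - t / d%:R < ratr a < tnth x i.
    move=> i; have td : 0 < t / d%:R by rewrite divr_gt0// (d0 i).
    have /rat_in_itvoo[a] : tnth x i - t / d%:R < tnth x i by rewrite gtrBl.
    by rewrite inE/= => /andP[]; rewrite !bnd_simp => h1 h2; exists a; rewrite h1 h2.
  have /choice[b hb] : forall i : 'I_d, exists a : rat, tnth x i < ratr a < tnth x i + t / d%:R.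
    move=> i; have td : 0 < t / d%:R by rewrite divr_gt0// (d0 i).
    have /rat_in_itvoo[b] : tnth x i < tnth x i + t / d%:R by rewrite ltrDl.
    by rewrite inE/= => /andP[]; rewrite !bnd_simp => h1 h2; exists b; rewrite h1 h2.
  exists (pickle ([tuple a i | i < d], [tuple b i | i < d])); rewrite pickleK /=; split.
    move=> i; rewrite !tnth_mktuple; have /andP[_ ->] := ha i.
    by have /andP[-> _] := hb i.
  move=> y hy; apply: dist_le_sum => [|i]; first exact: ltW.
  have := hy i; rewrite !tnth_mktuple ler_norml.
  by have /andP[] := ha i; have /andP[] := hb i; clear d0; lra.
- move=> n x; case: unpickle => [c|//] hx.
  pose m i := Num.min (tnth x i - tnth (toR c.1) i) (tnth (toR c.2) i - tnth x i).
  have m0 i : 0 < m i by rewrite lt_min !subr_gt0; have /andP[-> ->] := hx i.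
  pose t := \big[Num.min/1]_(i < d) m i.
  have t0 : 0 < t by rewrite /t; elim/big_rec: _ => // i z _ z0; rewrite lt_min m0.
  have tm i : t <= m i by rewrite /t (bigD1 i)//= ge_min lexx.
  (* Half of the least gap, since [eball] is closed and the box is open. *)
  exists (t / 2); first by rewrite divr_gt0.
  move=> y xy i.
  have := le_trans (abs_coord_le_dist x y i) xy; rewrite ler_norml.
  have := tm i; rewrite /m le_min => /andP[h1 h2]; lra.
Qed.

(** Coordinates differ by at most [2 * e], and [dist_le_sum] costs a factor [d]. This weak triangle
    inequality is the origin of the separation [2 * d * t] between two sample points. *)
Lemma euclid_dist_quasi_triangle x y z (e : R) :
  euclid_dist x y <= e -> euclid_dist x z <= e -> euclid_dist y z <= 2 * d%:R * e.
Proof.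
move=> xy xz; have e0 : 0 <= e by exact: le_trans (euclid_dist_ge0 x y) xy.
apply: dist_le_sum => [|i]; first by rewrite !mulr_ge0.
have h1 := le_trans (abs_coord_le_dist x y i) xy.
have h2 := le_trans (abs_coord_le_dist x z i) xz.
have d0 : d%:R != 0 :> R by rewrite pnatr_eq0 -lt0n; case: d i {h1 h2} => // -[].
have -> : 2 * d%:R * e / d%:R = 2 * e by field.
by move: h1 h2; rewrite !ler_norml; lra.
Qed.

(** For arbitrary [A], the complement of the closure is the union of the basic boxes that miss
    [A]. *)
Lemma measurable_eclosure (A : set S) : measurable (eclosure A).
Proof.
have [F [mF F1 F2]] := countable_base.
rewrite -[X in measurable X]setCK; apply: measurableC.
have -> : ~` eclosure A = \bigcup_n (if pselect (F n `&` A = set0) then F n else set0).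
  apply/seteqP; split=> [x /existsNP[e /not_implyP[e0 h]]|x [n _]].
    have e2 : 0 < e / 2 by rewrite divr_gt0.
    have [n [Fx Fe]] := F1 x (e / 2) e2.
    exists n => //; case: pselect => // -[]; rewrite -subset0 => y [/Fe xy Ay].
    by apply: h; exists y; split => //; apply: (le_lt_trans xy); rewrite ltr_pdivrMr//; lra.
  case: pselect => // FA Fx; have [t t0 tF] := F2 _ _ Fx.
  move=> /(_ t t0)[y [Ay xy]].
  by have : (F n `&` A) y by [split => //; apply: tF; exact: ltW]; rewrite FA.
apply: bigcupT_measurable => n; case: pselect => FA; [exact: mF | exact: measurable0].
Qed.

End Balls.

Section LebesgueBalls.
Context {R : realType} {d : nat} (hd : (1 <= d)%N).
Local Notation S := (d.-tuple R).
Variable lam : {measure set S -> \bar R}.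
Hypothesis hlam : is_lebesgue lam.

Lemma lam_cube (x : S) (r : R) : 0 <= r ->
  lam (box [tuple tnth x i - r | i < d] [tuple tnth x i + r | i < d]) = ((2 * r) ^+ d)%:E.
Proof.
move=> r0; rewrite hlam => [|i]; last by rewrite !tnth_mktuple; lra.
congr EFin; rewrite (eq_bigr (fun=> 2 * r)) ?prodr_const ?card_ord// => i _.
by rewrite !tnth_mktuple; ring.
Qed.

(** Balls are compared with cubes, because [is_lebesgue] gives the volume of boxes. *)
Lemma lam_eball_le (x : S) r : 0 <= r -> (lam (eball x r) <= ((2 * r) ^+ d)%:E)%E.
Proof.
move=> r0; rewrite -(lam_cube x r0); apply: le_measure; rewrite ?inE.
- exact: measurable_eball.
- exact: measurable_box.
- exact: eball_sub_box.
Qed.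

Lemma lam_eball_ge (x : S) r : 0 <= r -> (((2 * (r / d%:R)) ^+ d)%:E <= lam (eball x r))%E.
Proof.
move=> r0; rewrite -(@lam_cube x (r / d%:R)); last by rewrite divr_ge0.
apply: le_measure; rewrite ?inE.
- exact: measurable_box.
- exact: measurable_eball.
- exact: box_sub_eball.
Qed.

Lemma cbar_gt0 : 0 < cbar lam.
Proof.
have d0 : 0 < d%:R :> R by rewrite ltr0n.
have h1 := lam_eball_ge [tuple of nseq d 0] (@ler01 R).
have h2 := lam_eball_le [tuple of nseq d 0] (@ler01 R).
rewrite /cbar fine_gt0//; apply/andP; split.
  by apply: lt_le_trans h1; rewrite lte_fin exprn_gt0// mulr_gt0// divr_gt0.
by apply: le_lt_trans h2 _; rewrite ltry.
Qed.

End LebesgueBalls.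

(** * Mass of balls under a density *)

Section Density.
Context {R : realType} {dT} {T : measurableType dT} (P : probability T R).
Context {d : nat} (hd : (1 <= d)%N).
Local Notation S := (d.-tuple R).
Variable lam : {measure set S -> \bar R}.
Hypothesis hlam : is_lebesgue lam.
Variables (V : T -> S) (p : S -> R).
Hypothesis hp : is_density lam p.
Hypothesis hV : has_density P lam V p.

Let p0 x : 0 <= p x. Proof. by case: hp => _ []. Qed.
Let mp : measurable_fun setT p. Proof. by case: hp. Qed.
Let mpE (A : set S) : measurable A -> measurable_fun A (EFin \o p).
Proof. by move=> mA; apply: measurable_funTS; exact/measurable_EFinP. Qed.
Lemma prob_null A : measurable A -> lam A = 0%E -> P (V @^-1` A) = 0%E.
Proof. by move=> mA A0; rewrite hV.2// null_set_integral//; exact: mpE. Qed.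

Lemma prob_eball0 x : P (V @^-1` eball x 0) = 0%E.
Proof.
apply: prob_null; first exact: measurable_eball.
apply/eqP; rewrite eq_le measure_ge0 andbT.
have := lam_eball_le hlam x (lexx 0); rewrite mulr0 expr0n.
by rewrite -[d == 0%N]negbK -lt0n hd.
Qed.

Lemma prob_density0 : P (V @^-1` [set x | p x = 0]) = 0%E.
Proof.
have m : measurable [set x | p x = 0].
  by have := @mp measurableT [set 0] (measurable_set1 _); rewrite setTI.
rewrite hV.2// (eq_integral (cst 0%E)) ?integral0// => x.
by rewrite inE/= => ->.
Qed.

Lemma prob_eball_le C x r : (forall y, p y <= C) -> 0 <= r ->
  (P (V @^-1` eball x r) <= (C * (2 * r) ^+ d)%:E)%E.
Proof.
move=> pC r0; have mB : measurable (eball x r) by exact: measurable_eball.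
have C0 : 0 <= C := le_trans (p0 x) (pC x).
rewrite hV.2//; apply: (@le_trans _ _ (\int[lam]_(z in eball x r) C%:E)%E).
  by apply: ge0_le_integral => //; try exact: mpE; move=> z _; rewrite lee_fin.
rewrite integral_cst// EFinM; apply: lee_wpmul2l; first by rewrite lee_fin.
exact: lam_eball_le.
Qed.

Lemma prob_eball_ge (M : set S) c rM x r : measurable M -> (forall y, M y -> c <= p y) ->
  0 <= c -> 0 <= r -> 0 <= rM ->
  (rM%:E * lam (eball x r) <= lam (eball x r `&` M))%E ->
  ((c * rM * (2 * (r / d%:R)) ^+ d)%:E <= P (V @^-1` eball x r))%E.
Proof.
move=> mM pc c0 r0 rM0 h; have mB : measurable (eball x r) by exact: measurable_eball.
have mBM : measurable (eball x r `&` M) by exact: measurableI.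
rewrite hV.2//; apply: (@le_trans _ _ (\int[lam]_(z in eball x r `&` M) (p z)%:E)%E); last first.
  by apply: ge0_subset_integral => //; try exact: mpE; move=> z _; rewrite lee_fin.
apply: (@le_trans _ _ (\int[lam]_(z in eball x r `&` M) c%:E)%E); last first.
  by apply: ge0_le_integral => //; try exact: mpE; move=> z [_ Mz]; rewrite lee_fin ?pc.
rewrite integral_cst// -mulrA EFinM; apply: lee_wpmul2l; first by rewrite lee_fin.
apply: le_trans h; rewrite EFinM; apply: lee_wpmul2l; first by rewrite lee_fin.
exact: lam_eball_ge.
Qed.

(** Absolute continuity of the integral of [p]: small volume forces small mass, and the volume bound
    for a ball does not involve its centre. *)
Lemma prob_eball_uniformly_small (e : R) : 0 < e ->
  exists2 t : R, 0 < t & forall x, (P (V @^-1` eball x t) <= e%:E)%E.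
Proof.
move=> e0.
have ip : lam.-integrable setT (EFin \o p).
  apply/integrableP; split; first by exact/measurable_EFinP.
  rewrite (eq_integral (EFin \o p)) => [|x _]; last by rewrite /= ger0_norm.
  by rewrite /comp /=; case: hp => _ [_ ->]; rewrite ltry.
have [dl [dl0 h]] := integral_normr_continuous ip e0.
(* As [t <= 1], the volume is at most [2^d * t^d <= 2^d * t <= dl / 2]. *)
pose t := Num.min 1 (dl / 2 ^+ d.+1).
have t0 : 0 < t by rewrite lt_min ltr01 divr_gt0// exprn_gt0.
exists t => // x; have mB : measurable (eball x t) by exact: measurable_eball.
have tle : (lam (eball x t) < dl%:E)%E.
  apply: (le_lt_trans (lam_eball_le hlam x (ltW t0))); rewrite lte_fin.
  rewrite exprMn; apply: (@le_lt_trans _ _ (2 ^+ d * t)).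
    rewrite ler_wpM2l ?exprn_ge0//.
    have -> : t ^+ d = t * t ^+ d.-1 by rewrite -exprS prednK.
    apply: ler_piMr; first exact: ltW.
    by apply: exprn_ile1; [exact: ltW | rewrite /t ge_min lexx].
  apply: (@le_lt_trans _ _ (2 ^+ d * (dl / 2 ^+ d.+1))).
    by rewrite ler_wpM2l ?exprn_ge0// ge_min lexx orbT.
  have -> : 2 ^+ d * (dl / 2 ^+ d.+1) = dl / 2.
    by rewrite exprS; field; rewrite gt_eqF// exprn_gt0.
  lra.
have := h _ mB tle; rewrite hV.2//.
rewrite -lte_fin fineK; last first.
  apply: (@integrable_fin_num _ _ _ lam) => //.
  apply: integrable_norm; exact: integrableS ip.
move=> /ltW; apply: le_trans; apply: ge0_le_integral => //; try exact: mpE.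
- by move=> z _; rewrite lee_fin.
- by apply/measurable_EFinP; apply: measurableT_comp => //; exact: measurable_funTS.
- by move=> z _; rewrite lee_fin ler_norm.
Qed.

End Density.

Section TwoDensities.
Context {R : realType} {dT} {T : measurableType dT} (P : probability T R).
Context {d : nat}.
Local Notation S := (d.-tuple R).
Variable lam : {measure set S -> \bar R}.
Variables (X Y : T -> S) (p q : S -> R).
Hypothesis hp : is_density lam p.
Hypothesis hq : is_density lam q.
Hypothesis hX : has_density P lam X p.
Hypothesis hY : has_density P lam Y q.

Let p0 x : 0 <= p x. Proof. by case: hp => _ []. Qed.
Let q0 x : 0 <= q x. Proof. by case: hq => _ []. Qed.
Let mp : measurable_fun setT p. Proof. by case: hp. Qed.
Let mq : measurable_fun setT q. Proof. by case: hq. Qed.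

Lemma measurable_preim A : measurable A -> measurable (X @^-1` A).
Proof. by move=> mA; rewrite -[X in measurable X]setTI; apply: hX.1. Qed.

Lemma measurable_eq0 (f : S -> R) : measurable_fun setT f -> measurable [set x | f x = 0].
Proof. by move=> mf; have := @mf measurableT [set 0] (measurable_set1 _); rewrite setTI. Qed.

Lemma measurable_pos : measurable [set x | 0 < p x].
Proof.
rewrite (_ : [set _ | _] = ~` [set x | p x = 0]); first by apply: measurableC; exact: measurable_eq0.
apply/seteqP; split=> x /=; rewrite lt0r p0 andbT; first by move/eqP.
by move/eqP.
Qed.

Lemma ae_density_gt0 : {ae P, forall w, 0 < p (X w)}.
Proof.
exists (X @^-1` [set x | p x = 0]); split.
- by apply: measurable_preim; exact: measurable_eq0.
- exact: (prob_density0 hp hX).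
- by move=> w /= /negP; rewrite lt0r p0 andbT negbK => /eqP.
Qed.

(** On a basic box without [Y]-mass, [q] vanishes almost everywhere, hence so does [p], and the box
    has no [X]-mass either. There are countably many such boxes, and every ball contains a basic box
    around its centre. *)
Lemma ae_ball_mass_gt0 : lam ([set x | 0 < p x] `&` [set x | q x = 0]) = 0%E ->
  {ae P, forall w, forall t : R, 0 < t -> (0 < P (Y @^-1` eball (X w) t))%E}.
Proof.
move=> pq0; have [F [mF F1 _]] := @countable_base R d.
have mpos := measurable_pos.
have neg n : P.-negligible (X @^-1` (if P (Y @^-1` F n) == 0%E then F n else set0)).
  case: ifPn => [/eqP Y0|_]; last by rewrite preimage_set0; exact: negligible_set0.
  apply/negligibleP; first exact: measurable_preim.
  have mD : measurable (F n `&` [set x | q x != 0]).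
    apply: measurableI => //.
    have -> : [set x | q x != 0] = ~` [set x | q x = 0] by apply/seteqP; split=> x /= /eqP.
    by apply: measurableC; exact: measurable_eq0.
  have D0 : lam (F n `&` [set x | q x != 0]) = 0%E.
    have := Y0; rewrite hY.2// => I0.
    have /(ae_eq_integral_abs lam (mF n)) : measurable_fun (F n) (EFin \o q).
      by apply: measurable_funTS; exact/measurable_EFinP.
    case=> [+ _]; rewrite (eq_integral (EFin \o q)) => [|x _]; last by rewrite /= ger0_norm.
    move=> /(_ I0)[N [mN N0 hN]]; apply/eqP; rewrite eq_le measure_ge0 andbT -N0.
    apply: le_measure; rewrite ?inE// => x [Fx /eqP qx]; apply: hN => /= h.
    by apply: qx; have := h Fx => -[].
  have XF : X @^-1` F n `<=` X @^-1` (F n `&` [set x | 0 < p x]) `|` X @^-1` [set x | p x = 0].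
    move=> w Fw /=; have := p0 (X w); rewrite le_eqVlt => /orP[/eqP <-|pw]; [by right | by left].
  have m1 : measurable (F n `&` [set x | 0 < p x]) by exact: measurableI.
  apply/eqP; rewrite eq_le measure_ge0 andbT.
  apply: (@le_trans _ _ (P (X @^-1` (F n `&` [set x | 0 < p x]) `|` X @^-1` [set x | p x = 0]))).
    apply: le_measure; rewrite ?inE//.
      exact: measurable_preim.
    apply: measurableU; apply: measurable_preim => //; exact: measurable_eq0.
  apply: (le_trans (measureU2 _ _ _)).
  - exact: measurable_preim.
  - by apply: measurable_preim; exact: measurable_eq0.
  rewrite [X in (_ + X)%E](prob_density0 hp hX) adde0 [leLHS](prob_null hp hX)//.
  apply/eqP; rewrite eq_le measure_ge0 andbT.
  have m2 : measurable ([set x | 0 < p x] `&` [set x | q x = 0]).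
    by apply: measurableI => //; exact: measurable_eq0.
  apply: (@le_trans _ _ (lam ((F n `&` [set x | q x != 0]) `|` ([set x | 0 < p x] `&` [set x | q x = 0])))).
    apply: le_measure; rewrite ?inE//; first exact: measurableU.
    by move=> x [Fx px] /=; have [q0'|q0'] := eqVneq (q x) 0; [right|left].
  by apply: (le_trans (measureU2 _ _ _)) => //; rewrite [X in (X + _)%E]D0 [X in (_ + X)%E]pq0 adde0.
have [N [mN N0 hN]] := negligible_bigcup neg.
exists N; split => // w hw; apply: hN.
move: hw => /existsNP[t /not_implyP[t0 h]].
have [n [Fx Fs]] := F1 (X w) t t0; exists n => //=.
suff -> : P (Y @^-1` F n) == 0%E by [].
rewrite eq_le measure_ge0 andbT.
apply: (@le_trans _ _ (P (Y @^-1` eball (X w) t))); last by rewrite leNgt; apply/negP.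
apply: le_measure; rewrite ?inE.
- by rewrite -[X in measurable X]setTI; apply: hY.1.
- by rewrite -[X in measurable X]setTI; apply: hY.1 => //; exact: measurable_eball.
- by move=> w' /Fs.
Qed.

Lemma supp_gt0 x : 0 < p x -> supp p x.
Proof.
move=> px e e0; exists x; split => //; apply: le_lt_trans e0.
by apply: dist_le_sum => // i; rewrite subrr normr0 mul0r.
Qed.

Lemma measurable_epow (f : S -> R) a : measurable_fun setT f ->
  measurable_fun setT (fun x => epow (f x) a).
Proof.
move=> mf; rewrite /epow; apply: measurable_fun_ifT => //.
  by apply: measurable_and => //; exact: measurable_fun_eqr.
by apply/measurable_EFinP; apply: (@measurableT_comp _ _ _ _ _ _ (@powR R ^~ a)) => //; exact: measurable_powR.
Qed.

Lemma epow_ge0 (x a : R) : (0 <= epow x a)%E.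
Proof. by rewrite /epow; case: ifP => _; rewrite ?leey// lee_fin powR_ge0. Qed.

Lemma Dab_ge0 a b : (0 <= Dab lam a b p q)%E.
Proof.
apply: integral_ge0 => x _; apply: mule_ge0; last by rewrite lee_fin.
by apply: mule_ge0; exact: epow_ge0.
Qed.

(** For [b < 0] the convention of [epow] makes the integrand infinite where [p > 0] and [q = 0], so
    a finite divergence forces this set to be null. *)
Lemma Dab_fin_null a b : b < 0 -> (Dab lam a b p q < +oo)%E ->
  lam ([set x | 0 < p x] `&` [set x | q x = 0]) = 0%E.
Proof.
move=> b0 Dfin; set A := _ `&` _.
have mA : measurable A by apply: measurableI; [exact: measurable_pos | exact: measurable_eq0].
have mf : measurable_fun setT (fun x => epow (p x) a * epow (q x) b * (p x)%:E)%E.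
  apply: emeasurable_funM; last exact/measurable_EFinP.
  by apply: emeasurable_funM; exact: measurable_epow.
have : (\int[lam]_(x in A) (epow (p x) a * epow (q x) b * (p x)%:E) < +oo)%E.
  apply: le_lt_trans Dfin; apply: ge0_subset_integral => //.
  - exact: measurable_eclosure.
  - exact: measurable_funTS.
  - move=> x _; apply: mule_ge0; last by rewrite lee_fin.
    by apply: mule_ge0; exact: epow_ge0.
  - by move=> x [px _]; exact: supp_gt0.
rewrite (eq_integral (cst +oo%E)) => [|x].
  rewrite integral_cst//; have [//|A0] := eqVneq (lam A) 0%E.
  by rewrite gt0_mulye ?lt_neqAle ?ltxx// eq_sym A0 measure_ge0.
rewrite inE => -[/= px qx]; rewrite /epow qx eqxx b0/= gt_eqF//=.
by rewrite gt0_muley ?lte_fin ?powR_gt0// gt0_mulye// lte_fin.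
Qed.

End TwoDensities.

(** * Real powers and the summands of the estimator *)

Section RealPowers.
Context {R : realType}.
Implicit Types (a b u v : R).

Lemma powR_neg_le u v b : 0 < u -> u <= v -> b <= 0 -> v `^ b <= u `^ b.
Proof.
move=> u0 uv b0; rewrite -[b]opprK powRN [leRHS]powRN.
rewrite lef_pV2 ?posrE ?powR_gt0//; last exact: lt_le_trans uv.
by rewrite ge0_ler_powR ?oppr_ge0// nnegrE ltW// (lt_le_trans u0).
Qed.

Lemma powR_pos_le u v b : 0 <= u -> u <= v -> 0 <= b -> u `^ b <= v `^ b.
Proof.
by move=> u0 uv b0; rewrite ge0_ler_powR// nnegrE// (le_trans u0).
Qed.

Lemma powR_sqr u b : (u `^ b) ^+ 2 = u `^ (2 * b).
Proof. by rewrite -powR_mulrn ?powR_ge0// -powRrM mulrC. Qed.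

(** A ball of radius [u^(1/d)] has volume of order [u], and the exponent [- d * b] of the estimator
    turns this radius into [u^(- b)]. *)
Lemma root_powR (d : nat) u b : (0 < d)%N -> 0 <= u ->
  ((u `^ (d%:R)^-1) ^+ d = u) * ((u `^ (d%:R)^-1) `^ (- d%:R * b) = u `^ (- b)).
Proof.
move=> d0 u0; have dn0 : d%:R != 0 :> R by rewrite pnatr_eq0 -lt0n.
split; first by rewrite -powR_mulrn ?powR_ge0// -powRrM mulVf// powRr1.
by rewrite -powRrM; congr (_ `^ _); field.
Qed.

(* (1 - u)(1 + u) <= 1 and Bernoulli's inequality *)
Lemma expr_onem_le u n : 0 <= u <= 1 -> (1 - u) ^+ n <= (1 + n%:R * u)^-1.
Proof.
move=> /andP[u0 u1].
have bern : 1 + n%:R * u <= (1 + u) ^+ n.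
  elim: n => [|n IH]; first by rewrite mul0r addr0 expr0.
  rewrite exprSr -natr1; apply: (@le_trans _ _ ((1 + n%:R * u) * (1 + u))).
    have : 0 <= n%:R * u * u by rewrite !mulr_ge0.
    lra.
  by rewrite ler_wpM2r// addr_ge0.
have pos : 0 < 1 + n%:R * u by rewrite ltr_pwDl// mulr_ge0.
rewrite -[leRHS]mul1r ler_pdivlMr//.
apply: (@le_trans _ _ ((1 - u) ^+ n * (1 + u) ^+ n)).
  by rewrite ler_wpM2l// exprn_ge0// subr_ge0.
rewrite -exprMn exprn_ile1//; nra.
Qed.

(** Geometric decay in [n] beats every polynomial order [j]: combine [1 - u <= exp (- u)] with
    [y <= exp y] at [y = n * u / j]. *)
Lemma expr_onem_poly u n j : 0 < u <= 1 -> (0 < j)%N -> (0 < n)%N ->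
  (1 - u) ^+ n <= (j%:R / (n%:R * u)) ^+ j.
Proof.
move=> /andP[u0 u1] j0 n0.
have jn0 : 0 < j%:R :> R by rewrite ltr0n.
have nn0 : 0 < n%:R :> R by rewrite ltr0n.
have h1 : 1 - u <= expR (- u) by have := expR_ge1Dx (- u).
have h2 : n%:R * u / j%:R <= expR (n%:R * u / j%:R).
  by have := expR_ge1Dx (n%:R * u / j%:R); lra.
have nu : 0 < n%:R * u / j%:R by rewrite divr_gt0// mulr_gt0.
apply: (@le_trans _ _ (expR (- u) ^+ n)).
  by rewrite lerXn2r// ?nnegrE ?subr_ge0// expR_ge0.
rewrite -expRM_natl.
have -> : n%:R * - u = j%:R * - (n%:R * u / j%:R) by field; rewrite gt_eqF.
rewrite expRM_natl lerXn2r// ?nnegrE ?expR_ge0//.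
  by rewrite divr_ge0// ltW// mulr_gt0.
rewrite expRN -[leRHS]invf_div lef_pV2 ?posrE ?expR_gt0//.
Qed.

End RealPowers.

Section KnnPower.
Context {R : realType} {d : nat}.
Local Notation S := (d.-tuple R).
Variable k : nat.
Hypothesis k0 : (0 < k)%N.
Implicit Types (x : S) (s : seq S) (a t : R).

(* The rescaled power of the k-NN distance: with s = X_{1:n} minus X_i and
   s = Y_{1:m}, the products over both samples are the summands of the
   estimator, with the normalization (n-1)^a m^b included. *)
Definition knn_power a x s : R := (size s)%:R `^ (- a) * knn_dist k x s `^ (- d%:R * a).

Lemma phi_ge0 a x s : 0 <= knn_power a x s.
Proof. by rewrite mulr_ge0// powR_ge0. Qed.

Lemma phi_sqr a x s : knn_power a x s ^+ 2 = knn_power (2 * a) x s.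
Proof. by rewrite /knn_power exprMn !powR_sqr; congr (_ `^ _ * _ `^ _); ring. Qed.

Lemma phi_perm a x s s' : perm_eq s s' -> knn_power a x s = knn_power a x s'.
Proof. by move=> ss; rewrite /knn_power (perm_size ss) (knn_perm k x ss). Qed.

Lemma phi0 x s : knn_power 0 x s = 1.
Proof. by rewrite /knn_power mulr0 oppr0 !powRr0 mul1r. Qed.

Lemma mfunXS_phi a : mfunXS (knn_power a).
Proof.
move=> dU U x s mx ms; have [n hn] := mseq_size ms.
rewrite (_ : (fun u => _) = (fun u => n%:R `^ (- a) * knn_dist k (x u) (s u) `^ (- d%:R * a))).
  apply: measurable_funM => //.
  apply: (@measurableT_comp _ _ _ _ _ _ (@powR R ^~ (- d%:R * a))); first exact: measurable_powR.
  exact: measurable_knn.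
by apply/funext => u; rewrite /knn_power hn.
Qed.

(* For a = 0 the power is constant and no point has to be discarded. *)
Definition knn_far a t x s : bool := (a != 0) && (t < knn_dist k x s).

Lemma mfunXS_bad a t : mfunXS (fun x s => (knn_far a t x s)%:R).
Proof.
move=> dU U x s mx ms; apply: measurable_indicr.
apply: measurable_and => //; apply: measurable_fun_ltr => //.
exact: measurable_knn.
Qed.

Lemma mfunXS_phi_bad a t : mfunXS (fun x s => knn_power a x s * (knn_far a t x s)%:R).
Proof.
move=> dU U x s mx ms; apply: measurable_funM; first exact: mfunXS_phi.
exact: mfunXS_bad.
Qed.

Lemma mfunXS_phi_good a t : mfunXS (fun x s => knn_power a x s * (~~ knn_far a t x s)%:R).
Proof.
move=> dU U x s mx ms; apply: measurable_funM; first exact: mfunXS_phi.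
rewrite (_ : (fun u => _) = (fun u => 1 - (knn_far a t (x u) (s u))%:R)); last first.
  by apply/funext => u; case: knn_far; rewrite ?subr0 ?subrr.
by apply: measurable_funB => //; exact: mfunXS_bad.
Qed.

End KnnPower.

(** * Lower bounds for the mean of a rescaled power *)

Section PowerMeanBounds.
Context {R : realType} {dT} {T : measurableType dT} (P : probability T R).
Context {d : nat} (hd : (0 < d)%N).
Local Notation S := (d.-tuple R).
Variable V : nat -> T -> S.
Hypothesis mV : forall i, measurable_fun setT (V i).
Hypothesis hV : mutually_independent P V.
Hypothesis lV : forall i A, measurable A -> P (V i @^-1` A) = P (V 0%N @^-1` A).
Variable k : nat.
Hypothesis k0 : (0 < k)%N.
Local Notation Ev := (Ev P V).
Local Notation phi := (knn_power k).
Local Notation mphi := (mfunXS_phi k0).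

(** Only radii below 1, for which the support is assumed to fill a fixed share of the ball. *)
Definition mass_ge (c : R) (x : S) := forall r : R, 0 < r < 1 ->
  ((c * r ^+ d)%:E <= P (V 0%N @^-1` eball x r))%E.

Definition mass_le (C : R) (x : S) := forall r : R, 0 <= r ->
  (P (V 0%N @^-1` eball x r) <= (C * r ^+ d)%:E)%E.

(** [powR] sends 0 to 0 for every nonzero exponent, so at distance 0 the power would vanish instead
    of being infinite when [a > 0]. The absence of an atom makes this event null. *)
Definition no_atom (x : S) := P (V 0%N @^-1` eball x 0) = 0%E.

Lemma Ev_count0 x l : uniq l -> no_atom x ->
  Ev l (fun s => (0 < count (fun z : S => euclid_dist x z <= 0)%R s)%N%:R) = 0%E.
Proof.
move=> ul na; apply/eqP; rewrite eq_le; apply/andP; split.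
  by have := Ev_lt_count mV lV 0 ul na; rewrite mulr0.
by apply: Ev_ge0 => s.
Qed.

(** The ball with [r^d = K / N] has mass at least [c * K / N], so with probability at least 1/2 it
    holds [k] sample points. The rescaled power is then at least [K^(- a)], whatever [N] is. *)
Lemma Ev_phi_ge_pos (a c : R) : 0 < a -> 0 < c ->
  exists2 c1 : R, 0 < c1 & exists N1 : nat, forall x l,
    mass_ge c x -> no_atom x -> uniq l -> (N1 <= size l)%N ->
    (c1%:E <= Ev l (phi a x))%E.
Proof.
(* With this [K], [N * th / 2 >= 2 * 2^k], which brings the bound [2^k * (1 - th / 2)^N] below
   1/2. *)
move=> a0 c0; pose K : R := 4 * 2 ^+ k / c.
have K0 : 0 < K by rewrite divr_gt0// mulr_gt0// exprn_gt0.
exists (K `^ (- a) / 2); first by rewrite divr_gt0// powR_gt0.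
(* [N > K] keeps the radius below 1, as [mass_ge] requires. *)
exists (maxn k (Num.truncn K).+1) => x l mx na ul; rewrite geq_max => /andP[kl Kl].
set N := size l.
have KN : K < N%:R by apply: lt_le_trans (truncnS_gt K) _; rewrite ler_nat.
have N0 : 0 < N%:R :> R by exact: lt_trans KN.
have KN01 : 0 < K / N%:R < 1 by rewrite divr_gt0//= ltr_pdivrMr// mul1r.
have KN0 : 0 <= K / N%:R by case/andP: KN01 => /ltW.
pose r := (K / N%:R) `^ (d%:R)^-1.
have [rd ra] := root_powR a hd KN0.
have r01 : 0 < r < 1.
  have [KN1 KN2] := andP KN01; rewrite powR_gt0//=.
  rewrite ltNge; apply/negP => r1; have := exprn_ege1 d r1.
  by rewrite rd leNgt KN2.
have [r0 _] := andP r01.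
have [th Eth /andP[th0 th1]] := prob_ball_fin P mV x r.
have thK : c * (K / N%:R) <= th by rewrite -lee_fin -Eth -rd; exact: mx.
have hcount : (Ev l (fun s => (count (fun z : S => euclid_dist x z <= r)%R s < k)%N%:R)
               <= (2^-1)%:E)%E.
  apply: (le_trans (Ev_count_lt mV hV lV k ul Eth)); rewrite lee_fin.
  have th2 : 0 <= th / 2 <= 1 by lra.
  apply: (@le_trans _ _ (2 ^+ k * (1 + N%:R * (th / 2))^-1)).
    by rewrite ler_wpM2l ?exprn_ge0//; exact: expr_onem_le.
  have h4 : 2 * 2 ^+ k <= N%:R * (th / 2).
    have -> : 2 * 2 ^+ k = N%:R * (c * (K / N%:R) / 2).
      by rewrite /K; field; rewrite !gt_eqF.
    by rewrite ler_wpM2l// ler_pM2r.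
  have e0 : 0 < 2 ^+ k :> R by rewrite exprn_gt0.
  rewrite ler_pdivrMr; last by nra.
  by lra.
have v0 : 0 < K `^ (- a) by rewrite powR_gt0.
pose E1 s : R := (count (fun z : S => euclid_dist x z <= r)%R s < k)%N%:R.
pose E2 s : R := (0 < count (fun z : S => euclid_dist x z <= 0)%R s)%N%:R.
have mE1 : mfunS E1 by exact: mfunS_count_lt.
have mE2 : mfunS E2 by exact: mfunS_lt_count.
have key s : size s = N -> K `^ (- a) <= phi a x s + K `^ (- a) * (E1 s + E2 s).
  move=> sN; have ks : (0 < k <= size s)%N by rewrite k0 sN.
  have p0 := phi_ge0 k a x s.
  rewrite /E1; case: ltnP => hc.
    by rewrite /E2; case: (0 < _)%N; rewrite /= ?mulr1 ?mulr0; nra.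
  rewrite /E2; case: ltnP => hc0; first by rewrite /=; nra.
  rewrite /= addr0 mulr0 addr0 /knn_power sN.
  have knn_r : knn_dist k x s <= r by rewrite knn_leE.
  have knn0 : 0 < knn_dist k x s.
    rewrite ltNge knn_leE// -ltnNge; apply: leq_ltn_trans hc0 _; exact: k0.
  apply: (@le_trans _ _ (N%:R `^ (- a) * r `^ (- d%:R * a))).
    rewrite ra -powRM//; rewrite le_eqVlt; apply/orP; left; apply/eqP; congr (_ `^ _).
    by field; rewrite gt_eqF.
  rewrite ler_wpM2l ?powR_ge0//; apply: powR_neg_le => //.
  by rewrite mulNr oppr_le0 mulr_ge0// ltW.
have : ((K `^ (- a))%:E <= Ev l (phi a x) + (K `^ (- a))%:E * (2^-1)%:E)%E.
  rewrite -[leLHS](Ev_cst P V l).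
  apply: (@le_trans _ _ (Ev l (fun s => phi a x s + K `^ (- a) * (E1 s + E2 s)))).
    apply: le_Ev => //.
    - move=> dU U s ms; apply: measurable_funD; first exact: (mphi a (measurable_cst x) ms).
      apply: measurable_funM => //; apply: measurable_funD; [exact: mE1 | exact: mE2].
    - by move=> s; exact: ltW.
  have mE : mfunS (fun s => E1 s + E2 s).
    by move=> dU U s ms; apply: measurable_funD; [exact: mE1 | exact: mE2].
  rewrite Ev_addr//; first last.
  - by move=> s; rewrite mulr_ge0 ?addr_ge0// ltW.
  - by move=> s; exact: phi_ge0.
  - by move=> dU U s ms; apply: measurable_funM => //; exact: mE.
  - by move=> dU U s ms; exact: (mphi a (measurable_cst x) ms).
  rewrite leeD2l// Ev_mulr//; [|by move=> s; rewrite addr_ge0|exact: ltW].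
  apply: lee_wpmul2l; first by rewrite lee_fin ltW.
  by rewrite Ev_addr// Ev_count0// adde0.
have := Ev_ge0 P V l (phi_ge0 k a x).
case: (Ev l (phi a x)) => [e| |//]; last by rewrite !leey.
by rewrite -EFinM -EFinD !lee_fin => _; lra.
Qed.

(** Now large distances are wanted. The ball with [r^d = K / N] has mass at most
    [C * K / N = 1 / (2 * N)], so by Markov's inequality it is empty with probability at least
    1/2. *)
Lemma Ev_phi_ge_neg (a C : R) : a < 0 -> 0 < C ->
  exists2 c1 : R, 0 < c1 & forall x l,
    mass_le C x -> uniq l -> (k <= size l)%N -> (c1%:E <= Ev l (phi a x))%E.
Proof.
move=> a0 C0; pose K : R := (2 * C)^-1.
have K0 : 0 < K by rewrite invr_gt0 mulr_gt0.
exists (K `^ (- a) / 2); first by rewrite divr_gt0// powR_gt0.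
move=> x l mx ul kl; set N := size l.
have N0 : 0 < N%:R :> R by rewrite ltr0n; exact: leq_trans kl.
have KN0 : 0 <= K / N%:R by rewrite divr_ge0// ltW.
pose r := (K / N%:R) `^ (d%:R)^-1.
have [rd ra] := root_powR a hd KN0.
have r0 : 0 <= r by exact: powR_ge0.
have [th Eth /andP[th0 th1]] := prob_ball_fin P mV x r.
have thK : th <= C * (K / N%:R) by rewrite -lee_fin -Eth -rd; exact: mx.
pose E1 s : R := (0 < count (fun z : S => euclid_dist x z <= r)%R s)%N%:R.
have mE1 : mfunS E1 by exact: mfunS_lt_count.
have v0 : 0 < K `^ (- a) by rewrite powR_gt0.
have hcount : (Ev l E1 <= (2^-1)%:E)%E.
  apply: (le_trans (Ev_lt_count mV lV 0 ul Eth)); rewrite lee_fin.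
  apply: (@le_trans _ _ (N%:R * (C * (K / N%:R)))); first by rewrite ler_wpM2l.
  rewrite le_eqVlt; apply/orP; left; apply/eqP; rewrite /K; field; rewrite !gt_eqF//.
have key s : size s = N -> K `^ (- a) <= phi a x s + K `^ (- a) * E1 s.
  move=> sN; have ks : (0 < k <= size s)%N by rewrite k0 sN.
  have p0 := phi_ge0 k a x s.
  rewrite /E1; case: ltnP => hc0; first by rewrite /= mulr1; lra.
  rewrite /= mulr0 addr0 /knn_power sN.
  have knn_r : r <= knn_dist k x s.
    by rewrite ltW// ltNge knn_leE// -ltnNge (leq_ltn_trans hc0).
  apply: (@le_trans _ _ (N%:R `^ (- a) * r `^ (- d%:R * a))).
    rewrite ra -powRM//; rewrite le_eqVlt; apply/orP; left; apply/eqP; congr (_ `^ _).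
    by field; rewrite gt_eqF.
  rewrite ler_wpM2l ?powR_ge0//; apply: powR_pos_le => //.
  by rewrite mulNr -mulrN mulr_ge0// oppr_ge0 ltW.
have : ((K `^ (- a))%:E <= Ev l (phi a x) + (K `^ (- a))%:E * (2^-1)%:E)%E.
  rewrite -[leLHS](Ev_cst P V l).
  apply: (@le_trans _ _ (Ev l (fun s => phi a x s + K `^ (- a) * E1 s))).
    apply: le_Ev => //.
    - move=> dU U s ms; apply: measurable_funD; first exact: (mphi a (measurable_cst x) ms).
      by apply: measurable_funM => //; exact: mE1.
    - by move=> s; exact: ltW.
  rewrite Ev_addr//; first last.
  - by move=> s; rewrite mulr_ge0// ltW.
  - by move=> s; exact: phi_ge0.
  - by move=> dU U s ms; apply: measurable_funM => //; exact: mE1.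
  - by move=> dU U s ms; exact: (mphi a (measurable_cst x) ms).
  rewrite leeD2l// Ev_mulr//; last exact: ltW.
  by apply: lee_wpmul2l => //; rewrite lee_fin ltW.
have := Ev_ge0 P V l (phi_ge0 k a x).
case: (Ev l (phi a x)) => [e| |//]; last by rewrite !leey.
by rewrite -EFinM -EFinD !lee_fin => _; lra.
Qed.

End PowerMeanBounds.

Lemma natr_powR_le {R : realType} (a e : R) : 0 < a -> 0 < e ->
  exists N1 : nat, forall N : nat, (N1 <= N)%N -> N%:R `^ (- a) <= e.
Proof.
move=> a0 e0; pose u := e^-1 `^ a^-1.
have u0 : 0 < u by rewrite powR_gt0// invr_gt0.
exists (Num.truncn u).+1 => N uN.
have uN' : u <= N%:R by apply: ltW; apply: lt_le_trans (truncnS_gt u) _; rewrite ler_nat.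
apply: (@le_trans _ _ (u `^ (- a))).
  by apply: powR_neg_le => //; rewrite oppr_le0 ltW.
rewrite /u -powRrM mulrN mulVf ?gt_eqF// powR_inv1 ?invrK// invr_ge0 ltW//.
Qed.

Lemma limn_einf_ge_eventually {R : realType} (u : (\bar R)^nat) (x : \bar R) n :
  (forall m, (n <= m)%N -> (x <= u m)%E) -> (x <= limn_einf u)%E.
Proof.
move=> h; rewrite limn_einf_lim (cvg_lim _ (@cvg_einfs_sup _ u))//.
apply: (@le_trans _ _ (einfs u n)); last by apply: ereal_sup_ubound; exists n.
by apply: le_ereal_inf_tmp => _ [m /= nm <-]; exact: h.
Qed.

Lemma limn_einf_le_bound {R : realType} (u : (\bar R)^nat) (b : \bar R) :
  (forall m, (u m <= b)%E) -> (limn_einf u <= b)%E.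
Proof.
move=> h; rewrite limn_einf_lim (cvg_lim _ (@cvg_einfs_sup _ u))//.
apply: ge_ereal_sup => _ [m _ <-]; apply: le_trans (h m).
by apply: ereal_inf_lbound; exists m => /=.
Qed.

(** * Far points, and negative association of truncated distances *)

Section FarAndLowerBounds.
Context {R : realType} {dT} {T : measurableType dT} (P : probability T R).
Context {d : nat} (hd : (0 < d)%N).
Local Notation S := (d.-tuple R).
Variable V : nat -> T -> S.
Hypothesis mV : forall i, measurable_fun setT (V i).
Hypothesis hV : mutually_independent P V.
Hypothesis lV : forall i A, measurable A -> P (V i @^-1` A) = P (V 0%N @^-1` A).
Variable k : nat.
Hypothesis k0 : (0 < k)%N.
Local Notation Ev := (Ev P V).
Local Notation phi := (knn_power k).
Local Notation bad := (knn_far k).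
Local Notation mphi := (mfunXS_phi k0).

(** For each sign of [a], the control on the mass of balls that keeps the mean power away from 0:
    neighbours must be close when [a > 0], and not too close when [a < 0]. *)
Definition regular (a c : R) (x : S) :=
  [/\ no_atom P V x, 0 < a -> mass_ge P V c x & a < 0 -> mass_le P V c x].

Lemma Ev_phi_ge (a c : R) : 0 < c ->
  exists2 c1 : R, 0 < c1 & exists N1 : nat, forall x l,
    regular a c x -> uniq l -> (N1 <= size l)%N -> (c1%:E <= Ev l (phi a x))%E.
Proof.
move=> c0; have [a0|a0|a0] := ltgtP a 0.
- have [c1 c10 h] := Ev_phi_ge_neg hd mV lV k0 a0 c0.
  by exists c1 => //; exists k => x l [_ _ /(_ a0) ?]; exact: h.
- have [c1 c10 [N1 h]] := Ev_phi_ge_pos hd mV hV lV k0 a0 c0.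
  by exists c1 => //; exists N1 => x l [na /(_ a0) m _]; exact: h.
- exists 1 => //; exists 0%N => x l _ _ _; rewrite a0.
  by rewrite (_ : phi 0 x = fun=> 1) ?Ev_cst//; apply/funext => s; rewrite phi0.
Qed.

(** For [a > 0] the power of a far point is at most [N^(- a) * t^(- d * a)], a deterministic bound
    that tends to 0. *)
Lemma Ev_phi_bad_small_pos (a t : R) x (e : R) : 0 < a -> 0 < t -> 0 < e ->
  exists N1 : nat, forall l, (N1 <= size l)%N ->
    (Ev l (fun s => phi a x s * (bad a t x s)%:R)%R <= e%:E)%E.
Proof.
move=> a0 t0 e0; have tt0 : 0 < t `^ (- d%:R * a) by exact: powR_gt0.
have [N1 h] := natr_powR_le a0 (divr_gt0 e0 tt0).
exists N1 => l /h hl; rewrite -(Ev_cst P V l); apply: le_Ev => //.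
- by move=> dU U s ms; exact: (mfunXS_phi_bad k0 a t (measurable_cst x) ms).
- by move=> s; rewrite mulr_ge0// phi_ge0.
move=> s sl; rewrite /knn_far gt_eqF//=; case: ltP => /= ts; last by rewrite mulr0 ltW.
rewrite mulr1 /knn_power sl; apply: (@le_trans _ _ ((size l)%:R `^ (- a) * t `^ (- d%:R * a))).
  rewrite ler_wpM2l ?powR_ge0//; apply: powR_neg_le => //; first exact: ltW.
  by rewrite mulNr oppr_le0 mulr_ge0// ltW.
by rewrite -ler_pdivlMr.
Qed.

(** For [a < 0] the power is unbounded on far points. The first [N0] points bound its size, as their
    k-NN distance is the larger one and its power has finite mean; the other points bound the
    probability of being far, which decays geometrically. The two groups are independent, and the
    change of normalization costs only [(N / N0)^(- a)]. *)
Lemma Ev_phi_bad_small_neg (a t : R) x (e : R) l0 : a < 0 -> 0 < t -> 0 < e ->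
  (0 < P (V 0%N @^-1` eball x t))%E -> uniq l0 -> (k <= size l0)%N ->
  (Ev l0 (phi a x) < +oo)%E ->
  exists N1 : nat, forall l, uniq l -> (N1 <= size l)%N ->
    (Ev l (fun s => phi a x s * (bad a t x s)%:R)%R <= e%:E)%E.
Proof.
move=> a0 t0 e0 mass ul0 kl0 fin0; set N0 := size l0.
have N0p : (0 < N0)%N by exact: leq_trans kl0.
have N0r : 0 < N0%:R :> R by rewrite ltr0n.
have [A0 EA0 A00] : exists2 A0 : R, Ev l0 (phi a x) = A0%:E & 0 <= A0.
  have := Ev_ge0 P V l0 (phi_ge0 k a x); move: fin0.
  by case: (Ev l0 _) => // A _ A_ge0; exists A; rewrite -?lee_fin.
have [th Eth /andP[_ th1]] := prob_ball_fin P mV x t.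
have th0 : 0 < th by rewrite -lte_fin -Eth.
(* Chosen with [- a < j - 1], so that [N^(- a) / N^j <= 1 / N]. *)
pose j := (Num.truncn (- a)).+2.
pose C : R := N0%:R `^ a * A0 * 2 ^+ k * (4 * j%:R / th) ^+ j.
have C0 : 0 <= C.
  have jt : 0 <= 4 * j%:R / th by apply: divr_ge0; [rewrite mulr_ge0 | exact: ltW].
  by apply: mulr_ge0; [apply: mulr_ge0; [apply: mulr_ge0; [exact: powR_ge0|]|]|]; rewrite ?exprn_ge0.
(* The first bound leaves at least [k] points, and at least half of them all, in the second group;
   the second one makes [C / N <= e]. *)
exists (maxn (2 * (N0 + k))%N (Num.truncn (C / e)).+1) => l ul.
rewrite geq_max; set N := size l => /andP[NN0 NC].
have Np : (0 < N)%N by apply: leq_trans NN0; rewrite muln_gt0 addn_gt0 k0 orbT.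
have Nr : 0 < N%:R :> R by rewrite ltr0n.
have NNk : (N0 + k <= N)%N by apply: leq_trans NN0; rewrite leq_pmull.
have NN : (N0 <= N)%N by apply: leq_trans NNk; rewrite leq_addr.
have N02 : (N0 * 2 <= N)%N by apply: leq_trans NN0; rewrite mulnC leq_pmul2l// leq_addr.
have kN : (k <= N - N0)%N by rewrite leq_subRL.
have szt : size (take N0 l) = N0 by rewrite size_takel.
pose l1 := take N0 l; pose l2 := drop N0 l.
have l12 : l = l1 ++ l2 by rewrite cat_take_drop.
have sz2 : size l2 = (N - N0)%N by rewrite size_drop.
pose E s : R := (count (fun z : S => euclid_dist x z <= t)%R s < k)%N%:R.
have mE : mfunS E by exact: mfunS_count_lt.
have mp : mfunS (phi a x) by move=> dU U s ms; exact: (mphi a (measurable_cst x) ms).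
have cN0 : 0 <= (N%:R / N0%:R : R) `^ (- a) by exact: powR_ge0.
have uniqs := ul; rewrite l12 cat_uniq in uniqs.
case/and3P: uniqs => ul1 dis ul2.
apply: (@le_trans _ _ (((N%:R / N0%:R : R) `^ (- a))%:E * (Ev l1 (phi a x) * Ev l2 E))%E).
  rewrite -(Ev_prod mV hV dis mp mE) ?phi_ge0//; last by move=> s; exact: phi_ge0.
  rewrite -integral_mulr//; first last.
  - by move=> w; rewrite mulr_ge0// phi_ge0.
  - by apply: measurable_funM; exact: measurable_sample.
  apply: integral_ler.
  - apply: (mfunXS_phi_bad k0 a t (measurable_cst x)); exact: mseq_sample.
  - by apply: measurable_funM => //; apply: measurable_funM; exact: measurable_sample.
  - by move=> w; rewrite mulr_ge0// phi_ge0.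
  move=> w; set s := sample V l w; set s1 := sample V l1 w; set s2 := sample V l2 w.
  have s12 : s = s1 ++ s2 by rewrite /s l12 /sample map_cat.
  have ss1 : size s1 = N0 by rewrite size_map.
  have ss2 : size s2 = (N - N0)%N by rewrite size_map.
  have ks1 : (0 < k <= size s1)%N by rewrite k0 ss1.
  have ks2 : (0 < k <= size s2)%N by rewrite k0 ss2.
  rewrite /knn_far lt_eqF//=; case: ltP => /= ts; last first.
    by rewrite mulr0 mulr_ge0// mulr_ge0// phi_ge0.
  have -> : E s2 = 1.
    rewrite /E ltnNge -knn_leE// -ltNge (lt_le_trans ts)// s12.
    exact: knn_cat_ler.
  rewrite !mulr1 /knn_power size_map ss1 mulrA; apply: ler_pM; rewrite ?powR_ge0//.
    by rewrite -powRM ?divr_ge0// divfK ?gt_eqF.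
  apply: powR_pos_le; first exact: knn_ge0.
    by rewrite s12; exact: knn_cat_lel.
  by rewrite mulNr -mulrN mulr_ge0// oppr_ge0 ltW.
have -> : Ev l1 (phi a x) = A0%:E.
  by rewrite -EA0; apply: (Ev_exch mV hV lV) => //; move=> s; exact: phi_ge0.
apply: (@le_trans _ _ (((N%:R / N0%:R : R) `^ (- a))%:E *
   (A0%:E * (2 ^+ k * (1 - th / 2) ^+ (N - N0))%:E))%E).
  apply: lee_wpmul2l; first by rewrite lee_fin.
  apply: lee_wpmul2l; first by rewrite lee_fin.
  by rewrite -sz2; exact: Ev_count_lt.
rewrite -!EFinM lee_fin.
have M0 : (0 < N - N0)%N by exact: leq_trans kN.
have th2 : 0 < th / 2 <= 1 by lra.
have j0 : (0 < j)%N by [].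
have MN : N%:R / 2 <= (N - N0)%:R :> R.
  rewrite ler_pdivrMr// -natrM ler_nat mulnBl leq_subRL; last by rewrite leq_mul2r NN.
  by rewrite [(N * 2)%N]muln2 -addnn leq_add2r.
apply: (@le_trans _ _ ((N%:R / N0%:R) `^ (- a) * (A0 * (2 ^+ k * (4 * j%:R / (N%:R * th)) ^+ j)))).
  rewrite ler_wpM2l// ler_wpM2l// ler_wpM2l ?exprn_ge0//.
  apply: (le_trans (expr_onem_poly th2 j0 M0)).
  rewrite lerXn2r ?nnegrE ?divr_ge0 ?mulr_ge0//; try exact: ltW.
  have -> : 4 * j%:R / (N%:R * th) = j%:R / (N%:R / 2 * (th / 2)).
    by field; rewrite !gt_eqF.
  rewrite ler_wpM2l// lef_pV2 ?posrE ?mulr_gt0 ?divr_gt0//; last by rewrite ltr0n.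
  by rewrite ler_wpM2r// divr_ge0// ltW.
have -> : (N%:R / N0%:R) `^ (- a) * (A0 * (2 ^+ k * (4 * j%:R / (N%:R * th)) ^+ j)) =
          C * (N%:R `^ (- a) / N%:R ^+ j).
  rewrite powRM ?invr_ge0//.
  have -> : N0%:R^-1 `^ (- a) = N0%:R `^ a.
    by rewrite -powR_inv1// -powRrM mulN1r opprK.
  have -> : 4 * j%:R / (N%:R * th) = 4 * j%:R / th / N%:R by field; rewrite !gt_eqF.
  by rewrite exprMn exprVn /C; ring.
have Nj : N%:R `^ (- a) <= N%:R ^+ j.-1 :> R.
  rewrite -powR_mulrn//; apply: ler_powR; first by rewrite ler1n.
  by apply: ltW; exact: truncnS_gt.
apply: (@le_trans _ _ (C * N%:R^-1)).
  rewrite ler_wpM2l// ler_pdivrMr ?exprn_gt0//.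
  by rewrite [N%:R ^+ j]exprS mulrA mulVf ?mul1r ?gt_eqF.
rewrite ler_pdivrMr// mulrC -ler_pdivrMr// ltW//.
by apply: lt_le_trans (truncnS_gt (C / e)) _; rewrite ler_nat.
Qed.

(** By the quasi-triangle inequality the two open balls of radius [t] are disjoint, and each
    truncated distance sees only the points of its own ball. *)
Lemma negative_association_tknn (G : R -> R) (C t : R) x y l :
  uniq l -> 0 <= t -> 2 * d%:R * t < euclid_dist x y ->
  measurable_fun setT G -> (forall u, 0 <= u <= t -> 0 <= G u <= C) ->
  (forall u v, 0 <= u -> u <= v -> G u <= G v) \/
  (forall u v, 0 <= u -> u <= v -> G v <= G u) ->
  (Ev l (fun s => G (tknn k t x s) * G (tknn k t y s))%R <=
   Ev l (fun s => G (tknn k t x s)) * Ev l (fun s => G (tknn k t y s)))%E.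
Proof.
move=> ul t0 far mG GC mono.
have mGt z : mfunS (fun s => G (tknn k t z s)).
  move=> dU U s ms; apply: (measurableT_comp mG).
  exact: (measurable_tknn t k0 (measurable_cst z) ms).
have Gb z s : 0 <= G (tknn k t z s) <= C by apply: GC; rewrite tknn_ge0// tknn_le.
have ind z : insert_indep [set u | euclid_dist z u < t] (fun s => G (tknn k t z s)).
  by move=> s1 u s2 /negP; rewrite -leNgt => h; rewrite tknn_insert_far.
apply: (negative_association mV hV lV (S1 := [set u | euclid_dist x u < t])
          (S2 := [set u | euclid_dist y u < t]) (C := C)) => //.
  move=> z [/ltW h1 /ltW h2]; move: far; rewrite ltNge => /negP; apply.
  by apply: (@euclid_dist_quasi_triangle _ _ z); rewrite euclid_distC.
case: mono => mono; [left|right]; split => s1 z s2; apply: mono;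
  by [exact: tknn_ge0 | exact: tknn_insert_le].
Qed.

End FarAndLowerBounds.

(** * Two near points in one sample *)

Section GoodPair.
Context {R : realType} {dT} {T : measurableType dT} (P : probability T R).
Context {d : nat} (hd : (0 < d)%N).
Local Notation S := (d.-tuple R).
Variable V : nat -> T -> S.
Hypothesis mV : forall i, measurable_fun setT (V i).
Hypothesis hV : mutually_independent P V.
Hypothesis lV : forall i A, measurable A -> P (V i @^-1` A) = P (V 0%N @^-1` A).
Variable k : nat.
Hypothesis k0 : (0 < k)%N.
Local Notation Ev := (Ev P V).
Local Notation phi := (knn_power k).
Local Notation bad := (knn_far k).
Local Notation mphi := (mfunXS_phi k0).

Definition knn_power_near a t (x : S) s : R := phi a x s * (~~ bad a t x s)%:R.

Lemma phig_ge0 a t x s : 0 <= knn_power_near a t x s.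
Proof. by rewrite mulr_ge0// phi_ge0. Qed.

Lemma mfunS_phi a (x : S) : mfunS (phi a x).
Proof. by move=> dU U s ms; exact: (mphi a (measurable_cst x) ms). Qed.

Lemma mfunS_phig a t (x : S) : mfunS (knn_power_near a t x).
Proof. by move=> dU U s ms; exact: (mfunXS_phi_good k0 a t (measurable_cst x) ms). Qed.

Lemma mfunS_tknn (G : R -> R) t (x : S) : measurable_fun setT G ->
  mfunS (fun s => G (tknn k t x s)).
Proof.
move=> mG dU U s ms; apply: (measurableT_comp mG).
exact: (measurable_tknn t k0 (measurable_cst x) ms).
Qed.

Lemma le_Ev_eps (e : R) l a (x : S) : 0 < e -> (Ev l (phi a x) <= (1 + e)%:E * Ev l (phi a x))%E.
Proof.
move=> e0; have := Ev_ge0 P V l (phi_ge0 k a x); case: (Ev _ _) => [r| |//].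
  by rewrite -EFinM !lee_fin => r0; nra.
by move=> _; rewrite gt0_muley// lte_fin; lra.
Qed.

(** For [a < 0] the power increases with the distance, so the power of the truncated distance is
    bounded and lies between the near part and the full power. Negative association applies to it
    with no error term. *)
Lemma Ev_good_pair_neg (a t : R) x y l : a < 0 -> 0 < t -> (k <= size l)%N -> uniq l ->
  2 * d%:R * t < euclid_dist x y ->
  (Ev l (fun s => knn_power_near a t x s * knn_power_near a t y s)%R <= Ev l (phi a x) * Ev l (phi a y))%E.
Proof.
move=> a0 t0 kl ul far; set n : R := (size l)%:R `^ (- a).
have n0 : 0 <= n by exact: powR_ge0.
have e0 : 0 <= - d%:R * a by rewrite mulNr -mulrN mulr_ge0// oppr_ge0 ltW.
pose G (u : R) : R := n * u `^ (- d%:R * a).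
have mG : measurable_fun setT G by apply: measurable_funM => //; exact: measurable_powR.
have G0 u : 0 <= G u by rewrite mulr_ge0// powR_ge0.
have Gmono u v : 0 <= u -> u <= v -> G u <= G v.
  by move=> u0 uv; rewrite ler_wpM2l// powR_pos_le.
have GC u : 0 <= u <= t -> 0 <= G u <= G t.
  by move=> /andP[u0 ut]; rewrite G0 Gmono.
have NA := negative_association_tknn mV hV lV k0 ul (ltW t0) far mG GC (or_introl Gmono).
have good_le (z : S) s : size s = size l -> knn_power_near a t z s <= G (tknn k t z s).
  move=> sl; rewrite /knn_power_near /knn_far lt_eqF//=; case: ltP => /= ts.
    by rewrite mulr0.
  by rewrite mulr1 /knn_power /G sl tknnE ?k0 ?sl// min_r.
have le_phi (z : S) s : size s = size l -> G (tknn k t z s) <= phi a z s.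
  move=> sl; rewrite /knn_power /G sl -/n; apply: ler_wpM2l => //; apply: powR_pos_le => //.
    by apply: tknn_ge0; exact: ltW.
  by rewrite tknnE ?k0 ?sl// ge_min lexx orbT.
apply: (le_trans _ (le_trans NA _)).
- apply: le_Ev => //.
  + by apply: mfunSM; exact: mfunS_phig.
  + by apply: mfunSM; exact: mfunS_tknn.
  + by move=> s; rewrite mulr_ge0// phig_ge0.
  + by move=> s sl; apply: ler_pM; rewrite ?phig_ge0// good_le.
- by apply: lee_pmul; try (exact: Ev_ge0); apply: le_Ev => //; by [exact: mfunS_tknn | exact: mfunS_phi | exact: le_phi].
Qed.

(** For [a > 0] two things go wrong: the power is unbounded near distance 0, and truncation at [t]
    raises it. A floor [h j] on the distance cures the first and is removed by Fatou's lemma; the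
    lower bound on the mean absorbs the second into the factor [1 + e]. *)
Lemma Ev_good_pair_pos (a c t e : R) : 0 < a -> 0 < c -> 0 < t -> 0 < e ->
  exists N1 : nat, forall x y l, regular P V a c x -> regular P V a c y ->
   2 * d%:R * t < euclid_dist x y -> uniq l -> (N1 <= size l)%N ->
  (Ev l (fun s => knn_power_near a t x s * knn_power_near a t y s)%R <=
   ((1 + e)%:E * Ev l (phi a x)) * ((1 + e)%:E * Ev l (phi a y)))%E.
Proof.
move=> a0 c0 t0 e0.
have [c1 c10 [N1 h1]] := Ev_phi_ge hd mV hV lV k0 a c0.
have tt0 : 0 < t `^ (- d%:R * a) by exact: powR_gt0.
(* From here the power at distance [t] is at most [e * c1], hence at most [e] times the mean. *)
have [N2 h2] := natr_powR_le a0 (divr_gt0 (mulr_gt0 e0 c10) tt0).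
exists (maxn k (maxn N1 N2)) => x y l rx ry far ul.
rewrite !geq_max => /and3P[kl N1l N2l]; set n : R := (size l)%:R `^ (- a).
have n0 : 0 <= n by exact: powR_ge0.
have ex0 : - d%:R * a <= 0 by rewrite mulNr oppr_le0 mulr_ge0// ltW.
have nt : n * t `^ (- d%:R * a) <= e * c1 by rewrite -ler_pdivlMr//; exact: h2.
pose h j : R := (j.+1%:R)^-1.
have h0 j : 0 < h j by rewrite invr_gt0.
pose G j (u : R) : R := n * (Num.max u (h j)) `^ (- d%:R * a).
have mG j : measurable_fun setT (G j).
  apply: measurable_funM => //.
  apply: (@measurableT_comp _ _ _ _ _ _ (@powR R ^~ (- d%:R * a))); first exact: measurable_powR.
  exact: measurable_maxr.
have G0 j u : 0 <= G j u by rewrite mulr_ge0// powR_ge0.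
have maxh0 j u : 0 < Num.max u (h j) by rewrite lt_max h0 orbT.
have Gmono j u v : 0 <= u -> u <= v -> G j v <= G j u.
  move=> u0 uv; rewrite ler_wpM2l// powR_neg_le//.
  by rewrite ge_max !le_max uv lexx orbT.
have GC j u : 0 <= u -> G j u <= n * h j `^ (- d%:R * a).
  by move=> u0; rewrite ler_wpM2l// powR_neg_le// le_max lexx orbT.
have NA j : (Ev l (fun s => G j (tknn k t x s) * G j (tknn k t y s))%R <=
   Ev l (fun s => G j (tknn k t x s)) * Ev l (fun s => G j (tknn k t y s)))%E.
  apply: (negative_association_tknn mV hV lV k0 (C := n * h j `^ (- d%:R * a)) ul (ltW t0)) => //.
    by move=> u /andP[u0 ut]; rewrite G0 GC.
  by right; exact: Gmono.
have EG j z : regular P V a c z ->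
    (Ev l (fun s => G j (tknn k t z s)) <= (1 + e)%:E * Ev l (phi a z))%E.
  move=> rz; have [naz _ _] := rz.
  have c1z := h1 _ _ rz ul N1l.
  pose E2 s : R := (0 < count (fun u : S => euclid_dist z u <= 0)%R s)%N%:R.
  have mE2 : mfunS E2 by exact: mfunS_lt_count.
  have C0 : 0 <= n * h j `^ (- d%:R * a) by rewrite mulr_ge0// powR_ge0.
  (* The power itself, the excess from truncation, and the null event [E2] of a sample point at [z],
     where only the floor bounds [G]. *)
  apply: (@le_trans _ _ (Ev l (fun s => (phi a z s + e * c1) + n * h j `^ (- d%:R * a) * E2 s))).
    apply: le_Ev => //.
    - exact: mfunS_tknn.
    - move=> dU U s ms; apply: measurable_funD.
        by apply: measurable_funD => //; exact: mfunS_phi.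
      by apply: measurable_funM => //; exact: mE2.
    - move=> s sl; have ks : (0 < k <= size s)%N by rewrite k0 sl.
      have p0 := phi_ge0 k a z s.
      have ec : 0 <= e * c1 by rewrite ltW// mulr_gt0.
      rewrite /E2; case: ltnP => hc.
        rewrite /= mulr1; apply: (le_trans (GC j _ (tknn_ge0 _ _ _ (ltW t0)))).
        by rewrite lerDr addr_ge0.
      rewrite /= mulr0 addr0.
      have knn0 : 0 < knn_dist k z s.
        by rewrite ltNge knn_leE// -ltnNge; apply: leq_ltn_trans hc _.
      rewrite tknnE//; apply: (@le_trans _ _ (n * (Num.min t (knn_dist k z s)) `^ (- d%:R * a))).
        by rewrite ler_wpM2l// powR_neg_le ?lt_min ?t0// le_max lexx.
      rewrite /knn_power sl -/n; case: (leP t (knn_dist k z s)) => _.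
        by apply: (le_trans nt); rewrite lerDr mulr_ge0// powR_ge0.
      by rewrite lerDl.
  rewrite Ev_addr//; first last.
  - by move=> s; rewrite mulr_ge0.
  - by move=> s; rewrite addr_ge0 ?phi_ge0// ltW// mulr_gt0.
  - by move=> dU U s ms; apply: measurable_funM => //; exact: mE2.
  - by move=> dU U s ms; apply: measurable_funD => //; exact: mfunS_phi.
  rewrite [X in (_ + X)%E]Ev_mulr// Ev_count0// mule0 adde0.
  rewrite Ev_addr//; first last.
  - by move=> s; rewrite ltW// mulr_gt0.
  - by move=> s; exact: phi_ge0.
  - exact: mfunS_phi.
  rewrite Ev_cst; move: c1z; have := Ev_ge0 P V l (phi_ge0 k a z).
  case: (Ev l (phi a z)) => [r| |//].
    by rewrite -EFinM -EFinD !lee_fin => r0 cr; nra.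
  by move=> _ _; rewrite gt0_muley ?leey// lte_fin; lra.
set bnd := (X in (_ <= X)%E).
pose f j w : \bar R := (G j (tknn k t x (sample V l w)) * G j (tknn k t y (sample V l w)))%:E.
have mf j : measurable_fun setT (f j).
  apply/measurable_EFinP; apply: measurable_funM;
    exact: (measurable_sample mV l (mfunS_tknn t _ (mG j))).
have f0 j w : [set: T] w -> (0 <= f j w)%E by move=> _; rewrite lee_fin mulr_ge0.
apply: (@le_trans _ _ (\int[P]_w limn_einf (f ^~ w))%E); last first.
  apply: (le_trans (fatou P measurableT mf f0)).
  apply: limn_einf_le_bound => j; apply: (le_trans (NA j)).
  by apply: lee_pmul; try (exact: Ev_ge0); exact: EG.
apply: ge0_le_integral => //.
- by move=> w _; rewrite lee_fin mulr_ge0// phig_ge0.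
- by apply/measurable_EFinP; apply: measurable_funM; apply: measurable_sample => //; exact: mfunS_phig.
- apply: (emeasurable_fun_cvg (fun n w => einfs (f ^~ w) n)) => [i|w _].
    exact: measurable_fun_einfs.
  by rewrite limn_einf_lim; exact: is_cvg_einfs.
move=> w _; set s := sample V l w.
have sl : size s = size l by rewrite size_map.
have ks : (0 < k <= size s)%N by rewrite k0 sl.
have limG z : exists j0, forall j, (j0 <= j)%N -> knn_power_near a t z s <= G j (tknn k t z s).
  rewrite /knn_power_near /knn_far gt_eqF//=; case: ltP => /= ts.
    by exists 0%N => j _; rewrite mulr0.
  rewrite mulr1 /knn_power sl -/n; have := knn_ge0 k z s; rewrite le_eqVlt => /orP[/eqP <-|kn0].
    (* At distance 0 the convention of [powR] makes the left side 0. *)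
    exists 0%N => j _; rewrite powR0 ?mulr0// mulf_neq0 ?oppr_eq0 ?gt_eqF//.
    by rewrite ltr0n.
  exists (Num.truncn (knn_dist k z s)^-1) => j hj.
  rewrite /G tknnE// min_r// max_l//.
  rewrite /h -[leRHS]invrK lef_pV2 ?posrE ?invr_gt0//.
  by apply: ltW; apply: lt_le_trans (truncnS_gt _) _; rewrite ler_nat.
have [j1 hj1] := limG x; have [j2 hj2] := limG y.
apply: (@limn_einf_ge_eventually _ _ _ (maxn j1 j2)) => j; rewrite geq_max => /andP[h1j h2j].
by rewrite lee_fin ler_pM ?phig_ge0 ?hj1 ?hj2.
Qed.

Lemma Ev_good_pair (a c t e : R) : 0 < c -> 0 < t -> 0 < e ->
  exists N1 : nat, forall x y l, regular P V a c x -> regular P V a c y ->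
   2 * d%:R * t < euclid_dist x y -> uniq l -> (N1 <= size l)%N ->
  (Ev l (fun s => knn_power_near a t x s * knn_power_near a t y s)%R <=
   ((1 + e)%:E * Ev l (phi a x)) * ((1 + e)%:E * Ev l (phi a y)))%E.
Proof.
move=> c0 t0 e0; have [a0|a0|a0] := ltgtP a 0.
- exists k => x y l _ _ far ul kl.
  apply: (le_trans (Ev_good_pair_neg a0 t0 kl ul far)).
  apply: lee_pmul; try (apply: Ev_ge0; exact: phi_ge0); exact: le_Ev_eps.
- exact: Ev_good_pair_pos.
- exists 0%N => x y l _ _ _ _ _; rewrite a0.
  apply: (@le_trans _ _ (Ev l (phi 0 x) * Ev l (phi 0 y))%E).
    have p1 z : phi 0 z = fun=> 1 by apply/funext => s; rewrite phi0.
    rewrite !p1 !Ev_cst mule1.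
    rewrite (_ : (fun s => _) = fun=> 1) ?Ev_cst//; apply/funext => s.
    by rewrite /knn_power_near /knn_far !phi0 eqxx/= !mulr1.
  apply: lee_pmul; try (apply: Ev_ge0; exact: phi_ge0); exact: le_Ev_eps.
Qed.

End GoodPair.

(** * Conditioning on one or two points of the first sample *)

Section TwoSamples.
Context {R : realType} {dT} {T : measurableType dT} (P : probability T R).
Context {d : nat}.
Local Notation S := (d.-tuple R).
Variables X Y : nat -> T -> S.
Hypothesis mX : forall i, measurable_fun setT (X i).
Hypothesis mY : forall i, measurable_fun setT (Y i).
Let Z (z : nat + nat) := match z with inl i => X i | inr j => Y j end.
Hypothesis hind : mutually_independent P Z.
Hypothesis lX : forall i A, measurable A -> P (X i @^-1` A) = P (X 0%N @^-1` A).

Let mZ z : measurable_fun setT (Z z). Proof. by case: z. Qed.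

Lemma mutually_independent_inl : mutually_independent P X.
Proof.
move=> s A us mA.
pose B (z : nat + nat) := match z with inl i => A i | inr _ => setT end.
have := hind (s := map inl s) (A := B).
rewrite map_inj_uniq; last by move=> ? ? [].
move=> /(_ us); have mB z : measurable (B z) by case: z => i /=.
move=> /(_ mB).
rewrite big_map => <-; congr (P _); apply/seteqP; split=> w h i /=.
  by move=> /mapP[j js ->]; exact: h.
by move=> si; apply: (h (inl i)) => /=; exact: map_f.
Qed.

Lemma mutually_independent_inr : mutually_independent P Y.
Proof.
move=> s A us mA.
pose B (z : nat + nat) := match z with inr i => A i | inl _ => setT end.
have := hind (s := map inr s) (A := B).
rewrite map_inj_uniq; last by move=> ? ? [].
move=> /(_ us); have mB z : measurable (B z) by case: z => i /=.
move=> /(_ mB).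
rewrite big_map => <-; congr (P _); apply/seteqP; split=> w h i /=.
  by move=> /mapP[j js ->]; exact: h.
by move=> si; apply: (h (inr i)) => /=; exact: map_f.
Qed.

Let mfst (L1 L2 : pred (nat + nat)) z : L1 z ->
  measurable_fun setT (fun u : sigma_of Z L1 * sigma_of Z L2 => Z z u.1).
Proof.
move=> Li; apply: (@measurableT_comp _ _ _ _ _ _ (Z z : sigma_of Z L1 -> S) _ fst) => //.
exact: measurable_coord.
Qed.

Let msnd (L1 L2 : pred (nat + nat)) z : L2 z ->
  measurable_fun setT (fun u : sigma_of Z L1 * sigma_of Z L2 => Z z u.2).
Proof.
move=> Li; apply: (@measurableT_comp _ _ _ _ _ _ (Z z : sigma_of Z L2 -> S) _ snd) => //.
exact: measurable_coord.
Qed.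

Lemma Ev_prod_XY l l' (F G : seq S -> R) : mfunS F -> mfunS G ->
  (forall s, 0 <= F s) -> (forall s, 0 <= G s) ->
  (\int[P]_w (F (sample X l w) * G (sample Y l' w))%:E = Ev P X l F * Ev P Y l' G)%E.
Proof.
move=> mF mG F0 G0.
pose isX (z : nat + nat) := if z is inl _ then true else false.
rewrite (decouple (L1 := isX) (L2 := predC isX) mZ hind
  (F := fun w1 w2 => (F (sample X l w1) * G (sample Y l' w2))%:E))//.
- under eq_integral => w1 _.
    rewrite integral_mulr//; last exact: measurable_sample.
    over.
  rewrite ge0_integralZr//.
  + by apply/measurable_EFinP; exact: measurable_sample.
  + by move=> w _; rewrite lee_fin.
  + exact: Ev_ge0.
- by move=> z /=; rewrite negbK.
- by move=> w1 w2; rewrite lee_fin mulr_ge0.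
apply/measurable_EFinP; apply: measurable_funM.
  by apply: mF; apply: mseq_map => j jl; exact: (@mfst isX (predC isX) (inl j)).
by apply: mG; apply: mseq_map => j jl; exact: (@msnd isX (predC isX) (inr j)).
Qed.

Lemma measurable_Ev2 (V : nat -> T -> S) (F : S -> S -> seq S -> R) l :
  (forall i, measurable_fun setT (V i)) -> mfunXXS F -> (forall x y s, 0 <= F x y s) ->
  measurable_fun setT (fun u : S * S => Ev P V l (F u.1 u.2)).
Proof.
move=> mV mF F0.
pose f : (S * S) * T -> \bar R := fun u => (F u.1.1 u.1.2 (sample V l u.2))%:E.
apply: (measurable_fun_fubini_tonelli_F (m2 := P) f) => [|u]; last by rewrite lee_fin.
apply/measurable_EFinP; apply: mF.
- exact: (measurableT_comp measurable_fst measurable_fst).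
- exact: (measurableT_comp measurable_snd measurable_fst).
- by apply: mseq_map => i _; exact: (measurableT_comp (mV i)).
Qed.

(** The point [X i] is split off from all other coordinates; once it is frozen, [Ev_prod_XY]
    separates the two samples. *)
Lemma Ev_point_XY i l l' (F G : S -> seq S -> R) : i \notin l ->
  mfunXS F -> mfunXS G -> (forall x s, 0 <= F x s) -> (forall x s, 0 <= G x s) ->
  (\int[P]_w (F (X i w) (sample X l w) * G (X i w) (sample Y l' w))%:E =
   \int[P]_w (Ev P X l (F (X 0%N w)) * Ev P Y l' (G (X 0%N w))))%E.
Proof.
move=> il mF mG F0 G0.
pose L1 := pred1 (inl i : nat + nat).
rewrite (decouple (L1 := L1) (L2 := predC L1) mZ hind
  (F := fun w1 w2 => (F (X i w1) (sample X l w2) * G (X i w1) (sample Y l' w2))%:E))//.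
- under eq_integral => w1 _.
    rewrite (Ev_prod_XY l l' (mfunXS_fix _ mF) (mfunXS_fix _ mG) (F0 _) (G0 _)); over.
  apply: (ge0_integral_same_law (f := fun x => (Ev P X l (F x) * Ev P Y l' (G x))%E)) => //.
  + by move=> A mA; exact: lX.
  + by apply: emeasurable_funM; exact: measurable_Ev.
  + by move=> x; rewrite mule_ge0// Ev_ge0.
- by move=> z /= /eqP ->; rewrite negbK.
- by move=> w1 w2; rewrite lee_fin mulr_ge0.
have mi : measurable_fun setT (fun u : sigma_of Z L1 * sigma_of Z (predC L1) => X i u.1).
  by apply: (@mfst L1 (predC L1) (inl i)); rewrite /L1 /= eqxx.
apply/measurable_EFinP; apply: measurable_funM.
  apply: mF => //; apply: mseq_map => j jl; apply: (@msnd L1 (predC L1) (inl j)).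
  by rewrite /L1 /=; apply: contra il => /eqP[<-].
by apply: mG => //; apply: mseq_map => j jl; apply: (@msnd L1 (predC L1) (inr j)).
Qed.

(** The two points are frozen one after the other, the second by [Ev_point_XY]. *)
Lemma Ev_pair_XY i j l l' (F G : S -> S -> seq S -> R) : i != j -> i \notin l -> j \notin l ->
  mfunXXS F -> mfunXXS G -> (forall x y s, 0 <= F x y s) -> (forall x y s, 0 <= G x y s) ->
  (\int[P]_w (F (X i w) (X j w) (sample X l w) * G (X i w) (X j w) (sample Y l' w))%:E =
   \int[P]_w1 \int[P]_w2 (Ev P X l (F (X 0%N w1) (X 0%N w2))
                          * Ev P Y l' (G (X 0%N w1) (X 0%N w2))))%E.
Proof.
move=> ij il jl mF mG F0 G0.
pose L1 := pred1 (inl i : nat + nat).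
rewrite (decouple (L1 := L1) (L2 := predC L1) mZ hind
  (F := fun w1 w2 => (F (X i w1) (X j w2) (sample X l w2) * G (X i w1) (X j w2) (sample Y l' w2))%:E))//.
- under eq_integral => w1 _.
    rewrite (Ev_point_XY l' jl (mfunXXS_fix _ mF) (mfunXXS_fix _ mG) (F0 _) (G0 _)); over.
  apply: (ge0_integral_same_law (f := fun x => (\int[P]_w2
     (Ev P X l (F x (X 0%N w2)) * Ev P Y l' (G x (X 0%N w2))))%E)) => //.
  + by move=> A mA; exact: lX.
  + pose f : S * T -> \bar R := fun u =>
      (Ev P X l (F u.1 (X 0%N u.2)) * Ev P Y l' (G u.1 (X 0%N u.2)))%E.
    apply: (measurable_fun_fubini_tonelli_F (m2 := P) f) => [|u]; last first.
      by rewrite mule_ge0// Ev_ge0.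
    have mu : measurable_fun setT (fun u : S * T => (u.1, X 0%N u.2)).
      by apply: measurable_fun_pair => //; exact: (measurableT_comp (mX 0%N)).
    apply: emeasurable_funM.
      exact: (measurableT_comp (measurable_Ev2 l mX mF F0) mu).
    exact: (measurableT_comp (measurable_Ev2 l' mY mG G0) mu).
  + by move=> x; apply: integral_ge0 => w _; rewrite mule_ge0// Ev_ge0.
- by move=> z /= /eqP ->; rewrite negbK.
- by move=> w1 w2; rewrite lee_fin mulr_ge0.
have mi : measurable_fun setT (fun u : sigma_of Z L1 * sigma_of Z (predC L1) => X i u.1).
  by apply: (@mfst L1 (predC L1) (inl i)); rewrite /L1 /= eqxx.
have mj : measurable_fun setT (fun u : sigma_of Z L1 * sigma_of Z (predC L1) => X j u.2).
  apply: (@msnd L1 (predC L1) (inl j)); rewrite /L1 /=; apply: contra ij.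
  by move=> /eqP[->].
apply/measurable_EFinP; apply: measurable_funM.
  apply: mF => //; apply: mseq_map => h hl; apply: (@msnd L1 (predC L1) (inl h)).
  by rewrite /L1 /=; apply: contra il => /eqP[<-].
by apply: mG => //; apply: mseq_map => h hl; apply: (@msnd L1 (predC L1) (inr h)).
Qed.

End TwoSamples.

Section Ratio.
Context {R : realType}.

(** The change of normalization when one point is dropped from a list of [N.+1] points; it tends to
    1. *)
Definition succ_ratio (N : nat) (a : R) : R := (N.+1%:R / N%:R) `^ (- a).

Lemma succ_ratio_ge0 N a : 0 <= succ_ratio N a. Proof. exact: powR_ge0. Qed.

Lemma succ_ratio_le (a e : R) : 0 < e -> exists N1 : nat, forall N, (N1 <= N)%N -> succ_ratio N a <= 1 + e.
Proof.
move=> e0; have le0 : 0 < ln (1 + e) by rewrite ln_gt0// ltrDl.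
exists (Num.truncn (`|a| / ln (1 + e))).+1 => N hN.
have Np : (0 < N)%N by exact: leq_trans hN.
have Nr : 0 < N%:R :> R by rewrite ltr0n.
have aN : `|a| / N%:R <= ln (1 + e).
  rewrite ler_pdivrMr// mulrC -ler_pdivrMr// ltW//.
  by apply: lt_le_trans (truncnS_gt _) _; rewrite ler_nat.
have -> : succ_ratio N a = expR (- a * ln (1 + N%:R^-1)).
  have E : N.+1%:R / N%:R = 1 + N%:R^-1 :> R.
    by rewrite -natr1 mulrDl divff ?gt_eqF// mul1r.
  by rewrite /succ_ratio E /powR gt_eqF// addr_gt0// invr_gt0.
have lnle : 0 <= ln (1 + N%:R^-1 : R) <= N%:R^-1.
  apply/andP; split; first by rewrite ln_ge0// lerDl invr_ge0.
  by apply: le_ln1Dx; apply: (@lt_le_trans _ _ 0); rewrite ?invr_ge0// ltrN10.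
rewrite -[leRHS]lnK ?posrE ?addr_gt0// ler_expR; apply: le_trans aN.
have [l0 l1] := andP lnle.
apply: (@le_trans _ _ (`|a| * ln (1 + N%:R^-1))); first by rewrite ler_wpM2r// -normrN ler_norm.
by rewrite ler_wpM2l.
Qed.

Lemma natS_powR N a : (0 < N)%N -> N.+1%:R `^ (- a) = succ_ratio N a * N%:R `^ (- a) :> R.
Proof.
move=> N0; have Nr : 0 < N%:R :> R by rewrite ltr0n.
by rewrite /succ_ratio -powRM ?divr_ge0// divfK ?gt_eqF.
Qed.

End Ratio.

Section ExtendedIntegrals.
Context {R : realType} {dT} {T : measurableType dT} (P : probability T R).
Local Open Scope ereal_scope.

Lemma ge0_integral_lin2 (f g : T -> \bar R) (a b : \bar R) :
  measurable_fun setT f -> measurable_fun setT g ->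
  (forall w, 0 <= f w) -> (forall w, 0 <= g w) -> 0 <= a -> 0 <= b ->
  \int[P]_w (a * f w + b * g w) = a * \int[P]_w f w + b * \int[P]_w g w.
Proof.
move=> mf mg f0 g0 a0 b0; rewrite ge0_integralD//.
- by rewrite !ge0_integralZl.
- by move=> w _; rewrite mule_ge0.
- exact: emeasurable_funM.
- by move=> w _; rewrite mule_ge0.
- exact: emeasurable_funM.
Qed.

End ExtendedIntegrals.

(** * One-point moments and their weighted versions *)

Section SampleMoments.
Context {R : realType} {dT} {T : measurableType dT} (P : probability T R).
Context {d : nat}.
Local Notation S := (d.-tuple R).
Variables X Y : nat -> T -> S.
Hypothesis mX : forall i, measurable_fun setT (X i).
Hypothesis mY : forall i, measurable_fun setT (Y i).
Hypothesis hind : mutually_independent P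
  (fun z : nat + nat => match z with inl i => X i | inr j => Y j end).
Hypothesis lX : forall i A, measurable A -> P (X i @^-1` A) = P (X 0%N @^-1` A).
Hypothesis lY : forall i A, measurable A -> P (Y i @^-1` A) = P (Y 0%N @^-1` A).
Variable k : nat.
Hypothesis k0 : (0 < k)%N.
Local Notation phi := (knn_power k).

Let hX := mutually_independent_inl hind.
Let hY := mutually_independent_inr hind.

Definition power_meanX a N x := Ev P X (iota 0 N) (phi a x).
Definition power_meanY a N x := Ev P Y (iota 0 N) (phi a x).
Local Notation EX := power_meanX.
Local Notation EY := power_meanY.
(** The mean of one normalized summand whose point has [N] companions in its own sample and [m]
    points in the other one. *)
Definition joint_moment a b N m := (\int[P]_w (EX a N (X 0%N w) * EY b m (X 0%N w)))%E.
Local Notation U := joint_moment.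

Lemma EX_ge0 a N x : (0 <= EX a N x)%E.
Proof. by apply: Ev_ge0 => s; exact: phi_ge0. Qed.

Lemma EY_ge0 a N x : (0 <= EY a N x)%E.
Proof. by apply: Ev_ge0 => s; exact: phi_ge0. Qed.

Lemma U_ge0 a b N m : (0 <= U a b N m)%E.
Proof. by apply: integral_ge0 => w _; rewrite mule_ge0 ?EX_ge0 ?EY_ge0. Qed.

Lemma measurable_EX a N : measurable_fun setT (EX a N).
Proof. by apply: measurable_Ev => //; [exact: mfunXS_phi | move=> x s; exact: phi_ge0]. Qed.

Lemma measurable_EY a N : measurable_fun setT (EY a N).
Proof. by apply: measurable_Ev => //; [exact: mfunXS_phi | move=> x s; exact: phi_ge0]. Qed.

Lemma measurable_EXY a b N m :
  measurable_fun setT (fun w => EX a N (X 0%N w) * EY b m (X 0%N w))%E.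
Proof.
apply: emeasurable_funM.
  exact: (measurableT_comp (measurable_EX a N) (mX 0%N)).
exact: (measurableT_comp (measurable_EY b m) (mX 0%N)).
Qed.

Lemma EX_exch a x l : uniq l -> Ev P X l (phi a x) = EX a (size l) x.
Proof.
move=> ul; apply: (Ev_exch mX hX lX) => //; rewrite ?iota_uniq ?size_iota//.
- exact: mfunS_phi.
- by move=> s; exact: phi_ge0.
Qed.

Lemma EY_exch a x l : uniq l -> Ev P Y l (phi a x) = EY a (size l) x.
Proof.
move=> ul; apply: (Ev_exch mY hY lY) => //; rewrite ?iota_uniq ?size_iota//.
- exact: mfunS_phi.
- by move=> s; exact: phi_ge0.
Qed.

Lemma one_point_expectation a b i l l' : i \notin l -> uniq l -> uniq l' ->
  (\int[P]_w (phi a (X i w) (sample X l w) * phi b (X i w) (sample Y l' w))%:E =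
   U a b (size l) (size l'))%E.
Proof.
move=> il ul ul'.
rewrite (Ev_point_XY mX mY hind lX l' il (mfunXS_phi k0 a) (mfunXS_phi k0 b) (phi_ge0 k a) (phi_ge0 k b)).
by apply: eq_integral => w _; rewrite (EX_exch _ _ ul) (EY_exch _ _ ul').
Qed.

(** The weight involves [X j], which is also a candidate neighbour of [X i]; [Ev_knn_first_point]
    separates the two roles up to a term of order [k / N]. The factor 2 absorbs [succ_ratio]. *)
Lemma weighted_first_point a b i j l N m (h : S -> S -> R) (M eta : R) :
  i \notin j :: l -> uniq (j :: l) -> size l = N -> (k <= N)%N -> succ_ratio N a <= 2 ->
  measurable_fun setT (fun u : S * S => h u.1 u.2) -> (forall x y, 0 <= h x y <= M) ->
  0 <= eta -> (forall x, (\int[P]_w (h x (X 0%N w))%:E <= eta%:E)%E) ->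
  (\int[P]_w (h (X i w) (X j w) * (phi a (X i w) (X j w :: sample X l w)
      * phi b (X i w) (sample Y (iota 0 m) w)))%:E <=
   (2 * eta)%:E * U a b N m + (M * k%:R / N.+1%:R)%:E * U a b N.+1 m)%E.
Proof.
move=> i0 ui sl kN rN mh hM eta0 heta.
have h0 x y : 0 <= h x y by case/andP: (hM x y).
have M0 : 0 <= M by case/andP: (hM [tuple of nseq d 0] [tuple of nseq d 0]) => /le_trans; apply.
pose F x s : R := phi a x s * h x (head x s).
have F0 x s : 0 <= F x s by rewrite mulr_ge0// phi_ge0.
have mF : mfunXS F.
  move=> dU U x s mx ms; apply: measurable_funM; first exact: mfunXS_phi.
  have mhd : measurable_fun setT (fun u => head (x u) (s u)).
    by case: ms => [|y s' my _] /=.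
  exact: (@measurableT_comp _ _ _ _ _ _ (fun u : S * S => h u.1 u.2) _
           (fun u => (x u, head (x u) (s u))) mh (measurable_fun_pair mx mhd)).
have -> : (\int[P]_w (h (X i w) (X j w) * (phi a (X i w) (X j w :: sample X l w)
      * phi b (X i w) (sample Y (iota 0 m) w)))%:E =
   \int[P]_w (F (X i w) (sample X (j :: l) w) * phi b (X i w) (sample Y (iota 0 m) w))%:E)%E.
  by apply: eq_integral => w _; congr EFin; rewrite /F /=; ring.
rewrite (Ev_point_XY mX mY hind lX (iota 0 m) i0 mF (mfunXS_phi k0 b) F0 (phi_ge0 k b)).
have c0 : 0 <= M * k%:R / N.+1%:R by rewrite divr_ge0// mulr_ge0.
have e20 : 0 <= 2 * eta by rewrite mulr_ge0.
pose F0' r : R := N.+1%:R `^ (- a) * r `^ (- d%:R * a).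
have mF0' : measurable_fun setT F0' by apply: measurable_funM => //; exact: measurable_powR.
have key x : (Ev P X (j :: l) (F x) <= (2 * eta)%:E * EX a N x +
               (M * k%:R / N.+1%:R)%:E * EX a N.+1 x)%E.
  have -> : Ev P X (j :: l) (F x) =
     Ev P X (j :: l) (fun s => F0' (knn_dist k x s) * h x (head x s))%R.
    by apply: eq_integral => w _; rewrite /F /F0' /knn_power size_map /= sl.
  have kkN : (0 < k <= size l)%N by rewrite k0 sl.
  have F0'0 r : 0 <= F0' r by rewrite mulr_ge0// powR_ge0.
  have mhx : measurable_fun setT (h x).
    exact: (measurable_fun_pair2 (f := fun u : S * S => h u.1 u.2)).
  apply: (le_trans (Ev_knn_first_point mX hX lX x kkN ui mF0' F0'0 mhx (hM x) (heta x))).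
  have ul : uniq l by case/andP: ui.
  rewrite sl; apply: leeD.
    rewrite [(2 * eta)%R]mulrC EFinM -muleA; apply: lee_wpmul2l; first by rewrite lee_fin.
    rewrite -sl -(EX_exch _ _ ul) -Ev_mulr//; first last.
    - by move=> s; exact: phi_ge0.
    - exact: mfunS_phi.
    apply: le_Ev => //.
    - exact: mfunS_knn.
    - by move=> dU V s ms; apply: measurable_funM => //; exact: mfunS_phi.
    - move=> s; rewrite ?sl => sN; rewrite /F0' ?sl natS_powR; last exact: leq_trans kN.
      rewrite -mulrA.
      by rewrite /knn_power sN ?sl ler_wpM2r// mulr_ge0// powR_ge0.
  apply: lee_wpmul2l; first by rewrite lee_fin.
  have sl1 : size (j :: l) = N.+1 by rewrite /= sl.
  rewrite -[X in EX _ X _]sl1 -(EX_exch _ _ ui).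
  rewrite le_eqVlt; apply/orP; left; apply/eqP; apply: eq_integral => w _.
  by rewrite /F0' /knn_power size_map sl1.
have mEc (c : R) N' : measurable_fun setT (fun w => c%:E * (EX a N' (X 0%N w) * EY b m (X 0%N w)))%E.
  by apply: emeasurable_funM => //; exact: measurable_EXY.
apply: (@le_trans _ _ (\int[P]_w ((2 * eta)%:E * (EX a N (X 0%N w) * EY b m (X 0%N w)) +
    (M * k%:R / N.+1%:R)%:E * (EX a N.+1 (X 0%N w) * EY b m (X 0%N w))))%E).
  apply: ge0_le_integral => //.
  - by move=> w _; rewrite mule_ge0 ?Ev_ge0// => s; exact: phi_ge0.
  - apply: emeasurable_funM.
      apply: (@measurableT_comp _ _ _ _ _ _ (fun x => Ev P X (j :: l) (F x)) _ (X 0%N)) => //.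
      exact: measurable_Ev.
    exact: (measurableT_comp (measurable_EY b m) (mX 0%N)).
  - by apply: emeasurable_funD.
  - move=> w _; rewrite !muleA -ge0_muleDl; first last.
    - by rewrite mule_ge0 ?lee_fin ?EX_ge0.
    - by rewrite mule_ge0 ?lee_fin ?EX_ge0.
    by apply: lee_wpmul2r; [exact: EY_ge0 | exact: key].
have E0 N' w : (0 <= EX a N' (X 0%N w) * EY b m (X 0%N w))%E by rewrite mule_ge0 ?EX_ge0 ?EY_ge0.
have e20' : (0 <= (2 * eta)%:E)%E by rewrite lee_fin.
have c0' : (0 <= (M * k%:R / N.+1%:R)%:E)%E by rewrite lee_fin.
have := ge0_integral_lin2 P (measurable_EXY a b N m) (measurable_EXY a b N.+1 m) (E0 N) (E0 N.+1) e20' c0'.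
by move=> ->.
Qed.

End SampleMoments.

Lemma weighted_sum_le {R : realType} (c x y : R) (A B A' B' : \bar R) :
  0 <= c -> 0 <= x -> 0 <= y -> c * (x + y) <= 1 -> (0 <= A)%E -> (0 <= B)%E ->
  (A' <= x%:E * A)%E -> (B' <= y%:E * B)%E ->
  (c%:E * A' * B + c%:E * A * B' <= A * B)%E.
Proof.
move=> c0 x0 y0 cxy A0 B0 hA hB; have AB0 : (0 <= A * B)%E by rewrite mule_ge0.
have ce0 : (0 <= c%:E)%E by rewrite lee_fin.
apply: (@le_trans _ _ (c%:E * (x%:E * (A * B)) + c%:E * (y%:E * (A * B)))%E).
  rewrite -!muleA; apply: leeD; apply: lee_wpmul2l => //.
    by rewrite muleA; apply: lee_wpmul2r.
  by rewrite muleCA; apply: lee_wpmul2l.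
rewrite !muleA -!EFinM -!muleA -ge0_muleDl ?lee_fin ?mulr_ge0// -EFinD -mulrDr.
by rewrite -[leRHS]mul1e; apply: lee_wpmul2r => //; rewrite lee_fin.
Qed.

Section FarPointWeights.
Context {R : realType} {dT} {T : measurableType dT} (P : probability T R).
Context {d : nat}.
Local Notation S := (d.-tuple R).
Variables X Y : nat -> T -> S.
Hypothesis mX : forall i, measurable_fun setT (X i).
Hypothesis mY : forall i, measurable_fun setT (Y i).
Hypothesis hind : mutually_independent P
  (fun z : nat + nat => match z with inl i => X i | inr j => Y j end).
Hypothesis lX : forall i A, measurable A -> P (X i @^-1` A) = P (X 0%N @^-1` A).
Hypothesis lY : forall i A, measurable A -> P (Y i @^-1` A) = P (Y 0%N @^-1` A).
Variable k : nat.
Hypothesis k0 : (0 < k)%N.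
Local Notation phi := (knn_power k).
Local Notation bad := (knn_far k).
Local Notation EX := (power_meanX P X k).
Local Notation EY := (power_meanY P Y k).
Local Notation U := (joint_moment P X Y k).

Let hX := mutually_independent_inl hind.

Definition far_mean (V : nat -> T -> S) a t N x :=
  Ev P V (iota 0 N) (fun s => phi a x s * (bad a t x s)%:R).

Lemma Ebad_ge0 (V : nat -> T -> S) a t N x : (0 <= far_mean V a t N x)%E.
Proof. by apply: Ev_ge0 => s; rewrite mulr_ge0// phi_ge0. Qed.

Lemma measurable_Ebad V a t N : (forall i, measurable_fun setT (V i)) ->
  measurable_fun setT (far_mean V a t N).
Proof.
move=> mV; apply: measurable_Ev => //; first exact: mfunXS_phi_bad.
by move=> x s; rewrite mulr_ge0// phi_ge0.
Qed.

(** A union bound splits the far event by sample. Each part is a far mean in one sample times a full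
    mean in the other, hence at most [thX] or [thY] times the product of the full means, and
    division by [th] compensates for their sum. *)
Lemma weighted_bad_point a b t i l N m (thX thY th : S -> R) :
  i \notin l -> uniq l -> size l = N ->
  measurable_fun setT th -> (forall x, 0 < th x) ->
  (forall x, 0 <= thX x) -> (forall x, 0 <= thY x) -> (forall x, thX x + thY x <= th x) ->
  {ae P, forall w, (far_mean X a t N (X 0%N w) <= (thX (X 0%N w))%:E * EX a N (X 0%N w))%E} ->
  {ae P, forall w, (far_mean Y b t m (X 0%N w) <= (thY (X 0%N w))%:E * EY b m (X 0%N w))%E} ->
  (\int[P]_w ((th (X i w))^-1 * (phi a (X i w) (sample X l w)
      * phi b (X i w) (sample Y (iota 0 m) w))
      * (bad a t (X i w) (sample X l w)
         || bad b t (X i w) (sample Y (iota 0 m) w))%:R)%:E <= U a b N m)%E.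
Proof.
move=> i0 ul sl mth th0 thX0 thY0 thXY aeX aeY.
pose FX x s : R := (th x)^-1 * (phi a x s * (bad a t x s)%:R).
pose FY (x : S) s : R := phi b x s * (bad b t x s)%:R.
pose GX x s : R := (th x)^-1 * phi a x s.
have thi0 x : 0 <= (th x)^-1 by rewrite invr_ge0 ltW.
have mthi : measurable_fun setT (fun x => (th x)^-1).
  rewrite (_ : (fun _ => _) = (fun x => th x `^ (-1))); last first.
    by apply/funext => x; rewrite powR_inv1// ltW.
  by apply: (@measurableT_comp _ _ _ _ _ _ (@powR R ^~ (-1))) => //; exact: measurable_powR.
have mthiX dU (W : measurableType dU) (x : W -> S) : measurable_fun setT x ->
    measurable_fun setT (fun u => (th (x u))^-1).
  by move=> mx; exact: (measurableT_comp mthi mx).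
have mFX : mfunXS FX.
  move=> dU W x s mx ms; apply: measurable_funM; first exact: mthiX.
  exact: (mfunXS_phi_bad k0 a t mx ms).
have mGX : mfunXS GX.
  move=> dU W x s mx ms; apply: measurable_funM; first exact: mthiX.
  exact: (mfunXS_phi k0 a mx ms).
have mFY : mfunXS FY by move=> dU W x s mx ms; exact: (mfunXS_phi_bad k0 b t mx ms).
have mpb : @mfunXS R d (phi b) by exact: mfunXS_phi.
have FX0 x s : 0 <= FX x s by rewrite mulr_ge0// mulr_ge0// phi_ge0.
have GX0 x s : 0 <= GX x s by rewrite mulr_ge0// phi_ge0.
have FY0 x s : 0 <= FY x s by rewrite mulr_ge0// phi_ge0.
have p0 c (x : S) s : 0 <= phi c x s by exact: phi_ge0.
have mX0 : measurable_fun setT (X i) by [].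
pose f1 w : R := FX (X i w) (sample X l w) * phi b (X i w) (sample Y (iota 0 m) w).
pose f2 w : R := GX (X i w) (sample X l w) * FY (X i w) (sample Y (iota 0 m) w).
have sX l0 : mseq (sample X l0) by exact: mseq_sample.
have sY l0 : mseq (sample Y l0) by exact: mseq_sample.
have mf1 : measurable_fun setT f1.
  by apply: measurable_funM; [exact: mFX | exact: mpb].
have mf2 : measurable_fun setT f2.
  by apply: measurable_funM; [exact: mGX | exact: mFY].
apply: (@le_trans _ _ (\int[P]_w (f1 w + f2 w)%:E)%E).
  apply: integral_ler => //.
  - apply: measurable_funM.
      apply: measurable_funM; first exact: mthiX.
      by apply: measurable_funM; [exact: (mfunXS_phi k0 a) | exact: mpb].
    apply: measurable_indicr; apply: measurable_or.
      apply: measurable_and => //; apply: measurable_fun_ltr => //.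
      exact: (measurable_knn k0).
    apply: measurable_and => //; apply: measurable_fun_ltr => //.
    exact: (measurable_knn k0).
  - exact: measurable_funD.
  - move=> w; apply: mulr_ge0; last exact: ler0n.
    by apply: mulr_ge0; [exact: thi0 | apply: mulr_ge0; exact: phi_ge0].
  - move=> w; rewrite /f1 /f2 /FX /GX /FY.
    set c := _^-1; set u := phi a _ _; set v := phi b _ _.
    have c0 : 0 <= c by exact: thi0.
    have u0 : 0 <= u by exact: phi_ge0.
    have v0 : 0 <= v by exact: phi_ge0.
    have cuv : 0 <= c * (u * v) by apply: mulr_ge0 => //; exact: mulr_ge0.
    by case: (bad a _ _ _); case: (bad b _ _ _) => /=; rewrite ?mulr1 ?mulr0 ?mul0r ?addr0 ?add0r; nra.
rewrite integral_addr//; last 2 first.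
- by move=> w; apply: mulr_ge0; [exact: FX0 | exact: phi_ge0].
- by move=> w; apply: mulr_ge0; [exact: GX0 | exact: FY0].
rewrite (Ev_point_XY mX mY hind lX (iota 0 m) i0 mFX mpb FX0 (p0 b)).
rewrite (Ev_point_XY mX mY hind lX (iota 0 m) i0 mGX mFY GX0 FY0).
have mEFX : measurable_fun setT (fun w => Ev P X (l) (FX (X 0%N w)) * EY b m (X 0%N w))%E.
  apply: emeasurable_funM.
    apply: (@measurableT_comp _ _ _ _ _ _ (fun x => Ev P X (l) (FX x)) _ (X 0%N)) => //.
    exact: measurable_Ev.
  exact: (measurableT_comp (measurable_EY P mY k0 b m)).
have mEGX : measurable_fun setT (fun w => Ev P X (l) (GX (X 0%N w)) * Ev P Y (iota 0 m) (FY (X 0%N w)))%E.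
  apply: emeasurable_funM.
    apply: (@measurableT_comp _ _ _ _ _ _ (fun x => Ev P X (l) (GX x)) _ (X 0%N)) => //.
    exact: measurable_Ev.
  apply: (@measurableT_comp _ _ _ _ _ _ (fun x => Ev P Y (iota 0 m) (FY x)) _ (X 0%N)) => //.
  exact: measurable_Ev.
rewrite -ge0_integralD//; last 2 first.
- by move=> w _; rewrite mule_ge0// Ev_ge0.
- by move=> w _; rewrite mule_ge0// Ev_ge0.
have mU : measurable_fun setT (fun w => EX a N (X 0%N w) * EY b m (X 0%N w))%E.
  exact: (measurable_EXY P mX mY k0).
apply: ae_ge0_le_integral => //.
- by move=> w _; rewrite adde_ge0// mule_ge0// Ev_ge0.
- exact: emeasurable_funD.
- by move=> w _; rewrite mule_ge0// ?EX_ge0 ?EY_ge0.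
apply: filterS2 aeX aeY => w hXw hYw _.
set x := X 0%N w in hXw hYw *.
have E1 : Ev P X (l) (FX x) = ((th x)^-1%:E * far_mean X a t N x)%E.
  rewrite /FX Ev_mulr//; first last.
  - by move=> s; apply: mulr_ge0; [exact: phi_ge0 | exact: ler0n].
  - by move=> dU W s ms; exact: (mfunXS_phi_bad k0 a t (measurable_cst x) ms).
  congr (_ * _)%E; apply: (Ev_exch mX hX lX); rewrite ?iota_uniq ?size_iota//.
  - by move=> dU W s ms; exact: (mfunXS_phi_bad k0 a t (measurable_cst x) ms).
  - by move=> s; apply: mulr_ge0; [exact: phi_ge0 | exact: ler0n].
have E2 : Ev P X (l) (GX x) = ((th x)^-1%:E * EX a N x)%E.
  rewrite /GX Ev_mulr; [|exact: mX|exact: mfunS_phi|exact: phi_ge0|exact: thi0].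
  by rewrite (EX_exch mX hind lX k0 a x ul) sl.
have cxy : (th x)^-1 * (thX x + thY x) <= 1 by rewrite mulrC ler_pdivrMr// mul1r.
have A0 := EX_ge0 P X k a N x; have B0 := EY_ge0 P Y k b m x.
rewrite E1 E2.
exact: (weighted_sum_le (thi0 x) (thX0 x) (thY0 x) cxy A0 B0 hXw hYw).
Qed.

End FarPointWeights.

Section AeDoubleIntegral.
Context {R : realType} {dT} {T : measurableType dT} (P : probability T R).
Local Open Scope ereal_scope.

(** [G] constrains each argument separately, so it is used once in the inner and once in the outer
    integral. *)
Lemma ae_double_integral_le (H : T -> T -> \bar R) (f : T -> \bar R) (q : R) (G : T -> Prop) :
  measurable_fun setT (fun u : T * T => H u.1 u.2) -> (forall w1 w2, 0 <= H w1 w2) ->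
  measurable_fun setT f -> (forall w, 0 <= f w) -> (0 <= q)%R ->
  {ae P, forall w, G w} -> (forall w1 w2, G w1 -> G w2 -> H w1 w2 <= q%:E * (f w1 * f w2)) ->
  \int[P]_w1 \int[P]_w2 H w1 w2 <= q%:E * (\int[P]_w f w * \int[P]_w f w).
Proof.
move=> mH H0 mf f0 q0 aeG HG.
have qe0 : 0 <= q%:E by rewrite lee_fin.
have I0 : 0 <= \int[P]_w f w by exact: integral_ge0.
have mH1 w1 : measurable_fun setT (H w1).
  exact: (measurable_fun_pair2 (f := fun u : T * T => H u.1 u.2)).
have mHI : measurable_fun setT (fun w1 => \int[P]_w2 H w1 w2).
  by apply: (measurable_fun_fubini_tonelli_F (m2 := P) (fun u : T * T => H u.1 u.2)) => // u.
apply: (@le_trans _ _ (\int[P]_w1 ((q%:E * \int[P]_w f w) * f w1))).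
  apply: ae_ge0_le_integral => //.
  - by move=> w _; exact: integral_ge0.
  - by move=> w _; rewrite mule_ge0// mule_ge0.
  - exact: emeasurable_funM.
  apply: filterS (aeG) => w1 G1 _.
  have -> : q%:E * \int[P]_w f w * f w1 = \int[P]_w2 ((q%:E * f w1) * f w2).
    by rewrite ge0_integralZl// ?mule_ge0// muleAC.
  apply: ae_ge0_le_integral => //.
  - by move=> w _; rewrite mule_ge0// mule_ge0.
  - exact: emeasurable_funM.
  by apply: filterS (aeG) => w2 G2 _; rewrite -muleA; exact: HG.
by rewrite ge0_integralZl ?mule_ge0// muleA.
Qed.

End AeDoubleIntegral.

(** Six factors [r]: two for dropping each point from the list of the other, two from the pair bound
    in the [X] sample, two from that in the [Y] sample. *)
Lemma good_prod_le {R : realType} (r : R) (A B A1 A2 B1 B2 : \bar R) :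
  0 <= r -> (0 <= A)%E -> (0 <= B)%E ->
  (A <= (r ^+ 2)%:E * ((r%:E * A1) * (r%:E * A2)))%E ->
  (B <= (r%:E * B1) * (r%:E * B2))%E ->
  (A * B <= (r ^+ 6)%:E * ((A1 * B1) * (A2 * B2)))%E.
Proof.
move=> r0 A0 B0 hA hB; apply: (le_trans (lee_pmul A0 B0 hA hB)).
rewrite le_eqVlt; apply/orP; left; apply/eqP.
have -> : (r ^+ 6)%:E = ((r ^+ 2)%:E * (r%:E * r%:E) * (r%:E * r%:E) :> \bar R)%E.
  by rewrite -!EFinM; congr EFin; ring.
rewrite [(r%:E * A1 * (r%:E * A2))%E]muleACA [(r%:E * B1 * (r%:E * B2))%E]muleACA.
by rewrite [(A1 * B1 * _)%E]muleACA -!muleA; congr (_ * (_ * (_ * _)))%E; rewrite !muleA;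
   rewrite -[(A1 * A2 * _ * _)%E]muleA [((A1 * A2) * (r%:E * r%:E))%E]muleC !muleA.
Qed.

(** * Pairs of separated near points *)

Section GoodPairBound.
Context {R : realType} {dT} {T : measurableType dT} (P : probability T R).
Context {d : nat} (hd : (0 < d)%N).
Local Notation S := (d.-tuple R).
Variables X Y : nat -> T -> S.
Hypothesis mX : forall i, measurable_fun setT (X i).
Hypothesis mY : forall i, measurable_fun setT (Y i).
Hypothesis hind : mutually_independent P
  (fun z : nat + nat => match z with inl i => X i | inr j => Y j end).
Hypothesis lX : forall i A, measurable A -> P (X i @^-1` A) = P (X 0%N @^-1` A).
Hypothesis lY : forall i A, measurable A -> P (Y i @^-1` A) = P (Y 0%N @^-1` A).
Variable k : nat.
Hypothesis k0 : (0 < k)%N.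
Local Notation phig := (knn_power_near k).
Local Notation U := (joint_moment P X Y k).

Let hX := mutually_independent_inl hind.
Let hY := mutually_independent_inr hind.

(** If [x] is near, a point beyond [t] does not affect its k-NN distance, so dropping it changes the
    normalization only. *)
Lemma phig_cons_far_le (a t : R) (x y : S) s : (k <= size s)%N -> 0 < t -> t < euclid_dist x y ->
  phig a t x (y :: s) <= succ_ratio (size s) a * phig a t x s.
Proof.
move=> ks t0 far; have ks' : (0 < k <= size s)%N by rewrite k0.
have ratio0 := succ_ratio_ge0 (size s) a.
rewrite /knn_power_near /knn_far; have [->|a0] := eqVneq a 0.
  by rewrite !phi0 /succ_ratio oppr0 powRr0 !mulr1.
rewrite /=; case: ltP => /= kt; first by rewrite mulr0 mulr_ge0// mulr_ge0// phi_ge0.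
have E := knn_cons_far ks' far kt.
rewrite -E ltNge kt/= !mulr1 /knn_power E /= natS_powR ?mulrA//.
exact: leq_trans ks.
Qed.

(** Each of the two points also occurs in the list of the other. They are removed by
    [phig_cons_far_le] first, so that both summands become functions of one common list, to which
    [Ev_good_pair] applies. *)
Lemma good_pair_bound (a b c c' t e : R) : 0 < c -> 0 < c' -> 0 < t -> 0 < e ->
  {ae P, forall w, regular P X a c (X 0%N w)} -> {ae P, forall w, regular P Y b c' (X 0%N w)} ->
  exists N1 : nat, forall N m, (N1 <= N)%N -> (N1 <= m)%N ->
  (\int[P]_w (((2 * d%:R * t < euclid_dist (X 0%N w) (X 1%N w))%R%:R *
     (phig a t (X 0%N w) (X 1%N w :: sample X (iota 2 N) w) *
      phig a t (X 1%N w) (X 0%N w :: sample X (iota 2 N) w))) *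
     (phig b t (X 0%N w) (sample Y (iota 0 m) w) * phig b t (X 1%N w) (sample Y (iota 0 m) w)))%:E
   <= ((1 + e) ^+ 6)%:E * (U a b N m * U a b N m))%E.
Proof.
move=> c0 c'0 t0 e0 aeX aeY.
have [n1 h1] := Ev_good_pair hd mX hX lX k0 a c0 t0 e0.
have [n2 h2] := Ev_good_pair hd mY hY lY k0 b c'0 t0 e0.
have [n3 h3] := succ_ratio_le a e0.
exists (maxn k (maxn n1 (maxn n2 n3))) => N m.
rewrite !geq_max => /and4P[kN n1N _ n3N] /and4P[_ _ n2m _].
pose F (x y : S) s : R := (2 * d%:R * t < euclid_dist x y)%R%:R *
  (phig a t x (y :: s) * phig a t y (x :: s)).
pose G (x y : S) s : R := phig b t x s * phig b t y s.
have mg a' dU (W : measurableType dU) (x : W -> S) s : measurable_fun setT x -> mseq s ->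
    measurable_fun setT (fun u => phig a' t (x u) (s u)).
  by move=> mx ms; exact: (mfunXS_phi_good k0 a' t mx ms).
have mF : mfunXXS F.
  move=> dU W x y s mx my ms; apply: measurable_funM.
    apply: measurable_indicr; apply: measurable_fun_ltr => //.
    exact: measurable_euclid_dist.
  by apply: measurable_funM; apply: mg => //; exact: mseq_cons.
have mG : mfunXXS G by move=> dU W x y s mx my ms; apply: measurable_funM; exact: mg.
have F0 x y s : 0 <= F x y s.
  by apply: mulr_ge0; [exact: ler0n | apply: mulr_ge0; exact: phig_ge0].
have G0 x y s : 0 <= G x y s by apply: mulr_ge0; exact: phig_ge0.
have i0 : 0%N \notin iota 2 N by rewrite mem_iota.
have i1 : 1%N \notin iota 2 N by rewrite mem_iota.
have -> := Ev_pair_XY mX mY hind lX (iota 0 m) (isT : 0%N != 1%N) i0 i1 mF mG F0 G0.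
pose H w1 w2 := (Ev P X (iota 2 N) (F (X 0%N w1) (X 0%N w2))
                 * Ev P Y (iota 0 m) (G (X 0%N w1) (X 0%N w2)))%E.
pose reg w := regular P X a c (X 0%N w) /\ regular P Y b c' (X 0%N w).
have mXX : measurable_fun setT (fun u : T * T => (X 0%N u.1, X 0%N u.2)).
  by apply: measurable_fun_pair; exact: (measurableT_comp (mX 0%N)).
have e1 : 0 <= 1 + e by rewrite addr_ge0// ltW.
apply: (@ae_double_integral_le _ _ _ _ H _ ((1 + e) ^+ 6) reg).
- apply: emeasurable_funM.
    exact: (measurableT_comp (measurable_Ev2 P (iota 2 N) mX mF F0) mXX).
  exact: (measurableT_comp (measurable_Ev2 P (iota 0 m) mY mG G0) mXX).
- by move=> w1 w2; apply: mule_ge0; apply: Ev_ge0 => s; [exact: F0 | exact: G0].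
- exact: (measurable_EXY P mX mY k0).
- by move=> w; apply: mule_ge0; [exact: EX_ge0 | exact: EY_ge0].
- exact: exprn_ge0.
- by apply: filterS2 aeX aeY => w; split.
move=> w1 w2 [rX1 rY1] [rX2 rY2]; rewrite /H.
set x := X 0%N w1 in rX1 rY1 *; set y := X 0%N w2 in rX2 rY2 *.
have [far|near] := ltP (2 * d%:R * t) (euclid_dist x y); last first.
  rewrite (_ : F x y = fun=> 0); last first.
    by apply/funext => s; rewrite /F ltNge near mul0r.
  rewrite Ev_cst mul0e mule_ge0//; first by rewrite lee_fin exprn_ge0.
  by rewrite !mule_ge0// ?EX_ge0 ?EY_ge0.
have tfar : t < euclid_dist x y.
  apply: le_lt_trans far; rewrite -[leLHS]mul1r ler_pM2r//.
  by rewrite -natrM ler1n muln_gt0.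
have tfar' : t < euclid_dist y x by rewrite euclid_distC.
apply: good_prod_le => //.
- by apply: Ev_ge0 => s; exact: F0.
- by apply: Ev_ge0 => s; exact: G0.
- have N1s : (n1 <= size (iota 2 N))%N by rewrite size_iota.
  have := h1 _ _ _ rX1 rX2 far (iota_uniq 2 N) N1s.
  rewrite !(EX_exch mX hind lX k0 _ _ (iota_uniq 2 N)) size_iota => hh.
  have e20 : 0 <= (1 + e) ^+ 2 by rewrite exprn_ge0.
  apply: le_trans; last first.
    by apply: lee_wpmul2l; [rewrite lee_fin; exact: e20 | exact: hh].
  rewrite -Ev_mulr//; first last.
  + by move=> s; apply: mulr_ge0; exact: phig_ge0.
  + by apply: mfunSM; exact: mfunS_phig.
  apply: le_Ev => //.
  + by move=> dU W s ms; exact: (mF _ _ _ _ _ (measurable_cst x) (measurable_cst y) ms).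
  + move=> dU W s ms; apply: measurable_funM => //.
    by apply: measurable_funM; exact: (mfunS_phig k0).
  + move=> s; rewrite size_iota => sN; rewrite /F far mul1r.
    have rN := h3 _ n3N; have r0 := succ_ratio_ge0 N a.
    have ks : (k <= size s)%N by rewrite sN.
    have g1 := phig_cons_far_le a ks t0 tfar; have g2 := phig_cons_far_le a ks t0 tfar'.
    rewrite sN in g1 g2.
    have q1 := phig_ge0 k a t x s; have q2 := phig_ge0 k a t y s.
    apply: (@le_trans _ _ (((1 + e) * phig a t x s) * ((1 + e) * phig a t y s))).
      apply: ler_pM; try exact: phig_ge0.
        by apply: (le_trans g1); exact: ler_wpM2r.
      by apply: (le_trans g2); exact: ler_wpM2r.
    by rewrite mulrACA -expr2.
- by apply: h2; rewrite ?size_iota ?iota_uniq.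
Qed.

End GoodPairBound.

(** * The weights of the AM-GM inequality *)

Section Weights.
Context {R : realType} {dT} {T : measurableType dT} (P : probability T R).
Context {d : nat} (hd : (0 < d)%N).
Local Notation S := (d.-tuple R).
Variable V : nat -> T -> S.
Hypothesis mV : forall i, measurable_fun setT (V i).
Hypothesis hV : mutually_independent P V.
Hypothesis lV : forall i A, measurable A -> P (V i @^-1` A) = P (V 0%N @^-1` A).
Variable k : nat.
Hypothesis k0 : (0 < k)%N.
Local Notation phi := (knn_power k).
Local Notation Ebad := (far_mean P k V).
Variables (X0 : T -> S) (mX0 : measurable_fun setT X0).

(** The quantifier over [e] stands inside the almost sure statement, since one null set must serve
    for the whole limit. *)
Lemma Ebad_small (a c t : R) : 0 < c -> 0 < t ->
  (a < 0 -> {ae P, forall w, (0 < P (V 0%N @^-1` eball (X0 w) t))%E}) ->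
  (a < 0 -> exists2 N0 : nat, (k <= N0)%N &
     {ae P, forall w, (Ev P V (iota 0 N0) (phi a (X0 w)) < +oo)%E}) ->
  {ae P, forall w, forall e : R, 0 < e -> exists N1 : nat, forall N, (N1 <= N)%N ->
     (Ebad a t N (X0 w) <= e%:E)%E}.
Proof.
move=> c0 t0 hmass hfin; have [a0|a0|a0] := ltgtP a 0.
- have [N0 kN0 fin0] := hfin a0.
  apply: filterS2 (hmass a0) fin0 => w mw fw e e0.
  have kN0' : (k <= size (iota 0 N0))%N by rewrite size_iota.
  have [N1 h] := Ev_phi_bad_small_neg mV hV lV k0 a0 t0 e0 mw (iota_uniq 0 N0) kN0' fw.
  by exists N1 => N N1N; apply: h; rewrite ?iota_uniq ?size_iota.
- apply: aeW => w e e0; have [N1 h] := Ev_phi_bad_small_pos P mV k0 (X0 w) a0 t0 e0.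
  by exists N1 => N N1N; apply: h; rewrite size_iota.
- apply: aeW => w e e0; exists 0%N => N _.
  rewrite /far_mean a0 (_ : (fun s => _) = fun=> 0).
    by rewrite Ev_cst lee_fin ltW.
  by apply/funext => s; rewrite /knn_far eqxx mulr0.
Qed.

(** The witness is [min (1, far mean / c1) + 1 / (N + 1)], with [c1] a lower bound for the mean
    power, which may itself be infinite. The cap 1 provides a dominating constant, and the last term
    keeps the weight positive so that it can be inverted. *)
Lemma bad_weights (a c t : R) : 0 < c -> 0 < t ->
  {ae P, forall w, regular P V a c (X0 w)} ->
  (a < 0 -> {ae P, forall w, (0 < P (V 0%N @^-1` eball (X0 w) t))%E}) ->
  (a < 0 -> exists2 N0 : nat, (k <= N0)%N &
     {ae P, forall w, (Ev P V (iota 0 N0) (phi a (X0 w)) < +oo)%E}) ->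
  exists th : nat -> S -> R, [/\ forall N, measurable_fun setT (th N),
    forall N x, 0 < th N x <= 2,
    exists N1 : nat, forall N, (N1 <= N)%N ->
      {ae P, forall w, (Ebad a t N (X0 w) <=
                        (th N (X0 w))%:E * Ev P V (iota 0 N) (phi a (X0 w)))%E} &
    forall e : R, 0 < e -> exists N1 : nat, forall N, (N1 <= N)%N ->
      (\int[P]_w (th N (X0 w))%:E <= e%:E)%E].
Proof.
move=> c0 t0 hreg hmass hfin.
have [c1 c10 [n1 h1]] := Ev_phi_ge hd mV hV lV k0 a c0.
pose g N x : \bar R := mine 1%E ((c1^-1)%:E * Ebad a t N x)%E.
have E0 N x := Ebad_ge0 P k V a t N x.
have ci0 : (0 <= (c1^-1)%:E :> \bar R)%E by rewrite lee_fin invr_ge0 ltW.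
have g0 N x : (0 <= g N x)%E by rewrite /g le_min lee01/= mule_ge0.
have g1 N x : (g N x <= 1)%E by rewrite /g ge_min lexx.
have /choice[r hr] : forall u : nat * S, exists r : R, g u.1 u.2 = r%:E.
  move=> u; have := g0 u.1 u.2; have := g1 u.1 u.2.
  by case: (g u.1 u.2) => [r _ _| |//]; [exists r | rewrite leye_eq].
have gr N x : g N x = (r (N, x))%:E by rewrite -(hr (N, x)).
have r01 N x : 0 <= r (N, x) <= 1 by rewrite -!lee_fin -gr g0 g1.
have mr N : measurable_fun setT (fun x => r (N, x)).
  apply/measurable_EFinP; rewrite (_ : _ \o _ = g N); last first.
    by apply/funext => x; rewrite gr.
  apply: measurable_mine => //; apply: emeasurable_funM => //.
  exact: (measurable_Ebad P k0 a t N mV).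
have iN N : 0 < (N.+1%:R^-1 : R) <= 1 by rewrite invr_gt0 ltr0n/= invf_le1// ler1n.
pose th N x : R := r (N, x) + N.+1%:R^-1.
have mth N : measurable_fun setT (th N) by exact: measurable_funD.
have th02 N x : 0 < th N x <= 2.
  have /andP[h2 h3] := r01 N x; have /andP[h4 h5] := iN N.
  apply/andP; split; first exact: ltr_wpDl.
  by apply: (le_trans (lerD h3 h5)); exact: lexx.
exists th; split => //.
- exists n1 => N n1N; apply: filterS hreg => w rw.
  have := h1 _ (iota 0 N) rw (iota_uniq 0 N); rewrite size_iota => /(_ n1N).
  set x := X0 w; set A := Ev _ _ _ _ => cA.
  have A0 : (0 <= A)%E by apply: Ev_ge0 => s; exact: phi_ge0.
  have EA : (Ebad a t N x <= A)%E.
    apply: le_Ev => //.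
    - by move=> dU W s ms; exact: (mfunXS_phi_bad k0 a t (measurable_cst x) ms).
    - exact: mfunS_phi.
    - by move=> s; apply: mulr_ge0; [exact: phi_ge0 | exact: ler0n].
    - move=> s _; rewrite ler_piMr ?phi_ge0//; by case: (knn_far _ _ _ _ _).
  have rth : (r (N, x))%:E = g N x :> \bar R by rewrite gr.
  apply: (@le_trans _ _ ((r (N, x))%:E * A)%E); last first.
    by apply: lee_wpmul2r => //; rewrite lee_fin lerDl; have /andP[/ltW] := iN N.
  rewrite rth /g; have [hc|hc] := leP 1%E ((c1^-1)%:E * Ebad a t N x)%E; first by rewrite mul1e.
  rewrite -{1}[Ebad a t N x]mul1e -(_ : (c1^-1)%:E * c1%:E = 1)%E; last first.
    by rewrite -EFinM mulVf ?gt_eqF.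
  by rewrite muleAC; apply: lee_wpmul2l => //; rewrite mule_ge0.
- have hsm := Ebad_small c0 t0 hmass hfin.
  have mthX N : measurable_fun setT (fun w => th N (X0 w)) by exact: (measurableT_comp (mth N)).
  have cv : (\int[P]_w (th N (X0 w))%:E)%E @[N --> \oo] --> (\int[P]_w (cst 0 w : \bar R))%E.
    have mf_ N : measurable_fun setT (fun w => (th N (X0 w))%:E) by exact/measurable_EFinP.
    have ig : P.-integrable setT (EFin \o cst (2 : R)) by exact: finite_measure_integrable_cst.
    have f_g : {ae P, forall w N, setT w -> (`|(th N (X0 w))%:E| <= (EFin \o cst 2%R) w)%E}.
      apply: aeW => w N _; rewrite /= lee_fin; have /andP[h2 h3] := th02 N (X0 w).
      by rewrite ger0_norm// ltW.
    have f_f : {ae P, forall w, setT w -> (th N (X0 w))%:E @[N --> \oo] --> (cst 0 w : \bar R)}.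
      apply: filterS hsm => w hw _.
      apply: cvg_EFin; first exact: nearW.
      apply/cvgrPdist_le => e e0.
      have ce0 : 0 < c1 * (e / 2) by rewrite mulr_gt0// divr_gt0.
      have [N1 hN1] := hw _ ce0.
      exists (maxn N1 (Num.truncn (e / 2)^-1)) => //= N; rewrite /= geq_max => /andP[N1N N2N].
      have /andP[t1 _] := th02 N (X0 w).
      rewrite sub0r normrN ger0_norm; last exact: ltW.
      rewrite /th.
      have h2 : r (N, X0 w) <= e / 2.
        rewrite -lee_fin -gr /g ge_min; apply/orP; right.
        apply: le_trans (lee_wpmul2l ci0 (hN1 _ N1N)) _.
        by rewrite -EFinM lee_fin mulrA mulVf ?gt_eqF// mul1r.
      have h3 : N.+1%:R^-1 <= e / 2.
        rewrite -[leRHS]invrK lef_pV2 ?posrE ?invr_gt0 ?divr_gt0//.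
        by apply: ltW; apply: lt_le_trans (truncnS_gt _) _; rewrite ler_nat.
      by rewrite [leRHS]splitr lerD.
    by have [_ _ ] := dominated_convergence measurableT mf_ (measurable_cst 0%E) f_f ig f_g.
  move=> e e0; move: cv; rewrite integral0 => /fine_cvgP[[N1 _ hfin1] cv].
  have [N2 _ h2] := (@cvgr_le R nat \oo _ _ 0 cv e e0).
  exists (maxn N1 N2) => N; rewrite geq_max => /andP[N1N N2N].
  have := h2 N N2N; rewrite /= -lee_fin fineK//; exact: hfin1.
Qed.

End Weights.

Lemma perturbed_square {R : realType} (D e : R) : 0 <= D -> 0 < e ->
  exists2 u : R, 0 < u & (1 + u) ^+ 6 * ((D + u) * (D + u)) <= D * D + e.
Proof.
(* On [[0, 1]] one has [(1 + u)^6 <= 1 + 63 * u], as [63 = 2^6 - 1]; the 64 collects the terms [u]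
   and [63 * u^2] in front of [2 * D + 1]. *)
move=> D0 e0; pose C := 63 * (D * D) + 64 * (2 * D + 1).
have DD0 : 0 <= D * D by exact: mulr_ge0.
have C0 : 0 < C by rewrite /C; lra.
pose u := Num.min 1 (e / C).
have u0 : 0 < u by rewrite lt_min ltr01 divr_gt0.
have u1 : u <= 1 by rewrite /u ge_min lexx.
have uC : u * C <= e by rewrite -ler_pdivlMr// /u ge_min lexx orbT.
exists u => //.
have u0' := ltW u0.
have uu : u * u <= u by exact: ler_piMr.
have uuu : u * (u * u) <= u by apply: (le_trans _ uu); exact: ler_wpM2l.
have h6 : (1 + u) ^+ 6 <= 1 + 63 * u.
  have -> : (1 + u) ^+ 6 = ((1 + u) ^+ 2) ^+ 3 by rewrite -exprM.
  apply: (@le_trans _ _ ((1 + 3 * u) ^+ 3)).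
    have h2 : (1 + u) ^+ 2 <= 1 + 3 * u.
      have -> : (1 + u) ^+ 2 = 1 + 2 * u + u * u by ring.
      lra.
    by apply: lerXn2r => //; rewrite nnegrE ?sqr_ge0//; lra.
  have -> : (1 + 3 * u) ^+ 3 = 1 + 9 * u + 27 * (u * u) + 27 * (u * (u * u)) by ring.
  lra.
have hD : (D + u) * (D + u) <= D * D + u * (2 * D + 1).
  have -> : (D + u) * (D + u) = D * D + u * (2 * D) + u * u by ring.
  lra.
have D20 : 0 <= (D + u) * (D + u) by rewrite mulr_ge0// addr_ge0// ltW.
have p6 : 0 <= (1 + u) ^+ 6 by rewrite exprn_ge0// addr_ge0// ltW.
apply: (le_trans (ler_pM p6 D20 h6 hD)).
have -> : (1 + 63 * u) * (D * D + u * (2 * D + 1)) =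
  D * D + u * (63 * (D * D)) + u * (2 * D + 1) + 63 * (u * u) * (2 * D + 1) by ring.
have h3 : 63 * (u * u) * (2 * D + 1) <= 63 * u * (2 * D + 1).
  by rewrite ler_wpM2r// ?ler_wpM2l//; lra.
move: uC; rewrite /C mulrDr; lra.
Qed.

(** * The cross moment of two summands *)

Section CrossMoment.
Context {R : realType} {dT} {T : measurableType dT} (P : probability T R).
Context {d : nat} (hd : (0 < d)%N).
Local Notation S := (d.-tuple R).
Variables X Y : nat -> T -> S.
Hypothesis mX : forall i, measurable_fun setT (X i).
Hypothesis mY : forall i, measurable_fun setT (Y i).
Hypothesis hind : mutually_independent P
  (fun z : nat + nat => match z with inl i => X i | inr j => Y j end).
Hypothesis lX : forall i A, measurable A -> P (X i @^-1` A) = P (X 0%N @^-1` A).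
Hypothesis lY : forall i A, measurable A -> P (Y i @^-1` A) = P (Y 0%N @^-1` A).
Variable k : nat.
Hypothesis k0 : (0 < k)%N.
Local Notation phi := (knn_power k).
Local Notation bad := (knn_far k).
Local Notation phig := (knn_power_near k).
Local Notation EX := (power_meanX P X k).
Local Notation EY := (power_meanY P Y k).
Local Notation U := (joint_moment P X Y k).

Let hX := mutually_independent_inl hind.
Let hY := mutually_independent_inr hind.

Variables (al be c c' : R).
Hypothesis c0 : 0 < c.
Hypothesis c'0 : 0 < c'.
Hypothesis regX : {ae P, forall w, regular P X al c (X 0%N w)}.
Hypothesis regY : {ae P, forall w, regular P Y be c' (X 0%N w)}.
Hypothesis massX : al < 0 ->
  {ae P, forall w, forall t : R, 0 < t -> (0 < P (X 0%N @^-1` eball (X 0%N w) t))%E}.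
Hypothesis massY : be < 0 ->
  {ae P, forall w, forall t : R, 0 < t -> (0 < P (Y 0%N @^-1` eball (X 0%N w) t))%E}.
Hypothesis small : forall e : R, 0 < e ->
  exists2 t : R, 0 < t & forall x, (P (X 0%N @^-1` eball x t) <= e%:E)%E.
Variables (K D : R).
Hypothesis K0 : 0 <= K.
Hypothesis D0 : 0 <= D.
Hypothesis HK : exists N0 : nat, forall n m, (N0 <= n)%N -> (N0 <= m)%N ->
  (U (2 * al) (2 * be) n m <= K%:E)%E.
Hypothesis HD : forall e : R, 0 < e -> exists N0 : nat, forall n m, (N0 <= n)%N -> (N0 <= m)%N ->
  (U al be n m <= (D + e)%:E)%E.

Lemma regular_double (V : nat -> T -> S) a b x : regular P V a b x -> regular P V (2 * a) b x.
Proof.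
move=> [h1 h2 h3]; split => // h; [apply: h2|apply: h3].
  by move: h; rewrite pmulr_rgt0.
by move: h; rewrite pmulr_rlt0.
Qed.

Let regX2 : {ae P, forall w, regular P X (2 * al) c (X 0%N w)}.
Proof. by apply: filterS regX => w; exact: regular_double. Qed.

Let regY2 : {ae P, forall w, regular P Y (2 * be) c' (X 0%N w)}.
Proof. by apply: filterS regY => w; exact: regular_double. Qed.

(** [HK] controls only the product of the two means. Almost sure finiteness passes to each factor
    because the other one is bounded below by a positive constant. The size [N0] found here starts
    the estimate of far points for negative exponents. *)
Lemma second_moments_finite : exists2 N0 : nat, (k <= N0)%N &
  {ae P, forall w, (EX (2 * al) N0 (X 0%N w) < +oo)%E /\ (EY (2 * be) N0 (X 0%N w) < +oo)%E}.
Proof.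
have [nK hK] := HK.
have [c1 c10 [n1 h1]] := Ev_phi_ge hd mX hX lX k0 (2 * al) c0.
have [c2 c20 [n2 h2]] := Ev_phi_ge hd mY hY lY k0 (2 * be) c'0.
pose N0 := maxn k (maxn nK (maxn n1 n2)).
have kN : (k <= N0)%N by exact: leq_maxl.
have nKN : (nK <= N0)%N by rewrite /N0 !leq_max leqnn !orbT.
have n1N : (n1 <= N0)%N by rewrite /N0 !leq_max leqnn !orbT.
have n2N : (n2 <= N0)%N by rewrite /N0 !leq_max leqnn !orbT.
exists N0 => //.
have mU := measurable_EXY P mX mY k0 (2 * al) (2 * be) N0 N0.
have E0 w : (0 <= EX (2 * al) N0 (X 0%N w) * EY (2 * be) N0 (X 0%N w))%E.
  by apply: mule_ge0; [exact: EX_ge0 | exact: EY_ge0].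
have iU : P.-integrable setT (fun w => EX (2 * al) N0 (X 0%N w) * EY (2 * be) N0 (X 0%N w))%E.
  apply/integrableP; split; first exact: mU.
  under eq_integral do rewrite gee0_abs//.
  by apply: (le_lt_trans (hK _ _ nKN nKN)); rewrite ltry.
have aefin := integrable_ae measurableT iU.
apply: filterS3 aefin regX2 regY2 => w /(_ I) fw rx ry.
have := h1 _ (iota 0 N0) rx (iota_uniq 0 N0); rewrite size_iota => /(_ n1N) A1.
have := h2 _ (iota 0 N0) ry (iota_uniq 0 N0); rewrite size_iota => /(_ n2N) B1.
move: fw A1 B1; rewrite -/(EX (2 * al) N0 _) -/(EY (2 * be) N0 _).
case: (EX _ _ _) => [A| |]; case: (EY _ _ _) => [B| |] //=.
- by rewrite !ltry.
- move=> + A1 _; rewrite gt0_muley//; exact: lt_le_trans A1.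
- move=> + _ B1; rewrite gt0_mulye//; exact: lt_le_trans B1.
Qed.

(* AM-GM: z1 z2 <= (dl / th1 * z1^2 + th1 / dl * z2^2) / 2 on the event b1, and
   symmetrically on b2. *)
Lemma cross_split (z1 z2 g t1 t2 dl : R) (nr b1 b2 : bool) :
  0 <= z1 -> 0 <= z2 -> 0 <= g -> 0 < t1 -> 0 < t2 -> 0 < dl ->
  (~~ nr -> ~~ b1 -> ~~ b2 -> z1 * z2 <= g) ->
  z1 * z2 <= (nr%:R + dl^-1 * t2) / 2 * z1 ^+ 2 + (nr%:R + dl^-1 * t1) / 2 * z2 ^+ 2
     + dl / 2 * (t1^-1 * z1 ^+ 2 * b1%:R) + dl / 2 * (t2^-1 * z2 ^+ 2 * b2%:R) + g.
Proof.
move=> z10 z20 g0 t10 t20 dl0 hg.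
have amgm (t u v : R) : 0 < t -> u * v <= dl / 2 * (t^-1 * u ^+ 2) + dl^-1 * t / 2 * v ^+ 2.
  move=> t0; rewrite -subr_ge0.
  have -> : dl / 2 * (t^-1 * u ^+ 2) + dl^-1 * t / 2 * v ^+ 2 - u * v =
            dl / (2 * t) * (u - t / dl * v) ^+ 2 by field; rewrite !gt_eqF.
  by rewrite mulr_ge0 ?sqr_ge0// divr_ge0 ?mulr_ge0// ltW.
have s1 : 0 <= z1 ^+ 2 by exact: sqr_ge0.
have s2 : 0 <= z2 ^+ 2 by exact: sqr_ge0.
have dli : 0 <= dl^-1 by rewrite invr_ge0 ltW.
have t1i : 0 <= t1^-1 by rewrite invr_ge0 ltW.
have t2i : 0 <= t2^-1 by rewrite invr_ge0 ltW.
have dt1 : 0 <= dl^-1 * t1 / 2 by apply: divr_ge0 => //; apply: mulr_ge0 => //; exact: ltW.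
have dt2 : 0 <= dl^-1 * t2 / 2 by apply: divr_ge0 => //; apply: mulr_ge0 => //; exact: ltW.
have dl2 : 0 <= dl / 2 by apply: divr_ge0 => //; exact: ltW.
have p1 : 0 <= dl^-1 * t1 / 2 * z2 ^+ 2 by exact: mulr_ge0.
have p2 : 0 <= dl^-1 * t2 / 2 * z1 ^+ 2 by exact: mulr_ge0.
have p3 : 0 <= dl / 2 * (t1^-1 * z1 ^+ 2) by apply: mulr_ge0 => //; exact: mulr_ge0.
have p4 : 0 <= dl / 2 * (t2^-1 * z2 ^+ 2) by apply: mulr_ge0 => //; exact: mulr_ge0.
have E (r t v : R) : (r + dl^-1 * t) / 2 * v = r / 2 * v + dl^-1 * t / 2 * v by field; rewrite gt_eqF.
have q1 := amgm _ z1 z2 t10; have q2 := amgm _ z2 z1 t20; rewrite [z2 * z1]mulrC in q2.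
(* Any one of the three events already pays for the product; [g] is called upon only when none
   occurs. *)
rewrite !E; case: nr hg => [_|]; last case: b1 => [_|]; last case: b2 => [_|/(_ isT isT isT) hz].
- have : z1 * z2 <= 2^-1 * z1 ^+ 2 + 2^-1 * z2 ^+ 2.
    by have := sqr_ge0 (z1 - z2); rewrite sqrrB mulr2n; lra.
  case: b1; case: b2; rewrite ?mulr1 ?mulr0 ?div1r; lra.
- by case: b2; rewrite ?mulr1 ?mulr0 ?mul0r; lra.
- by rewrite ?mulr1 ?mulr0 ?mul0r; lra.
- by rewrite ?mulr1 ?mulr0 ?mul0r; lra.
Qed.

Lemma bad_double a t (x : S) s : bad (2 * a) t x s = bad a t x s.
Proof. by rewrite /knn_far mulf_eq0 pnatr_eq0. Qed.

(** [N] counts the points other than the two in question, so a sample of size [n] has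
    [N = n - 2]. *)
Definition cross_moment N m : \bar R :=
  (\int[P]_w ((phi al (X 0%N w) (X 1%N w :: sample X (iota 2 N) w)
                * phi be (X 0%N w) (sample Y (iota 0 m) w)) *
              (phi al (X 1%N w) (X 0%N w :: sample X (iota 2 N) w)
                * phi be (X 1%N w) (sample Y (iota 0 m) w)))%:E)%E.

(** Error budget: [e / 4] for separated near pairs, [e / 4] for the far terms, [e / 4] for the means
    of proximity and weights, [e / 8] for the [k / N] correction. First [dl] is fixed from [K], then
    [t] from [eta1], then [eta2] from [dl], and the sample sizes last. *)
Lemma cross_le (e : R) : 0 < e -> exists N0 : nat, forall N m, (N0 <= N)%N -> (N0 <= m)%N ->
  (cross_moment N m <= (D * D + e)%:E)%E.
Proof.
move=> e0.
have e4 : 0 < e / 4 by rewrite divr_gt0.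
have K1 : 0 < K + 1 by rewrite ltr_wpDl.
have [u u0 hu] := perturbed_square D0 e4.
pose dl := e / 4 / (K + 1).
have dl0 : 0 < dl by rewrite divr_gt0.
have dlK : dl * K <= e / 4.
  have -> : e / 4 = dl * (K + 1) by rewrite /dl; field; rewrite gt_eqF.
  by rewrite ler_wpM2l ?lerDl// ltW.
pose eta1 := e / (16 * (K + 1)).
have eta10 : 0 < eta1 by rewrite divr_gt0// mulr_gt0.
have eta1K : 2 * eta1 * K <= e / 8.
  have -> : e / 8 = 2 * eta1 * (K + 1) by rewrite /eta1; field; rewrite gt_eqF.
  by rewrite ler_wpM2l ?lerDl// ltW// mulr_gt0.
have [t' t'0 ht'] := small eta10.
have dR : 0 < d%:R :> R by rewrite ltr0n.
(* The proximity radius [2 * d * t] is then exactly [t'], whose balls have mass at most [eta1]. *)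
pose t := t' / (2 * d%:R).
have t0 : 0 < t by rewrite divr_gt0// mulr_gt0.
have tE : 2 * d%:R * t = t' by rewrite /t; field; rewrite gt_eqF.
have [M0 kM0 fin] := second_moments_finite.
have double_lt0 (a : R) : 2 * a < 0 -> a < 0 by rewrite pmulr_rlt0.
have [thX [mthX thX02 [nX1 hX1] hX2]] :
  exists th : nat -> S -> R, [/\ forall N, measurable_fun setT (th N),
    forall N x, 0 < th N x <= 2,
    exists N1 : nat, forall N, (N1 <= N)%N ->
      {ae P, forall w, (far_mean P k X (2 * al) t N (X 0%N w) <=
                        (th N (X 0%N w))%:E * EX (2 * al) N (X 0%N w))%E} &
    forall e : R, 0 < e -> exists N1 : nat, forall N, (N1 <= N)%N ->
      (\int[P]_w (th N (X 0%N w))%:E <= e%:E)%E].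
  apply: (bad_weights hd mX hX lX k0 (mX 0%N) c0 t0 regX2) => /double_lt0 a0.
    by apply: filterS (massX a0) => w; exact.
  by exists M0; [exact: kM0 | apply: filterS fin => w [h _]; exact: h].
have [thY [mthY thY02 [nY1 hY1] hY2]] :
  exists th : nat -> S -> R, [/\ forall N, measurable_fun setT (th N),
    forall N x, 0 < th N x <= 2,
    exists N1 : nat, forall N, (N1 <= N)%N ->
      {ae P, forall w, (far_mean P k Y (2 * be) t N (X 0%N w) <=
                        (th N (X 0%N w))%:E * EY (2 * be) N (X 0%N w))%E} &
    forall e : R, 0 < e -> exists N1 : nat, forall N, (N1 <= N)%N ->
      (\int[P]_w (th N (X 0%N w))%:E <= e%:E)%E].
  apply: (bad_weights hd mY hY lY k0 (mX 0%N) c'0 t0 regY2) => /double_lt0 b0.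
    by apply: filterS (massY b0) => w; exact.
  by exists M0; [exact: kM0 | apply: filterS fin => w [_ h]; exact: h].
(* The supremum bound for the coefficient [h] below: an indicator plus [dl^-1] times a sum of two
   weights, each at most 2. *)
pose M := (1 + dl^-1 * 4) / 2.
have dli0 : 0 < dl^-1 by rewrite invr_gt0.
have M0' : 0 <= M by rewrite /M divr_ge0// addr_ge0// mulr_ge0// ltW.
pose eta2 := dl * e / (32 * (K + 1)).
have eta20 : 0 < eta2 by apply: divr_gt0; apply: mulr_gt0.
have de2 : 0 <= 4 * (dl^-1 * eta2) by apply: mulr_ge0 => //; apply: mulr_ge0; exact: ltW.
have eta2K : 4 * (dl^-1 * eta2) * K <= e / 8.
  have -> : e / 8 = 4 * (dl^-1 * eta2) * (K + 1) by rewrite /eta2; field; rewrite !gt_eqF.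
  by apply: ler_wpM2l => //; rewrite lerDl.
have [nX2 hX2'] := hX2 _ eta20; have [nY2 hY2'] := hY2 _ eta20.
have [nK hK] := HK; have [nD hD] := HD u0.
have [ng hg] := good_pair_bound hd mX mY hind lX lY k0 c0 c'0 t0 u0 regX regY.
have [nr hr] := succ_ratio_le (2 * al) (@ltr01 R).
pose nM := (Num.truncn (16 * (M * k%:R * K) / e)).+1.
exists (maxn k (maxn nX1 (maxn nY1 (maxn nX2 (maxn nY2 (maxn nK (maxn nD (maxn ng (maxn nr nM))))))))).
move=> N m; rewrite !geq_max.
move=> /and5P[kN nX1N _ nX2N /and5P[_ nKN nDN ngN /andP[nrN nMN]]].
move=> /and5P[_ _ nY1m _ /and5P[nY2m nKm nDm ngm _]].
have leS n : (n <= N)%N -> (n <= N.+1)%N by move/leqW.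
(* The index is [N.+1] because the list of each of the two points contains the other one; the
   weights add up since far means far in either sample. *)
pose th x := thX N.+1 x + thY m x.
have thX0 x : 0 < thX N.+1 x by have /andP[] := thX02 N.+1 x.
have thY0 x : 0 < thY m x by have /andP[] := thY02 m x.
have th0 x : 0 < th x by exact: addr_gt0.
have th4 x : th x <= 4.
  have /andP[_ h1] := thX02 N.+1 x; have /andP[_ h2] := thY02 m x.
  by apply: (le_trans (lerD h1 h2)); rewrite -natrD.
have mth : measurable_fun setT th by exact: measurable_funD.
(* The coefficient of the square at [x] in [cross_split]; it depends on the other point through
   proximity and through its weight. *)
pose h (x y : S) : R := ((euclid_dist x y <= 2 * d%:R * t)%R%:R + dl^-1 * th y) / 2.
have hM x y : 0 <= h x y <= M.
  have dli := ltW dli0.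
  have hy : 0 <= dl^-1 * th y by apply: mulr_ge0 => //; exact: ltW.
  have hy4 : dl^-1 * th y <= dl^-1 * 4 by exact: ler_wpM2l.
  have n1 : (euclid_dist x y <= 2 * d%:R * t)%R%:R <= 1 :> R by case: (euclid_dist x y <= _)%R.
  apply/andP; split; first by apply: divr_ge0 => //; exact: addr_ge0.
  by apply: ler_wpM2r => //; exact: lerD.
have mh : measurable_fun setT (fun v : S * S => h v.1 v.2).
  apply: measurable_funM => //; apply: measurable_funD.
    apply: measurable_indicr; apply: measurable_fun_ler => //.
    exact: measurable_euclid_dist.
  apply: measurable_funM => //; exact: (measurableT_comp mth measurable_snd).
pose eta := (eta1 + dl^-1 * (eta2 + eta2)) / 2.
have eta0 : 0 <= eta.
  apply: divr_ge0 => //; apply: addr_ge0; first exact: ltW.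
  by apply: mulr_ge0; [exact: ltW | apply: addr_ge0; exact: ltW].
have heta x : (\int[P]_w (h x (X 0%N w))%:E <= eta%:E)%E.
  have mn : measurable_fun setT (fun w => (euclid_dist x (X 0%N w) <= 2 * d%:R * t)%R%:R : R).
    apply: measurable_indicr; apply: measurable_fun_ler => //.
    exact: measurable_euclid_dist.
  have mtX : measurable_fun setT (fun w => thX N.+1 (X 0%N w)).
    exact: (measurableT_comp (mthX N.+1)).
  have mtY : measurable_fun setT (fun w => thY m (X 0%N w)).
    exact: (measurableT_comp (mthY m)).
  have -> : (\int[P]_w (h x (X 0%N w))%:E = \int[P]_w (2^-1 *
      ((euclid_dist x (X 0%N w) <= 2 * d%:R * t)%R%:R +
        dl^-1 * (thX N.+1 (X 0%N w) + thY m (X 0%N w))))%:E)%E.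
    by apply: eq_integral => w _; rewrite /h mulrC.
  have th0' w : 0 <= thX N.+1 (X 0%N w) + thY m (X 0%N w) by exact: ltW (th0 _).
  have dth0 w : 0 <= dl^-1 * (thX N.+1 (X 0%N w) + thY m (X 0%N w)).
    by apply: mulr_ge0 => //; exact: ltW.
  have mth1 : measurable_fun setT (fun w => thX N.+1 (X 0%N w) + thY m (X 0%N w)).
    exact: measurable_funD.
  have mdth : measurable_fun setT (fun w => dl^-1 * (thX N.+1 (X 0%N w) + thY m (X 0%N w))).
    exact: measurable_funM.
  have mall : measurable_fun setT (fun w => (euclid_dist x (X 0%N w) <= 2 * d%:R * t)%R%:R
      + dl^-1 * (thX N.+1 (X 0%N w) + thY m (X 0%N w)) : R).
    exact: measurable_funD.
  have nn w : 0 <= (euclid_dist x (X 0%N w) <= 2 * d%:R * t)%R%:R :> R by exact: ler0n.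
  have nall w : 0 <= (euclid_dist x (X 0%N w) <= 2 * d%:R * t)%R%:R
      + dl^-1 * (thX N.+1 (X 0%N w) + thY m (X 0%N w)) by exact: addr_ge0.
  have half0 : 0 <= 2^-1 :> R by [].
  rewrite (integral_mulr P mall nall half0) (integral_addr P mn mdth nn dth0).
  rewrite (integral_mulr P mth1 th0' (ltW dli0)).
  rewrite (integral_addr P mtX mtY (fun w => ltW (thX0 _)) (fun w => ltW (thY0 _))).
  have -> : eta%:E = ((2^-1)%:E * (eta1%:E + (dl^-1)%:E * (eta2%:E + eta2%:E)) :> \bar R)%E.
    by rewrite /eta mulrC !(EFinM, EFinD).
  apply: lee_wpmul2l; first by rewrite lee_fin.
  apply: leeD.
    have -> := integral_ball mX lX x (2 * d%:R * t) 0%N.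
    by rewrite tE.
  apply: lee_wpmul2l; first by rewrite lee_fin ltW.
  by apply: leeD; [apply: hX2'; exact: leS | exact: hY2'].
pose s w := sample X (iota 2 N) w; pose s' w := sample Y (iota 0 m) w.
pose q (a b : R) i j w : R := phi a (X i w) (X j w :: s w) * phi b (X i w) (s' w).
pose bd i j w := bad (2 * al) t (X i w) (X j w :: s w) || bad (2 * be) t (X i w) (s' w).
pose f1 i j w : R := h (X i w) (X j w) * q (2 * al) (2 * be) i j w.
pose f2 i j w : R := (th (X i w))^-1 * q (2 * al) (2 * be) i j w * (bd i j w)%:R.
pose g w : R := ((2 * d%:R * t < euclid_dist (X 0%N w) (X 1%N w))%R%:R *
     (phig al t (X 0%N w) (X 1%N w :: s w) * phig al t (X 1%N w) (X 0%N w :: s w))) *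
     (phig be t (X 0%N w) (s' w) * phig be t (X 1%N w) (s' w)).
have ms : mseq s by exact: mseq_sample.
have ms' : mseq s' by exact: mseq_sample.
have msj j : mseq (fun w => X j w :: s w) by exact: mseq_cons.
have mq a b i j : measurable_fun setT (q a b i j).
  by apply: measurable_funM; exact: (mfunXS_phi k0).
have mf1 i j : measurable_fun setT (f1 i j).
  apply: measurable_funM => //.
  exact: (measurableT_comp mh (measurable_fun_pair (mX i) (mX j))).
have mthi i : measurable_fun setT (fun w => (th (X i w))^-1).
  rewrite (_ : (fun _ => _) = (fun w => th (X i w) `^ (-1))); last first.
    by apply/funext => w; rewrite powR_inv1// ltW.
  apply: (@measurableT_comp _ _ _ _ _ _ (@powR R ^~ (-1)) _ (fun w => th (X i w))).
    exact: measurable_powR.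
  exact: (measurableT_comp mth (mX i)).
have mbd i j : measurable_fun setT (bd i j).
  apply: measurable_or; apply: measurable_and => //; apply: measurable_fun_ltr => //;
    exact: (measurable_knn k0).
have mf2 i j : measurable_fun setT (f2 i j).
  by apply: measurable_funM; [exact: measurable_funM | exact: measurable_indicr].
have mgd a (x : T -> S) s0 : measurable_fun setT x -> mseq s0 ->
    measurable_fun setT (fun w => phig a t (x w) (s0 w)).
  by move=> mx m0; exact: (mfunXS_phi_good k0 a t mx m0).
have mg : measurable_fun setT g.
  apply: measurable_funM; last by apply: measurable_funM; exact: mgd.
  apply: measurable_funM; last by apply: measurable_funM; exact: mgd.
  apply: measurable_indicr; apply: measurable_fun_ltr => //.
  exact: measurable_euclid_dist.
have q0 a b i j w : 0 <= q a b i j w by apply: mulr_ge0; exact: phi_ge0.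
have f10 i j w : 0 <= f1 i j w.
  by apply: mulr_ge0; [have /andP[] := hM (X i w) (X j w) | exact: q0].
have f20 i j w : 0 <= f2 i j w.
  apply: mulr_ge0; last exact: ler0n.
  by apply: mulr_ge0; [rewrite invr_ge0 ltW | exact: q0].
have g0 w : 0 <= g w.
  apply: mulr_ge0; last by apply: mulr_ge0; exact: phig_ge0.
  by apply: mulr_ge0; [exact: ler0n | apply: mulr_ge0; exact: phig_ge0].
have dl20 : 0 <= dl / 2 by rewrite divr_ge0// ltW.
have qsqr i j w : q al be i j w ^+ 2 = q (2 * al) (2 * be) i j w.
  by rewrite /q exprMn !phi_sqr.
have split_le w : q al be 0%N 1%N w * q al be 1%N 0%N w <=
    f1 0%N 1%N w + f1 1%N 0%N w + dl / 2 * f2 0%N 1%N w + dl / 2 * f2 1%N 0%N w + g w.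
  rewrite /f1 /f2 -!qsqr /h [euclid_dist (X 1%N w) _]euclid_distC.
  apply: cross_split => //.
  rewrite -ltNge => far; rewrite /bd !bad_double !negb_or => /andP[b1 b2] /andP[b3 b4].
  rewrite /g far /knn_power_near b1 b2 b3 b4 !mulr1 mul1r /q.
  rewrite le_eqVlt; apply/orP; left; apply/eqP; ring.
have mdf2 i j : measurable_fun setT (fun w => dl / 2 * f2 i j w) by exact: measurable_funM.
have df20 i j w : 0 <= dl / 2 * f2 i j w by exact: mulr_ge0.
have m12 : measurable_fun setT (fun w => f1 0%N 1%N w + f1 1%N 0%N w) by exact: measurable_funD.
have n12 w : 0 <= f1 0%N 1%N w + f1 1%N 0%N w by exact: addr_ge0.
have m123 : measurable_fun setT (fun w => f1 0%N 1%N w + f1 1%N 0%N w + dl / 2 * f2 0%N 1%N w).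
  exact: measurable_funD.
have n123 w : 0 <= f1 0%N 1%N w + f1 1%N 0%N w + dl / 2 * f2 0%N 1%N w by exact: addr_ge0.
have m1234 : measurable_fun setT (fun w => f1 0%N 1%N w + f1 1%N 0%N w
  + dl / 2 * f2 0%N 1%N w + dl / 2 * f2 1%N 0%N w) by exact: measurable_funD.
have n1234 w : 0 <= f1 0%N 1%N w + f1 1%N 0%N w + dl / 2 * f2 0%N 1%N w + dl / 2 * f2 1%N 0%N w.
  exact: addr_ge0.
apply: (@le_trans _ _ (\int[P]_w (f1 0%N 1%N w + f1 1%N 0%N w + dl / 2 * f2 0%N 1%N w
    + dl / 2 * f2 1%N 0%N w + g w)%:E)%E).
  have mqq := measurable_funM (mq al be 0%N 1%N) (mq al be 1%N 0%N).
  have qq0 w : 0 <= q al be 0%N 1%N w * q al be 1%N 0%N w by exact: mulr_ge0.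
  exact: (integral_ler P mqq (measurable_funD m1234 mg) qq0 split_le).
rewrite (integral_addr P m1234 mg n1234 g0) (integral_addr P m123 (mdf2 1%N 0%N) n123 (df20 1%N 0%N)).
rewrite (integral_addr P m12 (mdf2 0%N 1%N) n12 (df20 0%N 1%N)).
rewrite (integral_addr P (mf1 0%N 1%N) (mf1 1%N 0%N) (f10 0%N 1%N) (f10 1%N 0%N)).
rewrite (integral_mulr P (mf2 0%N 1%N) (f20 0%N 1%N) dl20) (integral_mulr P (mf2 1%N 0%N) (f20 1%N 0%N) dl20).
have rN : succ_ratio N (2 * al) <= 2 by apply: (le_trans (hr _ nrN)).
have UK n : (nK <= n)%N -> (U (2 * al) (2 * be) n m <= K%:E)%E by move=> hn; exact: hK.
pose b1 : R := 2 * eta * K + M * k%:R / N.+1%:R * K.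
have If1 i j : i \notin j :: iota 2 N -> uniq (j :: iota 2 N) ->
    (\int[P]_w (f1 i j w)%:E <= b1%:E)%E.
  move=> ij uj.
  have Mk0 : 0 <= M * k%:R / N.+1%:R by rewrite divr_ge0// mulr_ge0.
  apply: (le_trans (weighted_first_point mX mY hind lX k0 (2 * be) m ij uj (size_iota 2 N) kN rN mh hM eta0 heta)).
  have -> : b1%:E = ((2 * eta)%:E * K%:E + (M * k%:R / N.+1%:R)%:E * K%:E :> \bar R)%E.
    by rewrite /b1 EFinD (EFinM (2 * eta)) (EFinM (M * k%:R / N.+1%:R)).
  have eta2' : (0 <= (2 * eta)%:E)%E by rewrite lee_fin; exact: mulr_ge0.
  have Mk0' : (0 <= (M * k%:R / N.+1%:R)%:E)%E by rewrite lee_fin.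
  apply: leeD; first exact: (lee_wpmul2l eta2' (UK _ nKN)).
  exact: (lee_wpmul2l Mk0' (UK _ (leS _ nKN))).
have If2 i j : i \notin j :: iota 2 N -> uniq (j :: iota 2 N) ->
    (\int[P]_w (f2 i j w)%:E <= K%:E)%E.
  move=> ij uj.
  have sz : size (j :: iota 2 N) = N.+1 by rewrite /= size_iota.
  apply: le_trans (UK N.+1 (leS _ nKN)).
  apply: (weighted_bad_point mX mY hind lX k0 ij uj sz mth th0 _ _ _ (hX1 _ (leS _ nX1N)) (hY1 _ nY1m)) => // x.
  - exact: ltW.
  - exact: ltW.
have Ig : (\int[P]_w (g w)%:E <= (D * D + e / 4)%:E)%E.
  apply: (le_trans (hg N m ngN ngm)).
  have UD := hD _ _ nDN nDm; have U0 := U_ge0 P X Y k al be N m.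
  apply: (@le_trans _ _ (((1 + u) ^+ 6)%:E * ((D + u)%:E * (D + u)%:E))%E).
    apply: lee_wpmul2l; first by rewrite lee_fin exprn_ge0// addr_ge0// ltW.
    exact: lee_pmul.
  by rewrite -!EFinM lee_fin.
have n01 : 0%N \notin 1%N :: iota 2 N by rewrite in_cons mem_iota.
have n10 : 1%N \notin 0%N :: iota 2 N by rewrite in_cons mem_iota.
have u1 : uniq (1%N :: iota 2 N) by exact: (iota_uniq 1 N.+1).
have u0' : uniq (0%N :: iota 2 N) by rewrite /= mem_iota iota_uniq.
have dl2K : (0 <= (dl / 2)%:E)%E by rewrite lee_fin.
apply: (le_trans (leeD (leeD (leeD (leeD (If1 _ _ n01 u1) (If1 _ _ n10 u0'))
   (lee_wpmul2l dl2K (If2 _ _ n01 u1))) (lee_wpmul2l dl2K (If2 _ _ n10 u0'))) Ig)).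
rewrite -!EFinM -!EFinD lee_fin.
have MN : 2 * (M * k%:R / N.+1%:R * K) <= e / 8.
  have -> : 2 * (M * k%:R / N.+1%:R * K) = 2 * (M * k%:R * K) / N.+1%:R by field; rewrite nat1r pnatr_eq0.
  rewrite ler_pdivrMr ?ltr0n//.
  have h1 : 16 * (M * k%:R * K) / e <= N.+1%:R.
    by apply: ltW; apply: lt_le_trans (truncnS_gt _) _; rewrite ler_nat; exact: leS.
  rewrite ler_pdivrMr// in h1.
  have -> : e / 8 * N.+1%:R = N.+1%:R * e / 8 by rewrite mulrC mulrA.
  lra.
have etaK : 2 * (2 * eta * K) = 2 * eta1 * K + 4 * (dl^-1 * eta2) * K.
  by rewrite /eta; field; rewrite gt_eqF.
have dlE : dl / 2 * K + dl / 2 * K = dl * K by field.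
rewrite -[b1 + b1 + _ + _]addrA dlE /b1.
move: (M * k%:R / N.+1%:R * K) (2 * eta * K) (2 * eta1 * K) (4 * (dl^-1 * eta2) * K) (dl * K)
  (D * D) MN etaK eta1K eta2K dlK e0 => x1 x2 x3 x4 x5 x6 *; lra.
Qed.

End CrossMoment.

(** * Positivity of the normalizing constant *)

Section GammaPositive.
Context {R : realType}.

Lemma powR_le_expR (a t : R) : 0 < a -> 0 < t -> t `^ a <= (2 * a) `^ a * expR (t / 2).
Proof.
move=> a0 t0; have a20 : 0 < 2 * a by exact: mulr_gt0.
have h : t <= 2 * a * expR (t / (2 * a)).
  rewrite mulrC -ler_pdivrMr//; apply: le_trans (expR_ge1Dx _).
  by rewrite lerDr.
have -> : expR (t / 2) = expR (t / (2 * a)) `^ a.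
  rewrite -expRM; congr expR; field; rewrite gt_eqF//.
rewrite -powRM ?expR_ge0 ?(ltW a20)//.
apply: ge0_ler_powR; rewrite ?nnegrE; [exact: ltW | exact: ltW | | exact: h].
by apply: mulr_ge0; [exact: ltW | exact: expR_ge0].
Qed.

(** [Gamma] is a [fine] value and would be 0 if the integral diverged, so finiteness is needed as
    well: the integrand is dominated by a multiple of the exponential density of rate 1/2. On
    [[1, 2]] it is at least [exp (- 2)]. *)
Lemma Gamma_gt0 (s : R) : 1 < s -> 0 < Gamma s.
Proof.
move=> s1; pose a := s - 1; have a0 : 0 < a by rewrite subr_gt0.
have half0 : 0 < 2^-1 :> R by [].
pose D := [set t : R | (0 < t)%R].
have mD : measurable D.
  by rewrite (_ : D = `]0, +oo[%classic)//; apply/seteqP; split => t /=; rewrite in_itv/= andbT.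
pose f (t : R) : R := t `^ a * expR (- t).
have mf : measurable_fun setT f.
  apply: measurable_funM; first exact: measurable_powR.
  exact: (measurableT_comp (@measurable_expR R) (@oppr_measurable R setT)).
have f0 t : 0 <= f t by apply: mulr_ge0; [exact: powR_ge0 | exact: expR_ge0].
have mfD (E : set R) : measurable_fun E (fun t => (f t)%:E).
  by apply/measurable_funTS/measurable_EFinP.
pose C := 2 * (2 * a) `^ a.
have C0 : 0 <= C by apply: mulr_ge0 => //; exact: powR_ge0.
pose g := exponential_pdf (2^-1 : R).
have g0 t : 0 <= g t by apply: exponential_pdf_ge0.
have mg : measurable_fun setT g by exact: measurable_exponential_pdf.
have mCg (E : set R) : measurable_fun E (fun t => C%:E * (g t)%:E)%E.
  have mC : measurable_fun E (fun t => C * g t) by apply: measurable_funTS; exact: measurable_funM.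
  exact/measurable_EFinP.
have Ifin : (\int[lebesgue_measure]_(t in D) (f t)%:E < +oo)%E.
  apply: (@le_lt_trans _ _ (\int[lebesgue_measure]_(t in D) (C%:E * (g t)%:E))%E).
    apply: ge0_le_integral => //.
    - by move=> t _; rewrite lee_fin.
    - exact: mfD.
    - exact: mCg.
    - move=> t Dt; rewrite -EFinM lee_fin /g exponential_pdfE ?(ltW Dt)//.
      apply: (@le_trans _ _ ((2 * a) `^ a * expR (t / 2) * expR (- t))).
        by rewrite ler_wpM2r ?expR_ge0// powR_le_expR.
      rewrite -mulrA -expRD /C le_eqVlt; apply/orP; left; apply/eqP.
      have -> : t / 2 - t = - 2^-1 * t by field.
      by field.
  apply: (@le_lt_trans _ _ (\int[lebesgue_measure]_t (C%:E * (g t)%:E))%E).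
    apply: ge0_subset_integral => //.
    - exact: mCg.
    - by move=> t _; rewrite mule_ge0// lee_fin.
  rewrite ge0_integralZl//.
  - by rewrite integral_exponential_pdf// mule1 ltry.
  - exact/measurable_EFinP.
  - by move=> t _; rewrite lee_fin.
have Ipos : ((expR (- 2 : R))%:E <= \int[lebesgue_measure]_(t in D) (f t)%:E)%E.
  apply: (@le_trans _ _ (\int[lebesgue_measure]_(t in `[1%R, 2%R]%classic) (f t)%:E)%E).
    apply: (@le_trans _ _ (\int[lebesgue_measure]_(t in `[1%R, 2%R]%classic) (cst (expR (- 2 : R))%:E t))%E).
      rewrite integral_cst//= lebesgue_measure_itv/= lte_fin ltr1n/=.
      by rewrite -EFinD -EFinM lee_fin (_ : 2 - 1 = 1 :> R) ?mulr1//; ring.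
    apply: ge0_le_integral => //.
    - by move=> t _; rewrite lee_fin expR_ge0.
    - exact: mfD.
    - move=> t /=; rewrite in_itv/= => /andP[t1 t2]; rewrite lee_fin.
      rewrite -[leLHS]mul1r; apply: ler_pM; rewrite ?expR_ge0//.
        by rewrite -[leLHS](powRr0 t); apply: ler_powR => //; exact: ltW.
      by rewrite ler_expR lerN2.
  apply: ge0_subset_integral => //.
  - exact: mfD.
  - by move=> t _; rewrite lee_fin.
  - by move=> t /=; rewrite in_itv/= => /andP[t1 _]; exact: lt_le_trans t1.
have I0 : (0 <= \int[lebesgue_measure]_(t in D) (f t)%:E)%E.
  by apply: integral_ge0 => t _; rewrite lee_fin.
rewrite /Gamma -/D; apply: (lt_le_trans (expR_gt0 (- 2 : R))).
rewrite -lee_fin fineK//.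
by rewrite ge0_fin_numE.
Qed.

(** The bounds put the arguments of [Gamma] above 1. For the doubled exponents they amount to
    [alpha] and [beta] lying below [(k - 1) / 2]. *)
Lemma Bconst_gt0 (d k : nat) (lam : {measure set (d.-tuple R) -> \bar R}) (a b : R) :
  (0 < d)%N -> is_lebesgue lam -> (1 < k)%N -> a < k%:R - 1 -> b < k%:R - 1 ->
  0 < Bconst k lam a b.
Proof.
move=> hd hlam k1 ak bk; apply: mulr_gt0; first by apply: powR_gt0; exact: cbar_gt0.
apply: divr_gt0; first by apply: exprn_gt0; apply: Gamma_gt0; rewrite ltr1n.
by apply: mulr_gt0; apply: Gamma_gt0; rewrite ltrBrDr addrC -ltrBrDr.
Qed.

End GammaPositive.

Lemma sume_const {R : realType} (n : nat) (x : \bar R) : (\sum_(i < n) x = n%:R%:E * x)%E.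
Proof. by rewrite mule_natl sumr_const card_ord. Qed.

(** * First and second moments of the estimator *)

Section EstimatorMoments.
Context {R : realType} {dT} {T : measurableType dT} (P : probability T R).
Context {d : nat}.
Local Notation S := (d.-tuple R).
Variables X Y : nat -> T -> S.
Hypothesis mX : forall i, measurable_fun setT (X i).
Hypothesis mY : forall i, measurable_fun setT (Y i).
Hypothesis hind : mutually_independent P
  (fun z : nat + nat => match z with inl i => X i | inr j => Y j end).
Hypothesis lX : forall i A, measurable A -> P (X i @^-1` A) = P (X 0%N @^-1` A).
Hypothesis lY : forall i A, measurable A -> P (Y i @^-1` A) = P (Y 0%N @^-1` A).
Variable k : nat.
Hypothesis k0 : (0 < k)%N.
Local Notation phi := (knn_power k).
Local Notation U := (joint_moment P X Y k).
Local Notation cross := (cross_moment P X Y k).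

Let hX := mutually_independent_inl hind.

(** Conditioning and exchangeability bring every pair of indices to the same double integral, so the
    pair 0, 1 represents all. *)
Lemma pair_expectation a b i j l m : i != j -> i \notin l -> j \notin l -> uniq l ->
  (\int[P]_w ((phi a (X i w) (X j w :: sample X l w) * phi b (X i w) (sample Y (iota 0 m) w)) *
              (phi a (X j w) (X i w :: sample X l w) * phi b (X j w) (sample Y (iota 0 m) w)))%:E
   = cross a b (size l) m)%E.
Proof.
move=> ij il jl ul.
pose F (x y : S) s : R := phi a x (y :: s) * phi a y (x :: s).
pose G (x y : S) s : R := phi b x s * phi b y s.
have mF : mfunXXS F.
  by move=> dU W x y s mx my ms; apply: measurable_funM;
    apply: (mfunXS_phi k0) => //; exact: mseq_cons.
have mG : mfunXXS G.
  by move=> dU W x y s mx my ms; apply: measurable_funM; exact: (mfunXS_phi k0).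
have F0 x y s : 0 <= F x y s by apply: mulr_ge0; exact: phi_ge0.
have G0 x y s : 0 <= G x y s by apply: mulr_ge0; exact: phi_ge0.
have E i' j' l' : i' != j' -> i' \notin l' -> j' \notin l' -> uniq l' -> size l' = size l ->
  (\int[P]_w ((phi a (X i' w) (X j' w :: sample X l' w) * phi b (X i' w) (sample Y (iota 0 m) w)) *
    (phi a (X j' w) (X i' w :: sample X l' w) * phi b (X j' w) (sample Y (iota 0 m) w)))%:E =
   \int[P]_w1 \int[P]_w2 (Ev P X l (F (X 0%N w1) (X 0%N w2))
                          * Ev P Y (iota 0 m) (G (X 0%N w1) (X 0%N w2))))%E.
  move=> ij' il' jl' ul' sl'.
  transitivity (\int[P]_w (F (X i' w) (X j' w) (sample X l' w) *
      G (X i' w) (X j' w) (sample Y (iota 0 m) w))%:E)%E.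
    by apply: eq_integral => w _; rewrite mulrACA.
  rewrite (Ev_pair_XY mX mY hind lX (iota 0 m) ij' il' jl' mF mG F0 G0).
  have mFxy x y : mfunS (F x y).
    by move=> dU W s ms; exact: (mF _ _ _ _ _ (measurable_cst x) (measurable_cst y) ms).
  apply: eq_integral => w1 _; apply: eq_integral => w2 _.
  by rewrite (Ev_exch mX hX lX ul' ul sl' (mFxy _ _) (F0 _ _)).
rewrite /cross_moment (E _ _ _ ij il jl ul (erefl _)) E//.
- by rewrite mem_iota.
- by rewrite mem_iota.
- exact: iota_uniq.
- by rewrite size_iota.
Qed.

Let others n i := [seq j <- iota 0 n | j != i].

Let others_size n i : (i < n)%N -> size (others n i) = n.-1.
Proof.
move=> ilt; rewrite size_filter -[in RHS](size_iota 0 n) -(count_predC (pred1 i) (iota 0 n)).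
by rewrite (count_uniq_mem _ (iota_uniq 0 n)) mem_iota ilt add1n.
Qed.

Let zeta a b n m (i : nat) w : R :=
  phi a (X i w) (sample X (others n i) w) * phi b (X i w) (sample Y (iota 0 m) w).

Let zeta_ge0 a b n m i w : 0 <= zeta a b n m i w.
Proof. by apply: mulr_ge0; exact: phi_ge0. Qed.

Let measurable_zeta a b n m i : measurable_fun setT (zeta a b n m i).
Proof.
by apply: measurable_funM; apply: (mfunXS_phi k0) => //; exact: mseq_sample.
Qed.

Let integral_zeta a b n m i : (i < n)%N -> (\int[P]_w (zeta a b n m i w)%:E = U a b n.-1 m)%E.
Proof.
move=> ilt.
have il : i \notin others n i by rewrite mem_filter eqxx.
have ul : uniq (others n i) by rewrite filter_uniq// iota_uniq.
have := one_point_expectation mX mY hind lX lY k0 a b il ul (iota_uniq 0 m).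
by rewrite (others_size ilt) size_iota.
Qed.

Let integral_zeta_sqr a b n m i : (i < n)%N ->
  (\int[P]_w (zeta a b n m i w * zeta a b n m i w)%:E = U (2 * a) (2 * b) n.-1 m)%E.
Proof.
move=> ilt; rewrite -(integral_zeta (2 * a) (2 * b) m ilt); apply: eq_integral => w _.
by rewrite -expr2 /zeta exprMn !phi_sqr.
Qed.

Let integral_zeta_pair a b n m i j : (i < n)%N -> (j < n)%N -> i != j ->
  (\int[P]_w (zeta a b n m i w * zeta a b n m j w)%:E = cross a b n.-2 m)%E.
Proof.
move=> ilt jlt ij; pose l := [seq x <- others n i | x != j].
have mem_oth n' i' x : (x \in others n' i') = (x != i') && (x < n')%N.
  by rewrite mem_filter mem_iota.
have uo n' i' : uniq (others n' i') by rewrite filter_uniq// iota_uniq.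
have ul : uniq l by rewrite filter_uniq.
have il : i \notin l by rewrite mem_filter mem_oth eqxx andbF.
have jl : j \notin l by rewrite mem_filter eqxx.
have pi : perm_eq (others n i) (j :: l).
  apply: uniq_perm => //=; first by rewrite jl.
  move=> x; rewrite mem_oth in_cons mem_filter mem_oth.
  by case: (eqVneq x j) => [->|]//=; rewrite eq_sym ij jlt.
have pj : perm_eq (others n j) (i :: l).
  apply: uniq_perm => //=; first by rewrite il.
  move=> x; rewrite mem_oth in_cons mem_filter mem_oth.
  by case: (eqVneq x i) => [->|]//=; rewrite ij ilt.
have sl : size l = n.-2 by have := perm_size pi; rewrite (others_size ilt) /= => ->.
rewrite -sl -(pair_expectation a b m ij il jl ul); apply: eq_integral => w _.
rewrite /zeta (phi_perm k a (X i w) (perm_map (X^~ w) pi)).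
by rewrite (phi_perm k a (X j w) (perm_map (X^~ w) pj)).
Qed.

Variable lam : {measure set S -> \bar R}.
Local Notation Dhat' a b n m w := (Dhat k lam a b n m (fun i => X i w) (fun j => Y j w)).

Let DhatE a b n m w : Dhat' a b n m w =
  Bconst k lam a b / n%:R * \sum_(i < n) zeta a b n m i w.
Proof.
rewrite /Dhat !mulr_sumr; apply: eq_bigr => i _.
rewrite /zeta /knn_power !size_map size_iota others_size// subn1 !powRN.
by rewrite /rho /nu !invfM; ring.
Qed.

Let measurable_sum_zeta a b n m : measurable_fun setT (fun w => \sum_(i < n) zeta a b n m i w).
Proof. by apply: measurable_sum => i; exact: measurable_zeta. Qed.

Lemma measurable_Dhat a b n m : measurable_fun setT (fun w => Dhat' a b n m w).
Proof.
rewrite (_ : (fun _ => _) = fun w => Bconst k lam a b / n%:R * \sum_(i < n) zeta a b n m i w).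
  exact: measurable_funM.
by apply/funext => w; rewrite DhatE.
Qed.

Lemma Dhat_ge0 a b n m w : 0 <= Bconst k lam a b -> 0 <= Dhat' a b n m w.
Proof.
by move=> B0; rewrite DhatE mulr_ge0 ?divr_ge0// sumr_ge0// => i _; exact: zeta_ge0.
Qed.

Lemma Dhat_mean a b n m : 0 <= Bconst k lam a b -> (0 < n)%N ->
  (\int[P]_w (Dhat' a b n m w)%:E = (Bconst k lam a b)%:E * U a b n.-1 m)%E.
Proof.
move=> B0 n0; under eq_integral do rewrite DhatE.
rewrite integral_mulr ?divr_ge0//; last by move=> w; apply: sumr_ge0 => i _; exact: zeta_ge0.
under eq_integral do rewrite -sumEFin.
rewrite ge0_integral_sum//; first last.
- by move=> i w _; rewrite lee_fin; exact: zeta_ge0.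
- by move=> i; apply/measurable_EFinP; exact: measurable_zeta.
rewrite (eq_bigr (fun _ => U a b n.-1 m)) => [|i _]; last exact: integral_zeta.
rewrite sume_const.
by rewrite muleA -EFinM divfK// pnatr_eq0 -lt0n.
Qed.

Lemma Dhat_second_moment a b n m (K c : R) : 0 <= Bconst k lam a b -> (0 < n)%N ->
  0 <= K -> 0 <= c -> (U (2 * a) (2 * b) n.-1 m <= K%:E)%E -> (cross a b n.-2 m <= c%:E)%E ->
  (\int[P]_w ((Dhat' a b n m w) ^+ 2)%:E <= (Bconst k lam a b ^+ 2 * (K / n%:R + c))%:E)%E.
Proof.
move=> B0 n0 K0 c0 UK Cc; set B := Bconst k lam a b in B0 *.
have nn : n%:R != 0 :> R by rewrite pnatr_eq0 -lt0n.
pose z (i : 'I_n) (j : 'I_n) w := zeta a b n m i w * zeta a b n m j w.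
have z0 i j w : 0 <= z i j w by apply: mulr_ge0; exact: zeta_ge0.
have mz i j : measurable_fun setT (z i j) by apply: measurable_funM; exact: measurable_zeta.
have s0 i w : 0 <= \sum_(j < n) z i j w by apply: sumr_ge0.
have ms i : measurable_fun setT (fun w => \sum_(j < n) z i j w) by exact: measurable_sum.
have -> : (\int[P]_w ((Dhat' a b n m w) ^+ 2)%:E =
    \int[P]_w ((B / n%:R) ^+ 2 * \sum_(i < n) \sum_(j < n) z i j w)%:E)%E.
  apply: eq_integral => w _; rewrite DhatE exprMn [(\sum_i _) ^+ 2]expr2 mulr_suml.
  by congr (_ * _)%:E; apply: eq_bigr => i _; rewrite mulr_sumr.
rewrite integral_mulr ?sqr_ge0//; last 2 first.
- exact: measurable_sum.
- by move=> w; apply: sumr_ge0.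
(* Diagonal terms are allowed [K + c] instead of [K], so that [c] occurs for all [n^2] pairs and the
   sum is exact. *)
have -> : B ^+ 2 * (K / n%:R + c) = (B / n%:R) ^+ 2 * \sum_(i < n) \sum_(j < n) ((i == j)%:R * K + c).
  rewrite (eq_bigr (fun _ => K + n%:R * c)) => [|i _]; last first.
    rewrite big_split/= sumr_const card_ord mulr_natl; congr (_ + _).
    rewrite (bigD1 i)//= eqxx mul1r big1 ?addr0// => j ji.
    by rewrite eq_sym (negbTE ji) mul0r.
  by rewrite sumr_const card_ord -mulr_natl; field.
rewrite (EFinM ((B / n%:R) ^+ 2)); apply: lee_wpmul2l; first by rewrite lee_fin sqr_ge0.
under eq_integral do rewrite -sumEFin.
rewrite ge0_integral_sum//; first last.
- by move=> i w _; rewrite lee_fin.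
- by move=> i; exact/measurable_EFinP.
rewrite -sumEFin; apply: lee_sum => i _.
under eq_integral do rewrite -sumEFin.
rewrite ge0_integral_sum//; first last.
- by move=> j w _; rewrite lee_fin.
- by move=> j; exact/measurable_EFinP.
rewrite -sumEFin; apply: lee_sum => j _.
have [<-|ij] := eqVneq i j.
  rewrite mul1r /z integral_zeta_sqr//; apply: (le_trans UK).
  by rewrite lee_fin lerDl.
by rewrite mul0r add0r /z integral_zeta_pair.
Qed.

End EstimatorMoments.

(** * From the hypotheses on the densities to the L2 limit *)

Lemma regular_density {R : realType} {dT} {T : measurableType dT} (P : probability T R)
    {d : nat} (lam : {measure set (d.-tuple R) -> \bar R}) (p v : d.-tuple R -> R)
    (V : nat -> T -> d.-tuple R) (a : R) :
  (0 < d)%N -> is_lebesgue lam -> is_density lam v -> has_density P lam (V 0%N) v ->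
  (exists r : R, 0 < r /\ forall (delta : R) (x : d.-tuple R), 0 < delta < 1 -> supp p x ->
      (r%:E * lam (eball x delta) <= lam (eball x delta `&` supp p))%E) ->
  (0 < a -> exists c : R, 0 < c /\ forall x, supp p x -> c <= v x) ->
  (a < 0 -> exists C : R, forall x, v x <= C) ->
  exists2 c : R, 0 < c & forall x, supp p x -> regular P V a c x.
Proof.
move=> hd hlam hv hV [r [r0 hr]] hpos hneg.
have atom x : no_atom P V x by exact: (prob_eball0 hd hlam hv hV).
have dR : 0 < d%:R :> R by rewrite ltr0n.
have [a0|a0|a0] := ltgtP a 0.
- have [C hC] := hneg a0.
  have v0 x : 0 <= v x := hv.2.1 x.
  have C0 : 0 <= C by apply: le_trans (hC [tuple of nseq d 0]).
  (* [C + 1] is positive as soon as [C >= 0]; the factor [2^d] is the volume of the cube around the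
     unit ball. *)
  exists ((C + 1) * 2 ^+ d); first by apply: mulr_gt0; [exact: ltr_wpDl | exact: exprn_gt0].
  move=> x _; split => // [|_]; first by rewrite ltNge (ltW a0).
  move=> s s0; apply: (le_trans (prob_eball_le hlam hv hV x hC s0)).
  rewrite lee_fin exprMn mulrA ler_wpM2r ?exprn_ge0// ler_wpM2r ?exprn_ge0//.
  by rewrite lerDl.
- have [c [c0 hc]] := hpos a0.
  exists (c * r * (2 / d%:R) ^+ d).
    by apply: mulr_gt0; [exact: mulr_gt0 | apply: exprn_gt0; exact: divr_gt0].
  move=> x sx; split => // [_|]; last by rewrite ltNge (ltW a0).
  move=> s s01; have s0 : 0 <= s by case/andP: s01 => /ltW.
  have := prob_eball_ge hlam hv hV (measurable_eclosure _) hc (ltW c0) s0 (ltW r0) (hr s x s01 sx).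
  rewrite (_ : 2 * (s / d%:R) = 2 / d%:R * s); last by rewrite mulrCA mulrC -mulrA mulrC.
  by rewrite exprMn mulrA.
- by exists 1 => // x _; split; rewrite ?a0 ?ltxx.
Qed.

(* (f - D)^2 + 2 D f = f^2 + D^2 has nonnegative terms only, so no integrability
   of f is needed. *)
Lemma second_moment_about {R : realType} {dT} {T : measurableType dT} (P : probability T R)
    (f : T -> R) (D e q : R) : measurable_fun setT f -> (forall w, 0 <= f w) -> 0 <= D ->
  ((D - e)%:E <= \int[P]_w (f w)%:E)%E -> (\int[P]_w (f w ^+ 2)%:E <= q%:E)%E ->
  (\int[P]_w ((f w - D) ^+ 2)%:E <= (q - D * D + 2 * D * e)%:E)%E.
Proof.
move=> mf f0 D0 hf hq.
have D20 : 0 <= 2 * D by exact: mulr_ge0.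
have m1 : measurable_fun setT (fun w => (f w - D) ^+ 2).
  by apply: measurable_funX; exact: measurable_funB.
have m2 : measurable_fun setT (fun w => 2 * D * f w) by exact: measurable_funM.
have m3 : measurable_fun setT (fun w => f w ^+ 2) by exact: measurable_funX.
have E : (\int[P]_w ((f w - D) ^+ 2)%:E + (2 * D)%:E * \int[P]_w (f w)%:E =
          \int[P]_w (f w ^+ 2)%:E + (D * D)%:E)%E.
  rewrite -(integral_mulr P mf f0 D20) -(integral_cstr P (D * D)).
  rewrite -(integral_addr P m1 m2 (fun w => sqr_ge0 _) (fun w => mulr_ge0 D20 (f0 w))).
  rewrite -(integral_addr P m3 (measurable_cst _) (fun w => sqr_ge0 _) (fun w => mulr_ge0 D0 D0)).
  by apply: eq_integral => w _; rewrite /=; congr EFin; ring.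
have h1 : ((2 * D)%:E * (D - e)%:E <= (2 * D)%:E * \int[P]_w (f w)%:E)%E.
  by apply: lee_wpmul2l => //; rewrite lee_fin.
have h2 : (\int[P]_w ((f w - D) ^+ 2)%:E + (2 * D)%:E * (D - e)%:E <= q%:E + (D * D)%:E)%E.
  by apply: (@le_trans _ _ (\int[P]_w ((f w - D) ^+ 2)%:E + (2 * D)%:E * \int[P]_w (f w)%:E)%E);
    [exact: leeD2l | rewrite E; exact: leeD2r].
have -> : q - D * D + 2 * D * e = q + D * D - 2 * D * (D - e) by ring.
rewrite EFinB leeBrDr// EFinD (EFinM (2 * D)); exact: h2.
Qed.
Theorem theorem3 (R : realType) (d k : nat) (hd : (1 <= d)%N) (hk : (2 <= k)%N)
  (lam : {measure set (d.-tuple R) -> \bar R}) (hlam : is_lebesgue lam)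
  (p q : d.-tuple R -> R) (hp : is_density lam p) (hq : is_density lam q)
  (hint : lam (supp p `\` einterior (supp p)) = 0%E)
  (hrM : exists r : R, 0 < r /\ forall (delta : R) (x : d.-tuple R),
      0 < delta < 1 -> supp p x ->
      (r%:E * lam (eball x delta) <= lam (eball x delta `&` supp p))%E)
  (alpha beta : R)
  (ha : - ((k%:R - 1) / 2) < alpha < (k%:R - 1) / 2)
  (hb : - ((k%:R - 1) / 2) < beta < (k%:R - 1) / 2)
  (hpa : 0 < alpha ->
     (exists c : R, 0 < c /\ forall x, supp p x -> c <= p x) /\
     (forall e : R, 0 < e -> exists del : R, 0 < del /\
        forall x y, supp p x -> supp p y -> euclid_dist x y < del -> `|p x - p y| < e))
  (hpa' : alpha < 0 -> exists C : R, forall x, p x <= C)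
  (hqb : 0 < beta ->
     (exists c : R, 0 < c /\ forall x, supp p x -> c <= q x) /\
     (forall e : R, 0 < e -> exists del : R, 0 < del /\
        forall x y, supp p x -> supp p y -> euclid_dist x y < del -> `|q x - q y| < e))
  (hqb' : beta < 0 -> exists C : R, forall x, q x <= C)
  (hD1 : (Dab lam alpha beta p q < +oo)%E)
  (hD2 : (Dab lam (2 * alpha) (2 * beta) p q < +oo)%E)
  (dT : measure_display) (T : measurableType dT) (P : probability T R)
  (X Y : nat -> T -> d.-tuple R)
  (hX : forall i, has_density P lam (X i) p)
  (hY : forall j, has_density P lam (Y j) q)
  (hind : mutually_independent P
            (fun z : nat + nat => match z with inl i => X i | inr j => Y j end))
  (hunb1 : lim2E (fun n m => 'E_P[fun w => Dhat k lam alpha beta n m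
                                      (fun i => X i w) (fun j => Y j w)]%E)
                 (fine (Dab lam alpha beta p q)))
  (hunb2 : lim2E (fun n m => 'E_P[fun w => Dhat k lam (2 * alpha) (2 * beta) n m
                                      (fun i => X i w) (fun j => Y j w)]%E)
                 (fine (Dab lam (2 * alpha) (2 * beta) p q))) :
  lim2E (fun n m => 'E_P[fun w => ((Dhat k lam alpha beta n m
                                      (fun i => X i w) (fun j => Y j w)
                                   - fine (Dab lam alpha beta p q)) ^+ 2)%R]%E) 0.
Proof.
have k0 : (0 < k)%N by exact: ltnW.
have k2 : 2 <= k%:R :> R by rewrite ler_nat.
have mX i : measurable_fun setT (X i) := (hX i).1.
have mY i : measurable_fun setT (Y i) := (hY i).1.
have lX i A : measurable A -> P (X i @^-1` A) = P (X 0%N @^-1` A).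
  by move=> mA; rewrite (hX i).2// (hX 0%N).2.
have lY i A : measurable A -> P (Y i @^-1` A) = P (Y 0%N @^-1` A).
  by move=> mA; rewrite (hY i).2// (hY 0%N).2.
have D10 : 0 <= fine (Dab lam alpha beta p q) by apply: fine_ge0; exact: (Dab_ge0 q hp).
have D20 : 0 <= fine (Dab lam (2 * alpha) (2 * beta) p q).
  by apply: fine_ge0; exact: (Dab_ge0 q hp).
move: (fine (Dab lam alpha beta p q)) D10 hunb1 => D1 D10 hunb1.
move: (fine (Dab lam (2 * alpha) (2 * beta) p q)) D20 hunb2 => D2 D20 hunb2.
have Bc1 : 0 < Bconst k lam alpha beta by apply: Bconst_gt0 => //; lra.
have Bc2 : 0 < Bconst k lam (2 * alpha) (2 * beta) by apply: Bconst_gt0 => //; lra.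
have [B1 B1E] : exists B, B = Bconst k lam alpha beta by exists (Bconst k lam alpha beta).
have [B2 B2E] : exists B, B = Bconst k lam (2 * alpha) (2 * beta).
  by exists (Bconst k lam (2 * alpha) (2 * beta)).
have B10 : 0 < B1 by rewrite B1E.
have B20 : 0 < B2 by rewrite B2E.
have aesupp : {ae P, forall w, supp p (X 0%N w)}.
  by apply: filterS (ae_density_gt0 hp (hX 0%N)) => w; exact: supp_gt0.
have [c c0 hc] : exists2 c : R, 0 < c & forall x, supp p x -> regular P X alpha c x.
  by apply: (regular_density hd hlam hp (hX 0%N) hrM _ hpa') => a0; case: (hpa a0).
have [c' c'0 hc'] : exists2 c : R, 0 < c & forall x, supp p x -> regular P Y beta c x.
  by apply: (regular_density hd hlam hq (hY 0%N) hrM _ hqb') => b0; case: (hqb b0).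
have regX : {ae P, forall w, regular P X alpha c (X 0%N w)}.
  by apply: filterS aesupp => w; exact: hc.
have regY : {ae P, forall w, regular P Y beta c' (X 0%N w)}.
  by apply: filterS aesupp => w; exact: hc'.
have massX : alpha < 0 ->
    {ae P, forall w, forall t : R, 0 < t -> (0 < P (X 0%N @^-1` eball (X 0%N w) t))%E}.
  move=> _; apply: (ae_ball_mass_gt0 hp hp (hX 0%N) (hX 0%N)).
  rewrite (_ : _ `&` _ = set0) ?measure0//; apply/seteqP; split => // x [/= px0 px].
  by move: px0; rewrite px ltxx.
have massY : beta < 0 ->
    {ae P, forall w, forall t : R, 0 < t -> (0 < P (Y 0%N @^-1` eball (X 0%N w) t))%E}.
  by move=> b0; apply: (ae_ball_mass_gt0 hp hq (hX 0%N) (hY 0%N)); exact: (Dab_fin_null hp hq b0 hD1).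
have small := prob_eball_uniformly_small hd hlam hp (hX 0%N).
(* Unbiasedness for the doubled exponents, with tolerance 1, bounds the mean square of one
   summand. *)
pose K := (D2 + 1) / B2.
have K0 : 0 <= K := divr_ge0 (addr_ge0 D20 ler01) (ltW B20).
pose D := D1 / B1.
have D0 : 0 <= D := divr_ge0 D10 (ltW B10).
have HK : exists N0 : nat, forall n m, (N0 <= n)%N -> (N0 <= m)%N ->
    (joint_moment P X Y k (2 * alpha) (2 * beta) n m <= K%:E)%E.
  have [N hN] := hunb2 1 ltr01; exists N => n m Nn Nm.
  (* A point with [n] companions belongs to a sample of size [n.+1]. *)
  have /andP[_] := hN n.+1 m (leqW Nn) Nm; rewrite unlock.
  rewrite (Dhat_mean mX mY hind lX lY k0 m (ltW Bc2) (ltn0Sn n)) -B2E => /ltW h.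
  by rewrite /K EFinM (lee_pdivlMr _ _ B20) muleC.
have HD (e : R) : 0 < e -> exists N0 : nat, forall n m, (N0 <= n)%N -> (N0 <= m)%N ->
    (joint_moment P X Y k alpha beta n m <= (D + e)%:E)%E.
  move=> e0; have [N hN] := hunb1 _ (mulr_gt0 B10 e0); exists N => n m Nn Nm.
  have /andP[_] := hN n.+1 m (leqW Nn) Nm; rewrite unlock.
  rewrite (Dhat_mean mX mY hind lX lY k0 m (ltW Bc1) (ltn0Sn n)) -B1E => /ltW h.
  have BN0 : B1 != 0 := lt0r_neq0 B10.
  have -> : D + e = (D1 + B1 * e) / B1 by rewrite /D mulrDl mulrAC (divff BN0) mul1r.
  by rewrite EFinM (lee_pdivlMr _ _ B10) muleC.
move=> e e0.
have BB0 : 0 < B1 ^+ 2 by exact: exprn_gt0.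
have e40 : 0 < e / 4 by exact: divr_gt0.
have [N1 h1] := cross_le hd mX mY hind lX lY k0 c0 c'0 regX regY massX massY small K0 D0 HK HD
  (divr_gt0 e40 BB0).
(* The bias enters with factor [2 * D1], so this denominator keeps it below [e / 4]; the [+ 1]
   covers [D1 = 0]. *)
have D21 : 0 < 4 * (2 * D1 + 1) by apply: mulr_gt0 => //; apply: ltr_wpDl => //; exact: mulr_ge0.
have [N3 h3] := hunb1 _ (divr_gt0 e0 D21).
have [NK hK] := HK.
pose N2 := (Num.truncn (B1 ^+ 2 * K / (e / 4))).+1.
(* The shift by 2 is there because the cross moment is taken at [n - 2]. *)
exists (maxn N1.+2 (maxn N2.+2 (maxn N3.+2 NK.+2))) => n m.
rewrite !geq_max => /and4P[N1n N2n N3n NKn] /and4P[/ltnW/ltnW N1m _ /ltnW/ltnW N3m /ltnW/ltnW NKm].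
have n0 : (0 < n)%N by exact: leq_trans N1n.
pose Z w := Dhat k lam alpha beta n m (fun i => X i w) (fun j => Y j w).
have mZ : measurable_fun setT Z by exact: (measurable_Dhat mX mY k0).
have Z0 w : 0 <= Z w by apply: Dhat_ge0; exact: (ltW Bc1).
have EZ : ((D1 - e / (4 * (2 * D1 + 1)))%:E <= \int[P]_w (Z w)%:E)%E.
  by have /andP[/ltW + _] := h3 n m (ltnW (ltnW N3n)) N3m; rewrite unlock.
have U2K : (joint_moment P X Y k (2 * alpha) (2 * beta) n.-1 m <= K%:E)%E.
  by apply: hK => //; rewrite -ltnS prednK// ltnW.
have Cle : (cross_moment P X Y k alpha beta n.-2 m <= (D * D + e / 4 / B1 ^+ 2)%:E)%E.
  by apply: h1 => //; rewrite -2!ltnS; move: N1n; case: (n) => [|[]].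
have C0 : 0 <= D * D + e / 4 / B1 ^+ 2.
  by apply: addr_ge0; [exact: mulr_ge0 | apply: divr_ge0; exact: ltW].
have := Dhat_second_moment mX mY hind lX lY k0 (ltW Bc1) n0 K0 C0 U2K Cle.
rewrite -B1E => /(second_moment_about mZ Z0 D10 EZ) hfin.
rewrite sub0r add0r unlock; apply/andP; split.
  by apply: (@lt_le_trans _ _ 0%E); [rewrite lte_fin oppr_lt0 | apply: integral_ge0r => w; exact: sqr_ge0].
apply: (le_lt_trans hfin); rewrite lte_fin.
have nR : 0 < n%:R :> R by rewrite ltr0n.
have hKn : B1 ^+ 2 * (K / n%:R) <= e / 4.
  rewrite mulrA ler_pdivrMr// [leRHS]mulrC -ler_pdivrMr//.
  apply/ltW; apply: lt_le_trans (truncnS_gt _) _; rewrite ler_nat.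
  exact: (ltnW (ltnW N2n)).
have hBD : B1 ^+ 2 * (D * D) = D1 * D1 by rewrite /D; field; rewrite gt_eqF.
have hBe : B1 ^+ 2 * (e / 4 / B1 ^+ 2) = e / 4 by field; rewrite gt_eqF.
have hDe : 2 * D1 * (e / (4 * (2 * D1 + 1))) <= e / 4.
  rewrite mulrA ler_pdivrMr//.
  have -> : e / 4 * (4 * (2 * D1 + 1)) = 2 * D1 * e + e by field.
  by rewrite lerDl ltW.
(* The square of [D1] cancels, and three errors of [e / 4] remain: diagonal, cross moment and
   bias. *)
rewrite (mulrDr (B1 ^+ 2)) (mulrDr (B1 ^+ 2)) hBD hBe.
lra.
Qed.
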